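(* For any integer $m\ge2$ there exists a real-analytic hypersurface $M\subset\mathbb{C}^2$ through the origin, $m$-nonminimal at the origin, with a divergent formal infinitesimal automorphism $L$ vanishing to order $m$ at $0$. In particular, for some $c\in\mathbb{R}$, the real flow $H^t(z,w)$ generated by $L$ consists of divergent formal automorphisms of the germ $(M,0)$ for all $t\in\mathbb{R}\setminus c\mathbb{Z}$.
   Context: Coordinates in $\mathbb{C}^2$ are $(z,w)$. A (smooth) real-analytic hypersurface $M\subset\mathbb{C}^2$ through $0$ is called $m$-nonminimal at the origin if in suitable local holomorphic coordinates near the origin it is given by $\operatorname{Im} w=(\operatorname{Re} w)^m\,\Phi(z,\bar z,\operatorname{Re} w)$, where the convergent power series $\Phi$ contains no pluriharmonic terms and $\Phi(z,\bar z,0)\not\equiv0$. Let $M=\{\theta(Z,\bar Z)=0\}$ near $0$ with $\theta$ a real-analytic defining function. A formal vector field $L=f_1\frac{\partial}{\partial z}+f_2\frac{\partial}{\partial w}$ (with $f_1,f_2$ formal power series in $(z,w)$) is a formal infinitesimal automorphism of $M$ if its real part $L+\bar L$ is formally tangent to $M$, i.e. $(L+\bar L)\theta$ is a formal power series multiple of $\theta$. It is divergent if at least one of its coefficient series is divergent. For a formal vector field $L$ with $L(0)=0$, its formal flow $H^t$ is the unique one-parameter group $t\mapsto H^t$ of formal invertible mappings $(\mathbb{C}^2,0)\to(\mathbb{C}^2,0)$, with all finite jets depending holomorphically on $t$, such that $\frac{d}{dt}H^t|_{t=0}=L$; the real flow is its restriction to $t\in\mathbb{R}$. A formal automorphism of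 $(M,0)$ is a formal invertible mapping $F:(\mathbb{C}^2,0)\to(\mathbb{C}^2,0)$ (a pair of formal power series without constant term and with invertible linear part) such that $\theta(F(Z),\bar F(\bar Z))=\lambda(Z,\bar Z)\theta(Z,\bar Z)$ for some formal power series $\lambda$ with nonzero constant term; it is divergent if at least one of its components is a divergent series. *)

(* Defs.v *)
From HB Require Import structures.
From mathcomp Require Import all_boot all_order all_algebra.
(* The notations of mpoly clash with those of mathcomp-analysis. *)
From mathcomp Require Import -(notations) mpoly.
From mathcomp Require Import all_classical all_reals all_analysis.
From mathcomp Require Import complex.

Set Implicit Arguments.
Unset Strict Implicit.
Unset Printing Implicit Defensive.

Import Order.TTheory GRing.Theory Num.Theory numFieldNormedType.Exports.

Local Open Scope classical_set_scope.
Local Open Scope ring_scope.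

(* The complex numbers as a numClosedFieldType, so that the generic topology
   of numeric fields applies to them. *)
Definition Cplx (R : realType) : numClosedFieldType := R[i]%C.

Definition of_real (R : realType) (t : R) : Cplx R := t%:C%C.

(* A formal power series in n variables, given by its coefficients. *)
Definition fps (K : Type) (n : nat) : Type := multinom n -> K.

Section FormalSeries.
Variable K : comNzRingType.
Implicit Types n k : nat.

Definition ftrunc n (d : nat) (f : fps K n) : mpoly n K :=
  \sum_(a : bmultinom n d.+1) f a *: mpolyX K a.

Definition fvar n (i : 'I_n) : fps K n := fun a => (a == mnm1 i)%:R.

(* Only terms of degree at most |a| contribute to the coefficient of index a. *)
Definition fmul n (f g : fps K n) : fps K n := fun a =>
  mcoeff a (ftrunc (mdeg a) f * ftrunc (mdeg a) g).

(* The series f (g_1, ..., g_k).  Truncating at |a| is legitimate when all the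
   g_i have zero constant term, which holds in every use below. *)
Definition fcomp k n (f : fps K k) (g : 'I_k -> fps K n) : fps K n := fun a =>
  mcoeff a (comp_mpoly [tuple ftrunc (mdeg a) (g i) | i < k]
                       (ftrunc (mdeg a) f)).

Definition fderiv n (i : 'I_n) (f : fps K n) : fps K n := fun a =>
  f (mnm_add a (mnm1 i)) *+ (a i).+1.

(* A pair of series is either a formal mapping of C^2 or the pair of
   coefficients of a formal vector field. *)
Definition fmap2 : Type := 'I_2 -> fps K 2.

Definition fid : fmap2 := fun i => fvar i.

Definition fmap_comp (F G : fmap2) : fmap2 := fun i => fcomp (F i) G.

Definition jac0 (F : fmap2) : 'M[K]_2 := \matrix_(i, j) F i (mnm1 j).

End FormalSeries.

Section FormalMaps.
Variable K : fieldType.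

Definition formal_invertible (F : fmap2 K) : Prop :=
  (forall i, F i mnm0 = 0) /\ jac0 F \in unitmx.

Definition vanishes_to_order (m : nat) (L : fmap2 K) : Prop :=
  (forall i a, (mdeg a < m)%N -> L i a = 0) /\
  (exists i a, mdeg a = m /\ L i a <> 0).

End FormalMaps.

(* Series in (Z, Zbar) = (z, w, zbar, wbar) are series in 2 + 2 variables. *)
Section Polarization.
Variable K : numClosedFieldType.
Implicit Types (f : fps K 2) (T : fps K (2 + 2)) (F L : fmap2 K).

Definition in_Z f : fps K (2 + 2) := fcomp f (fun i => fvar K (lshift 2 i)).

(* fbar_in_Zbar f is the series fbar(Zbar), with conjugated coefficients. *)
Definition fbar_in_Zbar f : fps K (2 + 2) :=
  fcomp (fun a => (f a)^*) (fun i => fvar K (rshift 2 i)).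

(* T (F(Z), Fbar(Zbar)) *)
Definition pullback T F : fps K (2 + 2) :=
  fcomp T (fun i => match fintype.split i with
                    | inl j => in_Z (F j)
                    | inr j => fbar_in_Zbar (F j)
                    end).

(* (L + Lbar) T, where L = L_0 d/dz + L_1 d/dw *)
Definition real_part_apply L T : fps K (2 + 2) := fun a =>
  \sum_(i < 2) (fmul (in_Z (L i)) (fderiv (lshift 2 i) T) a
              + fmul (fbar_in_Zbar (L i)) (fderiv (rshift 2 i) T) a).

Definition formal_infinitesimal_automorphism T L : Prop :=
  exists lambda : fps K (2 + 2), real_part_apply L T = fmul lambda T.

Definition formal_automorphism T F : Prop :=
  formal_invertible F /\
  exists lambda : fps K (2 + 2),
    lambda mnm0 <> 0 /\ pullback T F = fmul lambda T.

End Polarization.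

Section Analytic.
Variable R : realType.
Local Notation C := (Cplx R).
Implicit Types (n : nat) (M : set 'rV[C]_2).

Definition abs_summable_at n (f : fps C n) (x : 'I_n -> C) : Prop :=
  summable [set: multinom n]
    (fun a => (ComplexField.Normc.normc (f a * \prod_(i < n) x i ^+ a i))%:E).

Definition feval n (f : fps C n) (x : 'I_n -> C) : C :=
  limn (fun d => meval x (ftrunc d f)).

Definition convergent n (f : fps C n) : Prop :=
  exists r : R, 0 < r /\
    forall x : 'I_n -> C, (forall i, `|x i| < of_real r) -> abs_summable_at f x.

Definition divergent (F : fmap2 C) : Prop := exists i, ~ convergent (F i).

Definition polydisc (p : 'rV[C]_2) (r : R) : set 'rV[C]_2 :=
  [set Z | forall i, `|Z 0 i - p 0 i| < of_real r].

(* The point (Z, Zbar) of C^4. *)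
Definition with_conj (Z : 'rV[C]_2) : 'I_(2 + 2) -> C :=
  row_mx Z (map_mx Num.conj Z) 0.

(* T is the Taylor series at p, in (Z - p, conj (Z - p)), of a real-valued
   real-analytic function theta with nonzero differential at p, and M is the
   zero set of theta near p. *)
Definition defining_series M (p : 'rV[C]_2) (T : fps C (2 + 2)) : Prop :=
  (exists i, T (mnm1 i) <> 0) /\
  exists r : R, 0 < r /\ forall Z, polydisc p r Z ->
    [/\ abs_summable_at T (with_conj (Z - p)),
        feval T (with_conj (Z - p)) \is Num.real &
        M Z <-> feval T (with_conj (Z - p)) = 0].

Definition real_analytic_hypersurface M : Prop :=
  forall p, M p -> exists T, defining_series M p T.

Definition local_holomorphic_coordinates (F : fmap2 C) : Prop :=
  formal_invertible F /\ forall i, convergent (F i).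

(* The variables of Phi are (z, zbar, Re w).  "No pluriharmonic terms" means
   Phi (z, 0, u) = Phi (0, zbar, u) = 0 identically in u = Re w. *)
Definition nonminimal_at_origin (m : nat) M : Prop :=
  exists (F : fmap2 C) (Phi : fps C 3),
  [/\ local_holomorphic_coordinates F,
      convergent Phi /\
      (exists r : R, 0 < r /\ forall (z : C) (u : R),
         `|z| < of_real r -> `|u| < r ->
         feval Phi (tnth [tuple z; z^*; of_real u]) \is Num.real),
      (forall j l, Phi (Multinom [tuple j; 0%N; l]) = 0 /\
                   Phi (Multinom [tuple 0%N; j; l]) = 0),
      (exists j k, Phi (Multinom [tuple j; k; 0%N]) <> 0) &
      exists r : R, 0 < r /\ forall Z, polydisc 0 r Z ->
        let z := feval (F 0) (Z 0) in
        let w := feval (F 1) (Z 0) in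
        M Z <-> 'Im w = 'Re w ^+ m * feval Phi (tnth [tuple z; z^*; 'Re w])].

(* Each coefficient of H^t is an entire function of the complex time t; these
   conditions determine H from L. *)
Definition formal_flow (L : fmap2 C) (H : C -> fmap2 C) : Prop :=
  [/\ forall t, formal_invertible (H t),
      H 0 = fid C,
      forall s t, H (s + t) = fmap_comp (H s) (H t),
      forall i a (t : C), derivable (fun u : C => H u i a) t 1 &
      forall i a, is_derive (0 : C) (1 : C) (fun u : C => H u i a) (L i a)].

End Analytic.

(* Main.v *)
From HB Require Import structures.
Require Import Defs.
From mathcomp Require Import all_boot all_order all_algebra.
From mathcomp Require Import -(notations) mpoly.
From mathcomp Require Import all_classical all_reals all_analysis.
From mathcomp Require Import complex ring lra zify.
From mathcomp Require ssrcomplements.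

Set Implicit Arguments.
Unset Strict Implicit.
Unset Printing Implicit Defensive.

Import Order.TTheory GRing.Theory Num.Theory numFieldNormedType.Exports.

Local Open Scope classical_set_scope.
Local Open Scope ring_scope.

(* Write m = n + 1 and let B be the divergent solution of
   w^m B' = (1 - w^n) B - 1, with coefficients the products of the 1 + j n.  The
   field L = w^m B d/dw + (1/2) w^m B' z d/dz is invariant under the rotations
   of z.  Tangency of Re L to a hypersurface Im w = u^m s(|z|^2, u), u = Re w, is
   a differential equation for s with divergent coefficients.  It nevertheless
   has a convergent solution: there are P, Q with
   P B(w) - Q B(wbar) + 2 i |z|^2 = 0 on the hypersurface, and eliminating B(w)
   and B(wbar) turns the equation into a system of ordinary differential
   equations in rho = |z|^2 with polynomial right hand side and parameter u,
   which is solved by majorants.  Conversely, uniqueness for linear equations in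
   rho gives the first integral and the tangency.

   The Lie series exp (t L) multiplies theta by a unit.  The coefficients of L
   are nonnegative, so those of exp (t L) dominate those of t L for t > 0 and
   exp (t L) diverges.  For t < 0, convergence of exp (t L) would imply that of
   its inverse exp (- t L).  Hence c = 0. *)

(** * Formal power series *)

(** Put mu = w^-1 exp(-1 / (n w^n)), which solves w^m mu' = (1 - w^n) mu. In the coordinates W = B /
    mu, Z = z mu^(-1/2), which make sense only formally and off w = 0, the field becomes the
    dilation - (W d/dW + (1/2) Z d/dZ), and it preserves the quadric Im W + |Z|^2 = 0. Multiplied by
    2 i |mu|, the equation of this quadric is P B(w) - Q B(wbar) + 2 i |z|^2 = 0 with P^2 = mu(wbar)
    / mu(w) and Q = 1 / P. Since W' = - 1 / (w^m mu), it involves B only through an integral from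
    wbar to w; this is why the hypersurface can be analytic although B diverges. The essential
    singularity of mu cancels in P because w - wbar = 2 i u^m s. This heuristic guides the algebra,
    in which mu itself does not appear: only its logarithmic derivative (1 - w^n) / w^m enters, B is
    composed formally, and convergence is required of s alone. *)

Section Ring.
Variables (K : comNzRingType) (n : nat).
Implicit Types (f g h : fps K n) (a b : multinom n) (p q : mpoly n K) (d e : nat).

HB.instance Definition _ := Choice.copy (fps K n) (multinom n -> K).
HB.instance Definition _ := GRing.Zmodule.copy (fps K n) (multinom n -> K).

Definition fconst (c : K) : fps K n := fun a => c *+ (a == mnm0).

Definition fps_of_mpoly p : fps K n := fun a => mcoeff a p.

Lemma mcoeff_ftrunc d f a :
  mcoeff a (ftrunc d f) = if (mdeg a <= d)%N then f a else 0.
Proof.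
rewrite /ftrunc; case: ifP => [led|ltd]; first by rewrite mcoeff_mpoly.
rewrite raddf_sum big1 //= => b _; rewrite mcoeffZ mcoeffX.
case: eqP => [eab|]; last by rewrite mulr0.
by have := bmdeg b; rewrite eab ltnS ltd.
Qed.

(** A coefficient of a product depends only on the coefficients of the factors of no larger degree.
    Hence any sufficiently long truncation may replace a series, and the ring axioms for series
    descend from those for polynomials. *)
Lemma mcoeffM_congr a p p' q q' :
  (forall b, (mdeg b <= mdeg a)%N -> mcoeff b p = mcoeff b p') ->
  (forall b, (mdeg b <= mdeg a)%N -> mcoeff b q = mcoeff b q') ->
  mcoeff a (p * q) = mcoeff a (p' * q').
Proof.
move=> epp eqq; rewrite !mcoeffM; apply: eq_bigr => -[b c] _ /=.
by rewrite epp ?eqq // -ltnS bmdeg.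
Qed.

Lemma fmul_trunc d f g a : (mdeg a <= d)%N ->
  fmul f g a = mcoeff a (ftrunc d f * ftrunc d g).
Proof.
move=> led; apply: mcoeffM_congr => b leb; rewrite !mcoeff_ftrunc leb;
  by rewrite (leq_trans leb led).
Qed.

Lemma fmulE f g a : fmul f g a =
  \sum_(k : bmultinom n (mdeg a).+1 * bmultinom n (mdeg a).+1
        | a == mnm_add k.1 k.2) f k.1 * g k.2.
Proof.
rewrite /fmul mcoeffM; apply: eq_bigr => -[b c] _ /=.
by rewrite !mcoeff_ftrunc -ltnS bmdeg -ltnS bmdeg.
Qed.

Lemma fmul_of_mpoly p q :
  fps_of_mpoly (p * q) = fmul (fps_of_mpoly p) (fps_of_mpoly q).
Proof.
apply/funext => a; apply: mcoeffM_congr => b leb.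
  by rewrite mcoeff_ftrunc leb.
by rewrite mcoeff_ftrunc leb.
Qed.

Fact fmulA : associative (@fmul K n).
Proof.
move=> f g h; apply/funext => a; set d := mdeg a.
rewrite !(@fmul_trunc d) //.
transitivity (mcoeff a (ftrunc d f * (ftrunc d g * ftrunc d h))).
  apply: mcoeffM_congr => // b leb.
  by rewrite mcoeff_ftrunc leb (@fmul_trunc d).
rewrite mulrA; apply: mcoeffM_congr => // b leb.
by rewrite mcoeff_ftrunc leb (@fmul_trunc d).
Qed.

Fact fmulC : commutative (@fmul K n).
Proof. by move=> f g; apply/funext => a; rewrite /fmul mulrC. Qed.

Fact fmul1 : left_id (fconst 1) (@fmul K n).
Proof.
move=> f; apply/funext => a; rewrite /fmul -[RHS]mulr1.
transitivity (mcoeff a (1 * ftrunc (mdeg a) f)).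
  apply: mcoeffM_congr => // b leb.
  by rewrite mcoeff_ftrunc leb mcoeff1 /fconst -mulr_natr mul1r.
by rewrite mul1r mcoeff_ftrunc leqnn mulr1.
Qed.

Fact fmulDl : left_distributive (@fmul K n) +%R.
Proof.
move=> f g h; apply/funext => a; rewrite /= [in RHS]/GRing.add /=.
rewrite !(@fmul_trunc (mdeg a)) // -mcoeffD -mulrDl.
by apply: mcoeffM_congr => // b leb; rewrite mcoeffD !mcoeff_ftrunc leb.
Qed.

Fact fone_neq0 : fconst 1 != 0.
Proof.
apply/eqP => /(congr1 (fun f : fps K n => f mnm0)).
by rewrite /fconst eqxx => /eqP; rewrite oner_eq0.
Qed.

HB.instance Definition _ :=
  GRing.Zmodule_isComNzRing.Build (fps K n) fmulA fmulC fmul1 fmulDl fone_neq0.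

Lemma faddE f g a : (f + g) a = f a + g a. Proof. by []. Qed.
Lemma foppE f a : (- f) a = - f a. Proof. by []. Qed.
Lemma fsubE f g a : (f - g) a = f a - g a. Proof. by []. Qed.
Lemma fmul_mulE f g : fmul f g = f * g. Proof. by []. Qed.
Lemma foneE a : (1 : fps K n) a = (a == mnm0)%:R.
Proof. by []. Qed.

Lemma fsumE (I : Type) (r : seq I) (P : pred I) (F : I -> fps K n) a :
  (\sum_(i <- r | P i) F i) a = \sum_(i <- r | P i) F i a.
Proof. by elim/big_rec2: _ => // i x y _ <-. Qed.

Lemma fconst_is_additive : zmod_morphism fconst.
Proof. by move=> c e; apply/funext => a; rewrite fsubE /fconst -mulrnBl. Qed.
HB.instance Definition _ :=
  GRing.isZmodMorphism.Build K (fps K n) fconst fconst_is_additive.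

Lemma fconstM c f a : (fconst c * f) a = c * f a.
Proof.
transitivity (mcoeff a (mpolyC n c * ftrunc (mdeg a) f)).
  rewrite -fmul_mulE /fmul; apply: mcoeffM_congr => // b leb.
  by rewrite mcoeff_ftrunc leb mcoeffC /fconst mulr_natr.
by rewrite mcoeffCM mcoeff_ftrunc leqnn.
Qed.

Lemma fconst_is_multiplicative : monoid_morphism fconst.
Proof.
split=> // c e; apply/funext => a.
by rewrite fconstM /fconst mulrnAr.
Qed.
HB.instance Definition _ :=
  GRing.isMonoidMorphism.Build K (fps K n) fconst fconst_is_multiplicative.

Lemma fps_of_mpoly_is_additive : zmod_morphism fps_of_mpoly.
Proof. by move=> p q; apply/funext => a; rewrite fsubE /fps_of_mpoly mcoeffB. Qed.
HB.instance Definition _ :=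
  GRing.isZmodMorphism.Build (mpoly n K) (fps K n) fps_of_mpoly
    fps_of_mpoly_is_additive.

Lemma fps_of_mpoly_is_multiplicative : monoid_morphism fps_of_mpoly.
Proof.
split=> [|p q]; last by rewrite fmul_of_mpoly.
by apply/funext => a; rewrite /fps_of_mpoly mcoeff1.
Qed.
HB.instance Definition _ :=
  GRing.isMonoidMorphism.Build (mpoly n K) (fps K n) fps_of_mpoly
    fps_of_mpoly_is_multiplicative.

Lemma fps_of_mpolyC c : fps_of_mpoly (mpolyC n c) = fconst c.
Proof. by apply/funext => a; rewrite /fps_of_mpoly mcoeffC mulr_natr. Qed.

Lemma fps_of_mpolyX i : fps_of_mpoly (mpolyX K (mnm1 i)) = fvar K i.
Proof.
by apply/funext => a; rewrite /fps_of_mpoly mcoeffX /fvar eq_sym.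
Qed.

(** The adic filtration. [ord_ge d (f - g)] is congruence modulo terms of degree at least [d], and
    equality of series is proved by establishing it for every [d]. *)
Definition ord_ge d f := forall a, (mdeg a < d)%N -> f a = 0.

Lemma ord_ge0 f : ord_ge 0 f. Proof. by []. Qed.

Lemma ord_geW d e f : (e <= d)%N -> ord_ge d f -> ord_ge e f.
Proof. by move=> led fd a ltae; apply: fd; apply: leq_trans led. Qed.

Lemma ord_geD d f g : ord_ge d f -> ord_ge d g -> ord_ge d (f + g).
Proof. by move=> fd gd a lta; rewrite faddE fd ?gd ?addr0. Qed.

Lemma ord_geN d f : ord_ge d f -> ord_ge d (- f).
Proof. by move=> fd a lta; rewrite foppE fd ?oppr0. Qed.

Lemma ord_geB d f g : ord_ge d f -> ord_ge d g -> ord_ge d (f - g).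
Proof. by move=> fd gd; apply/ord_geD/ord_geN. Qed.

Lemma ord_ge_zero d : ord_ge d 0. Proof. by []. Qed.

Lemma ord_ge_sum (I : Type) (r : seq I) (P : pred I) (F : I -> fps K n) d :
  (forall i, P i -> ord_ge d (F i)) -> ord_ge d (\sum_(i <- r | P i) F i).
Proof.
move=> Fd; elim/big_ind: _ => //.
exact: ord_geD.
Qed.

Lemma ord_geM d e f g : ord_ge d f -> ord_ge e g -> ord_ge (d + e) (f * g).
Proof.
move=> fd ge a lta; rewrite -fmul_mulE fmulE big1 // => -[b c] /= /eqP ea.
case: (ltnP (mdeg b) d) => [ltb|leb]; first by rewrite fd // mul0r.
rewrite ge ?mulr0 //.
have: (mdeg b + mdeg c < d + e)%N by rewrite -mdegD -ea.
by rewrite !ltnNge; apply: contra => lec; rewrite leq_add.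
Qed.

Lemma ord_geMl d f g : ord_ge d f -> ord_ge d (f * g).
Proof. by move=> fd; rewrite -[d]addn0; apply: ord_geM. Qed.

Lemma ord_geMr d f g : ord_ge d g -> ord_ge d (f * g).
Proof. by rewrite mulrC; apply: ord_geMl. Qed.

Lemma ord_geX d f k : ord_ge d f -> ord_ge (d * k) (f ^+ k).
Proof.
move=> fd; elim: k => [|k IHk]; first by rewrite muln0.
by rewrite mulnS exprS; apply: ord_geM.
Qed.

Lemma ord_ge_var (i : 'I_n) : ord_ge 1 (fvar K i).
Proof.
move=> a; rewrite ltnS leqn0 mdeg_eq0 => /eqP ->.
by rewrite /fvar eq_sym mnm1_eq0.
Qed.

Lemma ord_ge1P f : ord_ge 1 f <-> f mnm0 = 0.
Proof.
split=> [f1|f0 a]; first by rewrite f1 // mdeg0.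
by rewrite ltnS leqn0 mdeg_eq0 => /eqP ->.
Qed.

Lemma ord_ge_eq f g : (forall d, ord_ge d (f - g)) -> f = g.
Proof.
move=> fg; apply/funext => a; apply/eqP; rewrite -subr_eq0; apply/eqP.
exact: (fg (mdeg a).+1).
Qed.

Lemma ord_ge_trunc d f : ord_ge d.+1 (f - fps_of_mpoly (ftrunc d f)).
Proof.
by move=> a; rewrite ltnS fsubE /fps_of_mpoly mcoeff_ftrunc => ->; rewrite subrr.
Qed.

(** Together with [ord_ge_trunc] this reduces identities between continuous operations on series to
    constants and variables. *)
Lemma fps_of_mpoly_ind (P : fps K n -> Prop) :
  (forall c, P (fconst c)) -> (forall i, P (fvar K i)) ->
  (forall f g, P f -> P g -> P (f + g)) ->
  (forall f g, P f -> P g -> P (f * g)) ->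
  forall p, P (fps_of_mpoly p).
Proof.
move=> PC PX PD PM p; rewrite [p]mpolyE raddf_sum /=.
elim/big_ind: _ => [||m _]; [by rewrite -(raddf0 fconst)|exact: PD|].
rewrite -mul_mpolyC rmorphM /= fps_of_mpolyC; apply: (PM) => //.
rewrite mpolyXE_id rmorph_prod.
elim/big_ind: _ => [||i _]; [by rewrite -(rmorph1 fconst)|exact: PM|].
rewrite rmorphXn /= fps_of_mpolyX; elim: (m i) => [|k IHk].
  by rewrite expr0 -(rmorph1 fconst).
by rewrite exprS; apply: PM.
Qed.

End Ring.

(** * Substitution and continuous algebra morphisms *)

Section Substitution.
Variables (K : comNzRingType) (k n : nat).
Implicit Types (f g : fps K k) (p q : mpoly k K) (G : 'I_k -> fps K n).

Definition psubst G (p : mpoly k K) : fps K n := mmap (@fconst K n) G p.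

Lemma psubst_is_additive G : zmod_morphism (psubst G).
Proof. by move=> p q; rewrite /psubst mmapB. Qed.
HB.instance Definition _ G :=
  GRing.isZmodMorphism.Build (mpoly k K) (fps K n) (psubst G)
    (psubst_is_additive G).

Lemma psubst_is_multiplicative G : monoid_morphism (psubst G).
Proof. by have [hM h1] := mmap_is_multiplicative G (@fconst K n). Qed.
HB.instance Definition _ G :=
  GRing.isMonoidMorphism.Build (mpoly k K) (fps K n) (psubst G)
    (psubst_is_multiplicative G).

Lemma psubstC G c : psubst G (mpolyC k c) = fconst c.
Proof. exact: mmapC. Qed.

Lemma psubstX G i : psubst G (mpolyX K (mnm1 i)) = G i.
Proof. by rewrite /psubst mmapX mmap1U. Qed.

Lemma fps_of_comp_mpoly (lq : k.-tuple (mpoly n K)) p :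
  fps_of_mpoly (comp_mpoly lq p) =
  psubst (fun i => fps_of_mpoly (tnth lq i)) p.
Proof.
rewrite /comp_mpoly /psubst /mmap raddf_sum /=; apply: eq_bigr => m _.
rewrite rmorphM /= fps_of_mpolyC; congr (_ * _).
by rewrite /mmap1 rmorph_prod; apply: eq_bigr => i _; rewrite rmorphXn.
Qed.

Lemma ord_ge_congrM d (f f' g g' : fps K n) :
  ord_ge d (f - f') -> ord_ge d (g - g') -> ord_ge d (f * g - f' * g').
Proof.
move=> ff gg; rewrite (_ : _ - _ = (f - f') * g + f' * (g - g')); last by ring.
by apply: ord_geD; [apply: ord_geMl|apply: ord_geMr].
Qed.

Lemma ord_ge_congrX d (f f' : fps K n) j :
  ord_ge d (f - f') -> ord_ge d (f ^+ j - f' ^+ j).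
Proof.
move=> ff; elim: j => [|j IHj]; first by rewrite subrr.
by rewrite !exprS; apply: ord_ge_congrM.
Qed.

Lemma psubst_congr d G G' p :
  (forall i, ord_ge d (G i - G' i)) -> ord_ge d (psubst G p - psubst G' p).
Proof.
move=> GG; rewrite /psubst /mmap -sumrB; apply: ord_ge_sum => m _.
rewrite -mulrBr; apply: ord_geMr; rewrite /mmap1.
elim/big_rec2: _ => [|i f g _ fg]; first by rewrite subrr.
by apply: ord_ge_congrM => //; apply: ord_ge_congrX.
Qed.

Lemma psubst_ord d G p : (forall i, ord_ge 1 (G i)) ->
  (forall a, (mdeg a < d)%N -> mcoeff a p = 0) -> ord_ge d (psubst G p).
Proof.
move=> G1 pd; rewrite /psubst /mmap big_seq; apply: ord_ge_sum => m.
rewrite mcoeff_msupp => mp; apply: ord_geMr.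
have /ord_geW : (d <= mdeg m)%N.
  by rewrite leqNgt; apply: contra mp => /pd ->.
apply; rewrite /mmap1 mdegE.
elim/big_rec2: _ => [|i f l _ fl]; first exact: ord_ge0.
by apply: ord_geM => //; rewrite -[X in ord_ge X]mul1n; apply: ord_geX.
Qed.

Lemma fcompE d f G a : (forall i, ord_ge 1 (G i)) -> (mdeg a <= d)%N ->
  fcomp f G a = psubst G (ftrunc d f) a.
Proof.
move=> G1 led.
transitivity (psubst G (ftrunc (mdeg a) f) a).
  rewrite -[LHS]/(fps_of_mpoly (comp_mpoly _ _) a) fps_of_comp_mpoly.
  apply/eqP; rewrite -subr_eq0 -fsubE; apply/eqP.
  apply: (@psubst_congr (mdeg a).+1) => // i b ltb.
  by rewrite tnth_mktuple fsubE /fps_of_mpoly mcoeff_ftrunc -ltnS ltb subrr.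
apply/eqP; rewrite -subr_eq0 -fsubE -raddfB; apply/eqP.
apply: (@psubst_ord (mdeg a).+1) => // b; rewrite ltnS => leb.
by rewrite mcoeffB !mcoeff_ftrunc leb (leq_trans leb led) subrr.
Qed.

Lemma fcomp_trunc d f G : (forall i, ord_ge 1 (G i)) ->
  ord_ge d.+1 (fcomp f G - psubst G (ftrunc d f)).
Proof. by move=> G1 a; rewrite ltnS => led; rewrite fsubE (@fcompE d) ?subrr. Qed.

(** The algebra morphisms that respect the filtration. Substitutions, the embeddings into the
    variables (Z, Zbar) and Lie series are all of this kind, so that they can be compared on
    variables alone. *)
Record fhom (E : fps K k -> fps K n) : Prop := FHom {
  fhomD : forall f g, E (f + g) = E f + E g;
  fhomM : forall f g, E (f * g) = E f * E g;
  fhomC : forall c, E (fconst c) = fconst c;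
  fhom_ord : forall d f, ord_ge d f -> ord_ge d (E f)
}.

Lemma fcomp_fhom G : (forall i, ord_ge 1 (G i)) -> fhom (fun f => fcomp f G).
Proof.
move=> G1; split.
- move=> f g; apply/funext => a; rewrite faddE !(@fcompE (mdeg a)) //.
  rewrite -faddE -raddfD; congr (psubst G _ _).
  by apply/mpolyP => b; rewrite mcoeffD !mcoeff_ftrunc; case: ifP; rewrite ?addr0.
- move=> f g; apply/funext => a; rewrite (@fcompE (mdeg a)) //.
  pose d := mdeg a; apply/eqP; rewrite -subr_eq0 -fsubE; apply/eqP.
  have -> : psubst G (ftrunc d (f * g)) - fcomp f G * fcomp g G =
     psubst G (ftrunc d (f * g) - ftrunc d f * ftrunc d g)
   - (fcomp f G * fcomp g G - psubst G (ftrunc d f) * psubst G (ftrunc d g)).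
    rewrite raddfB /=; rewrite rmorphM /=; ring.
  apply: (@ord_geB _ _ d.+1) => //.
    apply: psubst_ord => // b; rewrite ltnS => leb.
    by rewrite mcoeffB mcoeff_ftrunc leb -fmul_mulE (@fmul_trunc _ _ d) ?subrr.
  by apply: ord_ge_congrM; apply: fcomp_trunc.
- move=> c; apply/funext => a; rewrite (@fcompE (mdeg a)) // -(psubstC G).
  congr (psubst G _ _); apply/mpolyP => b; rewrite mcoeff_ftrunc mcoeffC mulr_natr.
  case: ifPn => // nb; rewrite /fconst; case: eqP => // b0.
  by rewrite b0 mdeg0 in nb.
- move=> d f fd a lta; rewrite (@fcompE (mdeg a)) //.
  apply: (@psubst_ord d) => // b ltb; rewrite mcoeff_ftrunc fd //; by case: ifP.
Qed.

Section FhomTheory.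
Variables (E : fps K k -> fps K n) (hE : fhom E).

Lemma fhom0 : E 0 = 0.
Proof. by rewrite -(raddf0 (@fconst K k)) fhomC // raddf0. Qed.
Lemma fhom1 : E 1 = 1.
Proof. by rewrite -(rmorph1 (@fconst K k)) fhomC // rmorph1. Qed.
Lemma fhomN f : E (- f) = - E f.
Proof. by apply/eqP; rewrite -addr_eq0 -fhomD // addNr fhom0. Qed.
Lemma fhomB f g : E (f - g) = E f - E g.
Proof. by rewrite fhomD // fhomN. Qed.
Lemma fhomX f j : E (f ^+ j) = E f ^+ j.
Proof. by elim: j => [|j IHj]; rewrite ?fhom1 // !exprS fhomM // IHj. Qed.
Lemma fhom_sum (I : Type) (r : seq I) (P : pred I) (F : I -> fps K k) :
  E (\sum_(i <- r | P i) F i) = \sum_(i <- r | P i) E (F i).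
Proof. exact: (big_morph E (fhomD hE) fhom0). Qed.

End FhomTheory.

Lemma fhom_ext E E' : fhom E -> fhom E' ->
  (forall i, E (fvar K i) = E' (fvar K i)) -> E =1 E'.
Proof.
move=> hE hE' EE f; apply: ord_ge_eq => d.
pose p := fps_of_mpoly (ftrunc d f).
have Ep : E p = E' p.
  rewrite /p; apply: (@fps_of_mpoly_ind _ _ (fun h => E h = E' h)).
  - by move=> c; rewrite !fhomC.
  - exact: EE.
  - by move=> g h Eg Eh; rewrite !fhomD // Eg Eh.
  - by move=> g h Eg Eh; rewrite !fhomM // Eg Eh.
rewrite (_ : _ - _ = E (f - p) - E' (f - p)); last first.
  by rewrite !fhomB // Ep; ring.
have fp : ord_ge d (f - p) by apply: (ord_geW (leqnSn d)); apply: ord_ge_trunc.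
by apply: ord_geB; apply: fhom_ord.
Qed.

Lemma fcomp_var G i : (forall j, ord_ge 1 (G j)) -> fcomp (fvar K i) G = G i.
Proof.
move=> G1; apply/funext => a; rewrite (@fcompE (mdeg a).+1) // -[RHS]/(G i a).
rewrite -(psubstX G i); congr (psubst G _ _); apply/mpolyP => b.
rewrite mcoeff_ftrunc mcoeffX /fvar eq_sym; case: ifPn => // nb.
by case: eqP nb => // <-; rewrite mdeg1.
Qed.

(** Every such morphism is a substitution. Applied to a Lie series, this turns the exponential of a
    field into composition with a formal map. *)
Lemma fhomE E f : fhom E -> E f = fcomp f (fun i => E (fvar K i)).
Proof.
move=> hE; have E1 i : ord_ge 1 (E (fvar K i)).
  by apply: (fhom_ord hE); apply: ord_ge_var.
by apply: (fhom_ext hE (fcomp_fhom E1)) => i; rewrite fcomp_var.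
Qed.

End Substitution.

Lemma fhom_comp (K : comNzRingType) k n l (E : fps K k -> fps K n)
    (E' : fps K n -> fps K l) : fhom E -> fhom E' -> fhom (E' \o E).
Proof.
move=> hE hE'; split=> [f g|f g|c|d f fd] /=.
- by rewrite !fhomD.
- by rewrite !fhomM.
- by rewrite !fhomC.
- by do 2!apply: fhom_ord => //.
Qed.

(** * Partial derivatives and the chain rule *)

Section Derivation.
Variables (K : comNzRingType) (n : nat).
Implicit Types (f g : fps K n) (i : 'I_n).

Lemma fderivD i f g : fderiv i (f + g) = fderiv i f + fderiv i g.
Proof. by apply/funext => a; rewrite /fderiv !faddE mulrnDl. Qed.

Lemma fderiv_trunc d i f a : (mdeg a < d)%N ->
  fderiv i f a = mcoeff a (mderiv i (ftrunc d f)).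
Proof. by move=> ltd; rewrite mcoeff_deriv mcoeff_ftrunc mdegD mdeg1 addn1 ltd. Qed.

Lemma fderivM i f g : fderiv i (f * g) = fderiv i f * g + f * fderiv i g.
Proof.
apply/funext => a; pose d := (mdeg a).+1.
have ad : mdeg (mnm_add a (mnm1 i)) = d by rewrite mdegD mdeg1 addn1.
rewrite [LHS]/fderiv -!fmul_mulE (@fmul_trunc _ _ d) ?ad // -mcoeff_deriv mderivM.
rewrite mcoeffD; congr (_ + _); apply: mcoeffM_congr => b leb.
- by rewrite mcoeff_ftrunc leb (@fderiv_trunc d).
- by rewrite !mcoeff_ftrunc leb (leq_trans leb).
- by rewrite !mcoeff_ftrunc leb (leq_trans leb).
- by rewrite mcoeff_ftrunc leb (@fderiv_trunc d).
Qed.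

Lemma fderivC i c : fderiv i (fconst c) = 0 :> fps K n.
Proof.
apply/funext => a; rewrite /fderiv /fconst mnmD_eq0 mnm1_eq0 andbF.
by rewrite mulr0n mul0rn.
Qed.

Lemma fderiv_var i j : fderiv i (fvar K j) = (i == j)%:R :> fps K n.
Proof.
apply/funext => a; rewrite (@fderiv_trunc (mdeg a).+2) //.
have -> : ftrunc (mdeg a).+2 (fvar K j) = mpolyX K (mnm1 j).
  apply/mpolyP => b; rewrite mcoeff_ftrunc mcoeffX /fvar eq_sym.
  by case: ifPn => // nb; case: eqP nb => // <-; rewrite mdeg1.
rewrite mderivX mnm1E eq_sym; case: eqP => [->|_].
  rewrite scale1r (_ : mnm_sub _ _ = mnm0); last first.
    by apply/mnmP => l; rewrite mnmBE subnn mnm0E.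
  by rewrite mcoeffX eq_sym.
by rewrite scale0r mcoeff0.
Qed.

Lemma fderiv_ord d i f : ord_ge d.+1 f -> ord_ge d (fderiv i f).
Proof.
by move=> fd a lta; rewrite /fderiv fd ?mul0rn // mdegD mdeg1 addn1.
Qed.

Lemma fderiv0 i : fderiv i 0 = 0 :> fps K n.
Proof. by rewrite -{1}(raddf0 (@fconst K n)) fderivC. Qed.
Lemma fderiv1 i : fderiv i 1 = 0 :> fps K n.
Proof. by rewrite -(rmorph1 (@fconst K n)) fderivC. Qed.
Lemma fderivN i f : fderiv i (- f) = - fderiv i f.
Proof. by apply/eqP; rewrite -addr_eq0 -fderivD addNr fderiv0. Qed.
Lemma fderivB i f g : fderiv i (f - g) = fderiv i f - fderiv i g.
Proof. by rewrite fderivD fderivN. Qed.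
Lemma fderivX i f j : fderiv i (f ^+ j) = f ^+ j.-1 * fderiv i f *+ j.
Proof.
elim: j => [|j IHj]; first by rewrite fderiv1 mulr0n.
rewrite exprS fderivM IHj mulrS mulrnAr mulrA -exprS [fderiv i f * _]mulrC.
by case: j {IHj} => [|j] //; rewrite !mulr0n.
Qed.
Lemma fderiv_comm i j f : fderiv i (fderiv j f) = fderiv j (fderiv i f).
Proof.
apply/funext => a; rewrite /fderiv -!mulrnA; congr (f _ *+ _).
  by apply/mnmP => l; rewrite !mnmDE addnAC.
rewrite !mnmDE !mnm1E [(j == i)]eq_sym; case: (eqVneq i j) => [->|nij] //.
by rewrite ?addn0 mulnC.
Qed.

End Derivation.

(** The defect [D] of the chain rule is a derivation along [E] that vanishes on constants and
    variables, hence on polynomials. Since derivation loses one degree, the truncation is taken one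
    degree beyond the order to be reached. *)
Lemma fderiv_hom (K : comNzRingType) k n (E : fps K k -> fps K n) i f :
  fhom E -> fderiv i (E f) = \sum_j E (fderiv j f) * fderiv i (E (fvar K j)).
Proof.
move=> hE; apply: ord_ge_eq => d.
pose D g := fderiv i (E g) - \sum_j E (fderiv j g) * fderiv i (E (fvar K j)).
have DD g h : D (g + h) = D g + D h.
  rewrite /D (fhomD hE) fderivD.
  have -> : \sum_j E (fderiv j (g + h)) * fderiv i (E (fvar K j)) =
    \sum_j E (fderiv j g) * fderiv i (E (fvar K j)) +
    \sum_j E (fderiv j h) * fderiv i (E (fvar K j)).
    by rewrite -big_split; apply: eq_bigr => j _; rewrite fderivD (fhomD hE) mulrDl.
  by ring.
have DM g h : D (g * h) = D g * E h + E g * D h.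
  rewrite /D (fhomM hE) fderivM.
  have -> : \sum_j E (fderiv j (g * h)) * fderiv i (E (fvar K j)) =
    (\sum_j E (fderiv j g) * fderiv i (E (fvar K j))) * E h +
    E g * (\sum_j E (fderiv j h) * fderiv i (E (fvar K j))).
    rewrite mulr_suml mulr_sumr -big_split; apply: eq_bigr => j _ /=.
    by rewrite fderivM (fhomD hE) !(fhomM hE); ring.
  by ring.
have Dp p : D (fps_of_mpoly p) = 0.
  apply: (@fps_of_mpoly_ind _ _ (fun h => D h = 0)) => [c|j|g h Dg Dh|g h Dg Dh].
  - rewrite /D (fhomC hE) fderivC big1 ?subr0 // => j _.
    by rewrite fderivC (fhom0 hE) mul0r.
  - rewrite /D (bigD1 j) //= fderiv_var eqxx (fhom1 hE) mul1r big1 ?addr0 ?subrr //.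
    by move=> l nlj; rewrite fderiv_var (negbTE nlj) (fhom0 hE) mul0r.
  - by rewrite DD Dg Dh addr0.
  - by rewrite DM Dg Dh mulr0 mul0r addr0.
rewrite -/(D f) -(subrK (fps_of_mpoly (ftrunc d.+1 f)) f) DD Dp addr0.
have fd : ord_ge d.+1 (f - fps_of_mpoly (ftrunc d.+1 f)).
  by apply: (ord_geW (leqnSn _)); apply: ord_ge_trunc.
apply: ord_geB; first by apply/fderiv_ord/(fhom_ord hE).
by apply: ord_ge_sum => j _; apply/ord_geMl/(fhom_ord hE)/fderiv_ord.
Qed.

Lemma triangle_sum (V : zmodType) (F : nat -> nat -> V) N :
  (forall i j, (N <= i + j)%N -> F i j = 0) ->
  \sum_(i < N) \sum_(j < N) F i j = \sum_(k < N) \sum_(i < k.+1) F i (k - i)%N.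
Proof.
move=> F0; transitivity (\sum_(i < N) \sum_(j < N - i) F i j).
  apply: eq_bigr => i _; rewrite [RHS](big_ord_widen N (fun j => F i j)) ?leq_subr //.
  rewrite [LHS](bigID (fun j : 'I_N => (j < N - i)%N)) /= [X in _ + X]big1 ?addr0 //.
  by move=> j; rewrite -leqNgt leq_subLR => /F0.
elim: N {F0} => [|N IHN]; first by rewrite !big_ord0.
rewrite big_ord_recr [RHS]big_ord_recr /= -IHN big_ord_recr /= !subSnn subnn.
rewrite big_ord_recl big_ord0 addr0 addrA; congr (_ + _).
rewrite -big_split /=; apply: eq_bigr => i _.
by rewrite subSn ?(ltnW (ltn_ord i)) // big_ord_recr.
Qed.

(** * Formal vector fields and Lie series *)

Section VectorField.
Variables (K : comNzRingType) (n : nat) (V : 'I_n -> fps K n).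
Hypothesis V2 : forall i, ord_ge 2 (V i).
Implicit Types f g : fps K n.

Definition vf f : fps K n := \sum_i V i * fderiv i f.

Lemma vfD f g : vf (f + g) = vf f + vf g.
Proof.
by rewrite /vf -big_split; apply: eq_bigr => i _ /=; rewrite fderivD mulrDr.
Qed.

Lemma vfM f g : vf (f * g) = vf f * g + f * vf g.
Proof.
rewrite /vf mulr_suml mulr_sumr -big_split; apply: eq_bigr => i _ /=.
by rewrite fderivM; ring.
Qed.

Lemma vfC c : vf (fconst c) = 0.
Proof. by rewrite /vf big1 // => i _; rewrite fderivC mulr0. Qed.

Lemma vf_var i : vf (fvar K i) = V i.
Proof.
rewrite /vf (bigD1 i) //= fderiv_var eqxx mulr1 big1 ?addr0 // => j nji.
by rewrite fderiv_var (negbTE nji) mulr0.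
Qed.

Lemma vf0 : vf 0 = 0.
Proof. by rewrite -{1}(raddf0 (@fconst K n)) vfC. Qed.

Lemma vfB f g : vf (f - g) = vf f - vf g.
Proof.
have vfN h : vf (- h) = - vf h by apply/eqP; rewrite -addr_eq0 -vfD addNr vf0.
by rewrite vfD vfN.
Qed.

Lemma vfZ c f : vf (fconst c * f) = fconst c * vf f.
Proof. by rewrite vfM vfC mul0r add0r. Qed.

Lemma vf_sum (I : Type) (r : seq I) (P : pred I) (F : I -> fps K n) :
  vf (\sum_(i <- r | P i) F i) = \sum_(i <- r | P i) vf (F i).
Proof. exact: (big_morph vf vfD vf0). Qed.

Lemma vf_ord d f : ord_ge d f -> ord_ge d.+1 (vf f).
Proof.
move=> fd; apply: ord_ge_sum => i _; case: d fd => [|d] fd.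
  by apply: ord_geMl; apply: (ord_geW _ (V2 i)).
by rewrite -[d.+2]add2n; apply: ord_geM => //; apply: fderiv_ord.
Qed.

Lemma iter_vf_ord d k f : ord_ge d f -> ord_ge (d + k) (iter k vf f).
Proof.
move=> fd; elim: k => [|k IHk]; first by rewrite addn0.
by rewrite addnS; apply: vf_ord.
Qed.

Lemma iter_vfD k f g : iter k vf (f + g) = iter k vf f + iter k vf g.
Proof. by elim: k => //= k ->; rewrite vfD. Qed.

Lemma iter_vf_ge k f : ord_ge k (iter k vf f).
Proof. by rewrite -[k]add0n; apply: iter_vf_ord. Qed.

End VectorField.

Section LieSeries.
Variables (K : numFieldType) (n : nat) (V : 'I_n -> fps K n).
Hypothesis V2 : forall i, ord_ge 2 (V i).
Implicit Types f g : fps K n.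
Local Notation D := (vf V).

Definition lie_coef (t : K) k f : fps K n := fconst (t ^+ k / k`!%:R) * iter k D f.

(* Applying the field raises the order, so that each coefficient of the
   exponential series is a finite sum. *)
Definition fexp (t : K) f : fps K n := fun a =>
  \sum_(k < (mdeg a).+1) lie_coef t k f a.

Lemma lie_coef_ord t d k f : ord_ge d f -> ord_ge (d + k) (lie_coef t k f).
Proof. by move=> fd; apply/ord_geMr/iter_vf_ord. Qed.

Lemma lie_coef_ge t k f : ord_ge k (lie_coef t k f).
Proof. by apply/ord_geMr/iter_vf_ge. Qed.

Lemma fexpE d t f a : (mdeg a <= d)%N ->
  fexp t f a = \sum_(k < d.+1) lie_coef t k f a.
Proof.
move=> led; rewrite /fexp (big_ord_widen d.+1 (fun k => lie_coef t k f a)) //.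
rewrite [RHS](bigID (fun k : 'I_d.+1 => (k < (mdeg a).+1)%N)) /=.
rewrite [X in _ = _ + X]big1 ?addr0 // => k.
by rewrite -leqNgt => lek; apply: (lie_coef_ge t f lek).
Qed.

Lemma fexp_trunc d t f :
  ord_ge d.+1 (fexp t f - \sum_(k < d.+1) lie_coef t k f).
Proof. by move=> a; rewrite ltnS => led; rewrite fsubE (fexpE _ _ led) fsumE subrr. Qed.

Lemma lie_coefS t k f :
  fconst t * D (lie_coef t k f) = lie_coef t k.+1 f *+ k.+1.
Proof.
rewrite /lie_coef vfZ mulrA -rmorphM /= -mulrnAl; congr (_ * _).
rewrite -raddfMn; congr (fconst _).
rewrite factS natrM invfM exprS -[RHS]mulr_natr.
have k0 : k.+1%:R != 0 :> K by rewrite pnatr_eq0.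
have kf : k`!%:R != 0 :> K by rewrite pnatr_eq0 -lt0n fact_gt0.
by move: (k.+1%:R) (k`!%:R) k0 kf => x y x0 y0; field; rewrite x0 y0.
Qed.

Lemma mulrnI_fps k f g : f *+ k.+1 = g *+ k.+1 -> f = g.
Proof.
move=> fg; apply/funext => a; apply: (mulIf (_ : k.+1%:R != 0)).
  by rewrite pnatr_eq0.
have E (h : fps K n) : (h *+ k.+1) a = h a * k.+1%:R.
  rewrite mulr_natr; elim: k.+1 => [|j IHj]; first by rewrite !mulr0n.
  by rewrite !mulrS faddE IHj.
by rewrite -!E fg.
Qed.

(** Leibniz rule for the divided powers of the field. The induction proves [k.+1] times the next
    formula: differentiating the two factors produces the weights [i] and [k.+1 - i], which add up
    to [k.+1]. *)
Lemma lie_coefM t k f g : lie_coef t k (f * g) =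
  \sum_(i < k.+1) lie_coef t i f * lie_coef t (k - i) g.
Proof.
elim: k => [|k IHk].
  by rewrite big_ord_recl big_ord0 addr0 /lie_coef fact0 expr0 invr1 mulr1 !mul1r.
apply: (@mulrnI_fps k); rewrite -lie_coefS IHk vf_sum mulr_sumr.
transitivity (\sum_(i < k.+1) lie_coef t i.+1 f * lie_coef t (k - i) g *+ i.+1 +
  \sum_(i < k.+1) lie_coef t i f * lie_coef t (k.+1 - i) g *+ (k.+1 - i)).
  rewrite -big_split; apply: eq_bigr => i _ /=.
  rewrite vfM mulrDr mulrA lie_coefS [fconst t * (_ * _)]mulrCA lie_coefS mulrnAl.
  by rewrite mulrnAr subSn // -ltnS.
rewrite -sumrMnl.
transitivity (\sum_(i < k.+2) (lie_coef t i f * lie_coef t (k.+1 - i) g *+ i +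
  lie_coef t i f * lie_coef t (k.+1 - i) g *+ (k.+1 - i))); last first.
  by apply: eq_bigr => i _; rewrite -mulrnDr subnKC // -ltnS.
rewrite big_split /=; congr (_ + _).
  rewrite [RHS]big_ord_recl /= mulr0n add0r; apply: eq_bigr => i _.
  by rewrite /bump /= add1n subSS.
by rewrite [RHS]big_ord_recr /= subnn mulr0n addr0.
Qed.

Lemma fexpD t f g : fexp t (f + g) = fexp t f + fexp t g.
Proof.
apply/funext => a; rewrite faddE /fexp -big_split; apply: eq_bigr => k _ /=.
by rewrite /lie_coef iter_vfD mulrDr.
Qed.

Lemma fexpM t f g : fexp t (f * g) = fexp t f * fexp t g.
Proof.
apply/funext => a; pose d := mdeg a.
have -> : (fexp t f * fexp t g) a =
    ((\sum_(i < d.+1) lie_coef t i f) * (\sum_(i < d.+1) lie_coef t i g)) a.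
  apply/eqP; rewrite -subr_eq0 -fsubE; apply/eqP.
  by apply: (@ord_ge_congrM _ _ d.+1) => //; apply: fexp_trunc.
rewrite mulr_suml fsumE.
under eq_bigr => i _ do rewrite mulr_sumr fsumE.
rewrite (triangle_sum (F := fun i j => (lie_coef t i f * lie_coef t j g) a)).
  by apply: eq_bigr => k _; rewrite lie_coefM fsumE.
move=> i j ltij; apply: (ord_geM (@lie_coef_ge t i f) (@lie_coef_ge t j g)).
exact: ltij.
Qed.

Lemma fexpC t c : fexp t (fconst c) = fconst c.
Proof.
apply/funext => a; rewrite /fexp big_ord_recl big1 ?addr0 => [|k _].
  by rewrite /lie_coef expr0 fact0 invr1 mulr1 mul1r.
rewrite /lie_coef iterSr vfC (_ : iter k D 0 = 0) ?mulr0 //.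
by elim: (val k) => //= j ->; rewrite vf0.
Qed.

Lemma fexp_ord t d f : ord_ge d f -> ord_ge d (fexp t f).
Proof.
move=> fd a lta; rewrite /fexp big1 // => k _.
exact: (@lie_coef_ord t d k f fd a (leq_trans lta (leq_addr _ _))).
Qed.

Lemma fexp_fhom t : fhom (fexp t).
Proof.
split; [exact: fexpD|exact: fexpM|exact: fexpC|by move=> d f; apply: fexp_ord].
Qed.

Lemma fexp0 f : fexp 0 f = f.
Proof.
apply/funext => a; rewrite /fexp big_ord_recl big1 ?addr0 => [|k _].
  by rewrite /lie_coef expr0 fact0 invr1 mulr1 fconstM mul1r.
by rewrite /lie_coef exprS !mul0r raddf0 mul0r.
Qed.

Lemma exp_coefD (s t : K) k : (s + t) ^+ k / k`!%:R =
  \sum_(i < k.+1) (s ^+ i / i`!%:R) * (t ^+ (k - i) / (k - i)`!%:R).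
Proof.
rewrite addrC exprDn mulr_suml; apply: eq_bigr => i _.
have lei : (i <= k)%N by rewrite -ltnS.
have f0 j : j`!%:R != 0 :> K by rewrite pnatr_eq0 -lt0n fact_gt0.
have -> : k`!%:R = 'C(k, i)%:R * i`!%:R * (k - i)`!%:R :> K.
  by rewrite -!natrM -mulnA bin_fact.
have b0 : 'C(k, i)%:R != 0 :> K by rewrite pnatr_eq0 -lt0n bin_gt0.
rewrite -mulr_natr; move: (f0 i) (f0 (k - i)%N) b0.
move: (i`!%:R) ((k - i)`!%:R) ('C(k, i)%:R) => x y c x0 y0 c0.
by field; rewrite x0 y0 c0.
Qed.

(** Up to degree [d] both sides are finite double sums. The right one runs over a square and the
    binomial formula over a triangle; they agree because at least [d.+1] applications of the field
    produce nothing in degree [d]. *)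
Lemma fexp_add s t f : fexp (s + t) f = fexp s (fexp t f).
Proof.
apply/funext => a; pose d := mdeg a.
transitivity (fexp s (\sum_(j < d.+1) lie_coef t j f) a); last first.
  apply/eqP; rewrite -subr_eq0 -fsubE -(fhomB (fexp_fhom s)) -opprB.
  rewrite (fhomN (fexp_fhom s)) foppE oppr_eq0; apply/eqP.
  by apply: (@fexp_ord s d.+1) => //; apply: fexp_trunc.
rewrite (fhom_sum (fexp_fhom s)) fsumE.
under [RHS]eq_bigr => j _ do rewrite (fexpE s _ (leqnn d)).
rewrite exchange_big /=.
pose F i j := (s ^+ i / i`!%:R) * (t ^+ j / j`!%:R) * iter (i + j) D f a.
transitivity (\sum_(i < d.+1) \sum_(j < d.+1) F i j); last first.
  apply: eq_bigr => i _; apply: eq_bigr => j _.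
  have iterZ k c g : iter k D (fconst c * g) = fconst c * iter k D g.
    by elim: k => //= k ->; rewrite vfZ.
  by rewrite /F /lie_coef iterZ !fconstM [RHS]mulrA iterD.
rewrite triangle_sum => [|i j leij]; last first.
  by rewrite /F (iter_vf_ge V2 f leij) mulr0.
apply: eq_bigr => k _; rewrite /lie_coef fconstM exp_coefD mulr_suml.
by apply: eq_bigr => i _; rewrite /F subnKC // -ltnS.
Qed.

(** The iterates of the field on [T] are [iter k step 1 * T]. As [l] has no constant term, [step]
    raises the order, so the exponential series of the cofactors is a well-defined unit [e]. *)
Lemma fexp_eigen t T l : ord_ge 1 l -> D T = l * T ->
  exists e : fps K n, e mnm0 = 1 /\ fexp t T = e * T.
Proof.
move=> l1 DT; pose step (x : fps K n) := D x + x * l.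
have iterT k : iter k D T = iter k step 1 * T.
  elim: k => [|k IHk]; first by rewrite mul1r.
  by rewrite iterS IHk vfM DT /= /step; ring.
have step_ord k : ord_ge k (iter k step 1).
  elim: k => [|k IHk] //; rewrite iterS /step; apply: ord_geD.
    exact: (vf_ord V2 IHk).
  by have := ord_geM IHk l1; rewrite addn1.
pose c k : fps K n := fconst (t ^+ k / k`!%:R) * iter k step 1.
pose e : fps K n := fun a => \sum_(k < (mdeg a).+1) c k a.
have eE d : ord_ge d.+1 (e - \sum_(k < d.+1) c k).
  move=> a; rewrite ltnS => led; rewrite fsubE fsumE /e.
  rewrite (big_ord_widen d.+1 (fun k => c k a)) //.
  rewrite [X in _ - X](bigID (fun k : 'I_d.+1 => (k < (mdeg a).+1)%N)) /=.
  rewrite [X in _ - (_ + X)]big1 ?addr0 ?subrr // => k.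
  rewrite -leqNgt => lek; have := @ord_geMr _ _ k _ _ (step_ord k).
  by move=> /(_ (fconst (t ^+ k / k`!%:R))); apply.
exists e; split.
  rewrite /e mdeg0 big_ord_recl big_ord0 addr0 /c fconstM expr0 fact0 divr1.
  by rewrite mul1r /= foneE eqxx.
apply: ord_ge_eq => d; apply: (@ord_geW _ _ d.+1) => //.
have -> : fexp t T - e * T =
   (fexp t T - \sum_(k < d.+1) lie_coef t k T)
   - (e - \sum_(k < d.+1) c k) * T.
  rewrite mulrBl mulr_suml (_ : \sum_(i < _) _ = \sum_(k < d.+1) lie_coef t k T).
    by ring.
  by apply: eq_bigr => k _; rewrite /c /lie_coef iterT mulrA.
by apply: ord_geB; [apply: fexp_trunc|apply: ord_geMl].
Qed.

End LieSeries.

(** Related vector fields have related flows. *)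
Lemma fexp_intertwine (K : numFieldType) k n (V : 'I_k -> fps K k)
    (W : 'I_n -> fps K n) (E : fps K k -> fps K n) t f :
  (forall i, ord_ge 2 (V i)) -> (forall i, ord_ge 2 (W i)) -> fhom E ->
  (forall g, E (vf V g) = vf W (E g)) -> E (fexp V t f) = fexp W t (E f).
Proof.
move=> V2 W2 hE EV; apply: ord_ge_eq => d.
apply: (@ord_geW _ _ d.+1) => //.
have Ec j : E (lie_coef V t j f) = lie_coef W t j (E f).
  rewrite /lie_coef (fhomM hE) (fhomC hE); congr (_ * _).
  by elim: j => //= j <-; rewrite EV.
have -> : E (fexp V t f) - fexp W t (E f) =
   E (fexp V t f - \sum_(j < d.+1) lie_coef V t j f)
   - (fexp W t (E f) - \sum_(j < d.+1) lie_coef W t j (E f)).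
  rewrite (fhomB hE) (fhom_sum hE); under eq_bigr => j _ do rewrite Ec.
  by ring.
by apply: ord_geB; [apply/(fhom_ord hE)/fexp_trunc|apply: fexp_trunc].
Qed.

(** * Majorants and differential equations *)

Section Norm.
Variables (K : numFieldType) (n : nat).
Implicit Types (f g : fps K n) (r : K) (d : nat).

(** The majorant norm on the polydisc of radius [r], truncated so that it is a finite sum. A bound
    uniform in [d] expresses absolute convergence. *)
Definition fnorm r d f : K := \sum_(a : bmultinom n d.+1) `|f a| * r ^+ mdeg a.

Lemma fnorm_ge0 r d f : 0 <= r -> 0 <= fnorm r d f.
Proof. by move=> r0; apply: sumr_ge0 => a _; rewrite mulr_ge0 ?exprn_ge0. Qed.

Lemma fnormD r d f g : 0 <= r -> fnorm r d (f + g) <= fnorm r d f + fnorm r d g.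
Proof.
move=> r0; rewrite /fnorm -big_split; apply: ler_sum => a _ /=.
by rewrite -mulrDl ler_wpM2r ?exprn_ge0 // faddE ler_normD.
Qed.

Lemma fnormN r d f : fnorm r d (- f) = fnorm r d f.
Proof. by apply: eq_bigr => a _; rewrite foppE normrN. Qed.

Lemma fnormC r d c : fnorm r d (fconst c) = `|c|.
Proof.
rewrite /fnorm (bigD1 (BMultinom (_ : (mdeg (@mnm0 n) < d.+1)%N))) ?mdeg0 //=.
move=> lt0; rewrite mdeg0 expr0 mulr1 /fconst eqxx mulr1n big1 ?addr0 // => a na.
suff /negbTE -> : (a : multinom n) != mnm0 by rewrite mulr0n normr0 mul0r.
by apply: contra na => /eqP a0; apply/eqP/val_inj.
Qed.

Lemma fnorm_var r d i : 0 <= r -> fnorm r d (fvar K i) <= r.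
Proof.
move=> r0; rewrite /fnorm (bigID (fun a : bmultinom n d.+1 => a == mnm1 i :> multinom n)) /=.
rewrite [X in _ + X]big1 ?addr0 => [|a /negbTE na]; last first.
  by rewrite /fvar na normr0 mul0r.
case: (ltnP 1 d.+1) => [lt1|]; last first.
  move=> le1; rewrite big1 // => a /eqP ea; have := bmdeg a.
  by rewrite ea mdeg1 ltnNge le1.
have lt1' : (mdeg (mnm1 i) < d.+1)%N by rewrite mdeg1.
rewrite (bigD1 (BMultinom lt1')) //= big1 ?addr0 => [|a /andP[/eqP ea na]].
  by rewrite /fvar eqxx normr1 mul1r mdeg1 expr1.
by case/eqP: na; apply: val_inj.
Qed.

Lemma fnorm_eq r d f g : ord_ge d.+1 (f - g) -> fnorm r d f = fnorm r d g.
Proof.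
move=> fg; apply: eq_bigr => a _; congr (`|_| * _); apply/eqP.
by rewrite -subr_eq0 -fsubE fg // bmdeg.
Qed.

Lemma fnormM r d f g : 0 <= r -> fnorm r d (f * g) <= fnorm r d f * fnorm r d g.
Proof.
move=> r0; pose F (k : bmultinom n d.+1 * bmultinom n d.+1) : K :=
  (`|f k.1| * r ^+ mdeg k.1) * (`|g k.2| * r ^+ mdeg k.2).
have F0 k : 0 <= F k by rewrite !mulr_ge0 ?exprn_ge0.
have -> : fnorm r d f * fnorm r d g = \sum_k F k.
  rewrite mulr_suml; under eq_bigr => b _ do rewrite mulr_sumr.
  by rewrite pair_bigA.
apply: (@le_trans _ _ (\sum_(a : bmultinom n d.+1)
  \sum_(k : bmultinom n d.+1 * bmultinom n d.+1
        | (a : multinom n) == mnm_add k.1 k.2) F k)).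
  apply: ler_sum => a _; have led : (mdeg a <= d)%N by rewrite -ltnS bmdeg.
  rewrite -fmul_mulE (fmul_trunc _ _ led) (mcoeff_poly_mul _ _ (bmdeg a)).
  apply: le_trans (ler_wpM2r (exprn_ge0 _ r0) (ler_norm_sum _ _ _)) _.
  rewrite mulr_suml; apply: ler_sum => -[b c] /= /eqP ea.
  rewrite !mcoeff_ftrunc -ltnS bmdeg -ltnS bmdeg normrM ea mdegD exprD /F /=.
  by rewrite mulrACA.
rewrite (exchange_big_dep predT) //=; apply: ler_sum => k _.
case: (pickP (fun a : bmultinom n d.+1 => a == mnm_add k.1 k.2 :> multinom n)) =>
    [a ea|no]; last by rewrite big_pred0.
rewrite (bigD1 a) //= big1 ?addr0 // => b /andP[eb nb].
by case/eqP: nb; apply: val_inj; rewrite /= (eqP ea) (eqP eb).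
Qed.

Lemma fnormX r d f j : 0 <= r -> fnorm r d (f ^+ j) <= fnorm r d f ^+ j.
Proof.
move=> r0; elim: j => [|j IHj].
  by rewrite !expr0 -(rmorph1 (@fconst K n)) fnormC normr1.
rewrite !exprS; apply: le_trans (fnormM _ _ _ r0) _.
by apply: ler_wpM2l => //; apply: fnorm_ge0.
Qed.

End Norm.

Section MulVar.
Variables (K : comNzRingType) (n : nat) (i : 'I_n).
Implicit Types f g : fps K n.
Local Notation rho := (fvar K i).

Lemma fvar_mulE f a : (rho * f) (mnm_add a (mnm1 i)) = f a.
Proof.
pose d := (mdeg a).+1.
have ad : mdeg (mnm_add a (mnm1 i)) = d by rewrite mdegD mdeg1 addn1.
rewrite mulrC -fmul_mulE (@fmul_trunc _ _ d) ?ad //.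
transitivity (mcoeff (mnm_add (mnm1 i) a) (ftrunc d f * mpolyX K (mnm1 i))).
  rewrite [in RHS]addmC; apply: mcoeffM_congr => // b; rewrite ad => leb.
  by rewrite mcoeff_ftrunc leb mcoeffX /fvar eq_sym.
by rewrite mcoeffMX mcoeff_ftrunc leqnSn.
Qed.

Lemma fvar_mul0 f (a : multinom n) : a i = 0%N -> (rho * f) a = 0.
Proof.
move=> ai0; rewrite -fmul_mulE fmulE big1 // => -[b c] /= /eqP abc.
rewrite /fvar; case: eqP => [bi|]; last by rewrite mul0r.
by have := congr1 (fun b : multinom n => b i) abc; rewrite /= ai0 mnmDE bi mnm1E eqxx.
Qed.

Lemma multinomSP (a : multinom n) : a i != 0%N -> exists b, a = mnm_add b (mnm1 i).
Proof.
move=> ai; exists (mnm_sub a (mnm1 i)); apply/mnmP => j.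
by rewrite mnmDE mnmBE mnm1E; case: eqP => [<-|_]; lia.
Qed.

End MulVar.

(** * Formal integration and Picard iteration *)

Section Integral.
Variables (K : numFieldType) (n : nat) (i : 'I_n).
Implicit Types f g : fps K n.
Local Notation rho := (fvar K i).

Definition fdiv_int f : fps K n := fun a => f a / (a i).+1%:R.

(** The primitive in the variable [i] that vanishes with this variable; the other variables are
    parameters. *)
Definition fint f : fps K n := rho * fdiv_int f.

Lemma fderiv_fint f : fderiv i (fint f) = f.
Proof.
apply/funext => a; by rewrite /fderiv /fint fvar_mulE /fdiv_int -[LHS]mulr_natr divfK.
Qed.

Lemma fint_fderiv f g : fderiv i f = g ->
  (forall a : multinom n, a i = 0%N -> f a = 0) ->
  f = fint g.
Proof.
move=> <- f0; apply/funext => a; case: (eqVneq (a i) 0%N) => [ai|].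
  by rewrite f0 // /fint fvar_mul0.
move=> /multinomSP[b ->].
by rewrite /fint fvar_mulE /fdiv_int /fderiv -[X in X / _]mulr_natr mulfK.
Qed.

Lemma fintB f g : fint (f - g) = fint f - fint g.
Proof.
rewrite /fint -mulrBr; congr (_ * _); apply/funext => a.
by rewrite fsubE /fdiv_int -mulrBl.
Qed.

Lemma fint_ord d f : ord_ge d f -> ord_ge d.+1 (fint f).
Proof.
move=> fd; rewrite -[d.+1]add1n; apply: ord_geM; first exact: ord_ge_var.
by move=> a lta; rewrite /fdiv_int fd // mul0r.
Qed.

Lemma fnorm_fint r d f : 0 <= r -> fnorm r d (fint f) <= r * fnorm r d f.
Proof.
move=> r0; apply: le_trans (fnormM _ _ _ r0) _.
apply: ler_pM; rewrite ?fnorm_ge0 ?fnorm_var //; apply: ler_sum => a _.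
apply: ler_wpM2r; rewrite ?exprn_ge0 // /fdiv_int normrM normfV normr_nat.
by rewrite -[X in _ <= X]mulr1 ler_wpM2l // invf_le1 ?ltr0n // ler1n.
Qed.

(** Uniqueness for a linear equation: [x] equals the integral of [l * x], and integration raises the
    order, so [x] has arbitrarily high order. The factorization [x = rho * y] expresses the initial
    value 0. *)
Lemma linear_ode_zero (l x y : fps K n) :
  fderiv i x = l * x -> x = rho * y -> x = 0.
Proof.
move=> dx xy; have xE : x = fint (l * x).
  by apply: fint_fderiv => // a ai; rewrite xy fvar_mul0.
apply: ord_ge_eq; elim=> [|d IHd]; first exact: ord_ge0.
by rewrite subr0 in IHd *; rewrite xE; apply/fint_ord/ord_geMr.
Qed.

End Integral.

Section ODE.
Variables (K : numFieldType) (n : nat) (i : 'I_n) (J : Type).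
Variables (R : (J -> fps K n) -> J -> fps K n) (Y0 : J -> fps K n).
Hypothesis R_congr : forall d Y Y',
  (forall j, ord_ge d (Y j - Y' j)) -> forall j, ord_ge d (R Y j - R Y' j).

Definition picard (Y : J -> fps K n) j : fps K n := Y0 j + fint i (R Y j).

Lemma picard_congr d Y Y' : (forall j, ord_ge d (Y j - Y' j)) ->
  forall j, ord_ge d.+1 (picard Y j - picard Y' j).
Proof.
move=> YY j; rewrite /picard opprD addrACA subrr add0r -fintB.
exact/fint_ord/R_congr.
Qed.

(** Integration raises the order, so each Picard step settles one more degree and the coefficient of
    index [a] no longer changes after [(mdeg a).+1] steps. *)
Definition picard_sol j : fps K n := fun a => iter (mdeg a).+1 picard Y0 j a.

Lemma picard_iter d j : ord_ge d (picard_sol j - iter d picard Y0 j).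
Proof.
have step k e l : ord_ge k (iter k picard Y0 l - iter (k + e) picard Y0 l).
  elim: k l => [|k IHk] l; first exact: ord_ge0.
  by rewrite addSn !iterS; apply: picard_congr.
move=> a lta; rewrite fsubE /picard_sol.
have [e ->] : exists e, d = ((mdeg a).+1 + e)%N by exists (d - (mdeg a).+1)%N; rewrite subnKC.
by rewrite -fsubE step.
Qed.

Lemma picard_solE j : picard_sol j = picard picard_sol j.
Proof.
apply: ord_ge_eq => d; apply: (@ord_geW _ _ d.+1) => //.
have -> : picard_sol j - picard picard_sol j =
   (picard_sol j - iter d.+1 picard Y0 j)
   - (picard picard_sol j - picard (iter d picard Y0) j).
  by rewrite iterS; ring.
by apply: ord_geB; [apply: picard_iter|apply/picard_congr/picard_iter].
Qed.

Lemma picard_unique Y Y' : (forall j, Y j = picard Y j) ->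
  (forall j, Y' j = picard Y' j) -> forall j, Y j = Y' j.
Proof.
move=> YE YE' j; apply: ord_ge_eq => d; elim: d j => [|d IHd] j.
  exact: ord_ge0.
by rewrite YE YE'; apply: picard_congr.
Qed.

(** The Picard map preserves the ball of radius [M] for the majorant norm, because integration
    contributes a factor [r]; up to a given degree the solution is one of the iterates. *)
Lemma picard_bound (r M0 M C : K) : 0 <= r -> M0 + r * C <= M -> M0 <= M ->
  (forall d j, fnorm r d (Y0 j) <= M0) ->
  (forall d Y, (forall j, fnorm r d (Y j) <= M) ->
     forall j, fnorm r d (R Y j) <= C) ->
  forall d j, fnorm r d (picard_sol j) <= M.
Proof.
move=> r0 leM leM0 Y0M RC d j.
rewrite (fnorm_eq r (g := iter d.+1 picard Y0 j)); last exact: picard_iter.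
elim: d.+1 j => [|k IHk] j; first exact: le_trans (Y0M _ _) _.
rewrite iterS; apply: le_trans leM; apply: le_trans (fnormD _ _ _ r0) _.
apply: lerD => //; apply: le_trans (fnorm_fint _ _ _ r0) _.
by apply: ler_wpM2l => //; apply: RC.
Qed.

End ODE.

(* Closed under the ring operations, so that every polynomial right hand side
   is tame, and sufficient for the majorant estimate picard_bound. *)
Section Tame.
Variables (K : numFieldType) (n : nat) (J : Type) (M : K).
Hypothesis M0 : 0 <= M.
Implicit Types R S : (J -> fps K n) -> fps K n.

Record tame R : Prop := Tame {
  tame_congr : forall d Y Y',
    (forall j, ord_ge d (Y j - Y' j)) -> ord_ge d (R Y - R Y');
  tame_bound : exists2 C, 0 <= C & forall r d Y, 0 <= r -> r <= 1 ->
    (forall j, fnorm r d (Y j) <= M) -> fnorm r d (R Y) <= C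
}.

Lemma tame_proj j : tame (fun Y => Y j).
Proof. by split=> [d Y Y'|]; [apply|exists M => // r d Y _ _; apply]. Qed.

Lemma tame_const c : tame (fun=> fconst c).
Proof.
split=> [d Y Y' _|]; first by rewrite subrr; apply: ord_ge_zero.
by exists `|c| => // r d Y _ _ _; rewrite fnormC.
Qed.

Lemma tame_var i : tame (fun=> fvar K i).
Proof.
split=> [d Y Y' _|]; first by rewrite subrr; apply: ord_ge_zero.
by exists 1 => // r d Y r0 r1 _; apply: le_trans r1; apply: fnorm_var.
Qed.

Lemma tameD R S : tame R -> tame S -> tame (fun Y => R Y + S Y).
Proof.
move=> [Rc [C C0 RC]] [Sc [E E0 SE]]; split=> [d Y Y' YY|].
  by rewrite opprD addrACA; apply: ord_geD; [apply: Rc|apply: Sc].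
exists (C + E) => [|r d Y r0 r1 YM]; first exact: addr_ge0.
apply: le_trans (fnormD _ _ _ r0) _.
by apply: lerD; [apply: RC|apply: SE].
Qed.

Lemma tameM R S : tame R -> tame S -> tame (fun Y => R Y * S Y).
Proof.
move=> [Rc [C C0 RC]] [Sc [E E0 SE]]; split=> [d Y Y' YY|].
  by apply: ord_ge_congrM; [apply: Rc|apply: Sc].
exists (C * E) => [|r d Y r0 r1 YM]; first exact: mulr_ge0.
apply: le_trans (fnormM _ _ _ r0) _.
by apply: ler_pM; rewrite ?fnorm_ge0 //; [apply: RC|apply: SE].
Qed.

Lemma tameN R : tame R -> tame (fun Y => - R Y).
Proof.
move=> [Rc [C C0 RC]]; split=> [d Y Y' YY|].
  by rewrite -opprD; apply: ord_geN; apply: Rc.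
by exists C => // r d Y r0 r1 YM; rewrite fnormN; apply: RC.
Qed.

Lemma tameX R k : tame R -> tame (fun Y => R Y ^+ k).
Proof.
move=> tR; elim: k => [|k IHk]; first exact: (tame_const 1).
by under eq_fun do rewrite exprS; apply: tameM.
Qed.

Lemma tameMn R k : tame R -> tame (fun Y => R Y *+ k).
Proof.
move=> tR; elim: k => [|k IHk].
  under eq_fun do rewrite mulr0n -(raddf0 (@fconst K n)).
  exact: tame_const.
by under eq_fun do rewrite mulrS; apply: tameD.
Qed.

End Tame.

(** * The equation of the hypersurface *)

Section RingIdentities.
Variable A : comNzRingType.

(** Equality of the mixed derivatives of log mu(w). Its rho-derivative is I f kap(a), its derivative
    along u^m d/du is kap(a) (1 + I t), with kap(a) = a^m - e a, and the two derivations commute. *)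
Lemma chi_bracket (I N e a an s t f : A) : a * (1 + I * e * s) = 1 ->
  - (I * (((N + 1) * an - e) * (- (I * a ^+ 2 * e * (t - e * s)))
          - N * e ^+ 2 * a) * f)
  + ((N + 1) * an - e) * (- (I * e * a ^+ 2 * f)) * (1 + I * t)
  + I * (N + 1) * e * (a * an - e * a) * f = 0.
Proof.
move=> ha; transitivity
  ((a * (1 + I * e * s) - 1) * (- (I * ((N + 1) * an - e) * e * a * f))).
  by ring.
by rewrite ha subrr mul0r.
Qed.

(** The left side is the rho-derivative of the quantity [chi] introduced later. It differs from a
    multiple of [chi] by a combination of the two bracket relations, one for w and one for wbar. *)
Lemma chi_linear (I h P dP k1 k2 dk1 dk2 Dk1 Dk2 f df t Dt M e : A) :
  Dt = M * e * f + df ->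
  - (I * dk1 * f) + Dk1 * (1 + I * t) + I * M * e * k1 * f = 0 ->
  I * dk2 * f + Dk2 * (1 - I * t) - I * M * e * k2 * f = 0 ->
  - (h * I * (dP * (k1 + k2) * f + P * ((dk1 + dk2) * f + (k1 + k2) * df)))
  + h * (- (h * I * P * (k1 + k2) * f) * (k1 * (1 + I * t) - k2 * (1 - I * t))
     + P * (Dk1 * (1 + I * t) + k1 * (I * Dt)
            - (Dk2 * (1 - I * t) - k2 * (I * Dt))))
  = - (h * I * (k1 + k2) * f) *
      (dP + h * P * (k1 * (1 + I * t) - k2 * (1 - I * t))).
Proof.
move=> -> b1 b2; set X1 := (X in X = 0) in b1; set X2 := (X in X = 0) in b2.
transitivity (- (h * I * (k1 + k2) * f) *
      (dP + h * P * (k1 * (1 + I * t) - k2 * (1 - I * t))) + h * P * (X1 - X2)).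
  by rewrite /X1 /X2; ring.
by rewrite b1 b2 subrr mulr0 addr0.
Qed.

(** The relation between [f] and the denominator is exactly what absorbs the inhomogeneous terms
    [am], [dm] and [I + I], leaving the rho-derivative of the first integral proportional to the
    first integral itself. *)
Lemma invariant_linear (I h P Q k1 k2 f b c am dm rho : A) :
  I * I = -1 -> h + h = 1 ->
  f * (P * am + Q * dm + I * rho * (k1 - k2)) = 1 + 1 ->
  - (h * I * P * (k1 + k2) * f) * b + P * (I * f * (k1 * b - am))
  - (h * I * Q * (k1 + k2) * f * c + Q * (- (I * f * (k2 * c - dm))))
  + (I + I)
  = h * I * f * (k1 - k2) * (P * b - Q * c + (1 + 1) * I * rho).
Proof.
move=> I2 h2 fE; set E := (X in f * X) in fE.
transitivity (h * I * f * (k1 - k2) * (P * b - Q * c + (1 + 1) * I * rho)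
  + ((h + h) - 1) * (- (I * f * (k1 * P * b + k2 * Q * c))
       - I * I * rho * f * (k1 - k2))
  + I * (1 + 1 - f * E)).
  by rewrite /E; ring.
by rewrite h2 fE !subrr mul0r mulr0 !addr0.
Qed.

(** The u-derivative of the vanishing first integral, solved for the slope [t]; the first integral
    itself serves to eliminate [b] and [c]. *)
Lemma tau_identity (I h P Q k1 k2 t b c am dm rho : A) :
  I * I = -1 -> h + h = 1 ->
  P * b - Q * c + (1 + 1) * I * rho = 0 ->
  - (h * P * (k1 * (1 + I * t) - k2 * (1 - I * t))) * b
  + P * ((k1 * b - am) * (1 + I * t))
  - (h * Q * (k1 * (1 + I * t) - k2 * (1 - I * t)) * c
     + Q * ((k2 * c - dm) * (1 - I * t))) = 0 ->
  t * (P * am + Q * dm + I * rho * (k1 - k2)) =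
  I * (P * am - Q * dm) - rho * (k1 + k2).
Proof.
move=> I2 h2 g0; set X := (X in X = 0) => X0.
set g := (X in X = 0) in g0; set S := k1 * (1 + I * t) + k2 * (1 - I * t).
apply/eqP; rewrite -subr_eq0; apply/eqP.
transitivity (I * X - h * I * S * g
   + (h + h - 1) * (I * (I * rho * S + P * b * k1 * (1 + I * t)
                         - Q * c * k2 * (1 - I * t)))
   + (I * I + 1) * (rho * S + t * (P * am + Q * dm))).
  by rewrite /X /g /S; ring.
by rewrite X0 g0 h2 I2 subrr addNr !mul0r !mulr0 subrr !addr0.
Qed.

(** The tangency expression is multiplied by the denominator [E], a unit because [f * E] is 2. Then
    [f] and [t] can be replaced, and a multiple of the first integral remains. *)
Lemma tangency_identity (I h P Q k1 k2 t f b c am dm rho al be cw co : A) :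
  I * I = -1 -> h + h = 1 ->
  P * b - Q * c + (1 + 1) * I * rho = 0 ->
  f * (P * am + Q * dm + I * rho * (k1 - k2)) = 1 + 1 ->
  t * (P * am + Q * dm + I * rho * (k1 - k2)) =
  I * (P * am - Q * dm) - rho * (k1 + k2) ->
  al * am = 1 -> be * dm = 1 -> al * k1 = cw -> be * k2 = co ->
  rho * (h * (cw * b - 1 + (co * c - 1))) * f
  + h * (al * b * (t + I) + be * c * (t - I)) = 0.
Proof.
move=> I2 h2 g0 fE tE ala bed alk bek.
set E := (X in f * X) in fE; rewrite -/E in tE.
set kap := (X in X = 0).
have Ek : E * kap = 0.
  transitivity (rho * h * (cw * b - 1 + (co * c - 1)) * (f * E)
    + h * (al * b * (t * E + I * E) + be * c * (t * E - I * E))).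
    by rewrite /kap; ring.
  rewrite fE tE.
  transitivity ((h + h) * (rho * (cw * b + co * c - (1 + 1))
      + I * P * b * (al * am) - rho * b * (al * k1)
      - I * Q * c * (be * dm) - rho * c * (be * k2))
    + h * ((I * I + 1) * rho * (k1 - k2) * (al * b - be * c))).
    by rewrite /E; ring.
  rewrite h2 ala bed alk bek I2 addNr !mul0r mulr0 addr0 mul1r.
  transitivity (I * (P * b - Q * c + (1 + 1) * I * rho)
    - (1 + 1) * (I * I + 1) * rho); first by ring.
  by rewrite g0 I2 addNr !mulr0 mul0r subrr.
have -> : kap = h * (f * (E * kap)) + (1 - h * (f * E)) * kap by ring.
by rewrite Ek fE !mulr0 add0r [h * _]mulrDr mulr1 h2 subrr mul0r.
Qed.

End RingIdentities.

(** * One-variable series and divided differences *)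

Section Substitution1.
Variables (K : comNzRingType).

Definition fsubst n (w : fps K n) (f : fps K 1) : fps K n := fcomp f (fun=> w).

Lemma fsubst_fhom n (w : fps K n) : ord_ge 1 w -> fhom (fsubst w).
Proof. by move=> w1; apply: fcomp_fhom. Qed.

Lemma fsubst_var n (w : fps K n) : ord_ge 1 w -> fsubst w (fvar K ord0) = w.
Proof. by move=> w1; apply: fcomp_var. Qed.

Lemma fderiv_fsubst n (w : fps K n) i f : ord_ge 1 w ->
  fderiv i (fsubst w f) = fsubst w (fderiv ord0 f) * fderiv i w.
Proof.
move=> w1; rewrite (fderiv_hom i f (fsubst_fhom w1)) big_ord_recl big_ord0 addr0.
by rewrite fsubst_var.
Qed.

Lemma fhom_fsubst k n (E : fps K k -> fps K n) (w : fps K k) f : fhom E ->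
  ord_ge 1 w -> E (fsubst w f) = fsubst (E w) f.
Proof.
move=> hE w1; have Ew1 : ord_ge 1 (E w) by apply: (fhom_ord hE).
apply: (fhom_ext (fhom_comp (fsubst_fhom w1) hE) (fsubst_fhom Ew1)) => i.
by rewrite /= (ord1 i) !fsubst_var.
Qed.

Lemma fvarX n (i : 'I_n) k a :
  (fvar K i ^+ k) a = (mnm_muln (mnm1 i) k == a)%:R.
Proof.
rewrite -fps_of_mpolyX -rmorphXn /= /fps_of_mpoly -mcoeffX; congr mcoeff.
by elim: k => [|k IHk]; rewrite ?mpolyX0 // exprS IHk -mpolyXD -mulmS.
Qed.

Lemma fsubst_fvarE n (i : 'I_n) (f : fps K 1) a : fsubst (fvar K i) f a =
  f (mnm_muln (mnm1 ord0) (a i)) *+ (mnm_muln (mnm1 i) (a i) == a).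
Proof.
rewrite /fsubst (@fcompE _ _ _ (mdeg a)) => // [|_]; last exact: ord_ge_var.
have -> : psubst (fun=> fvar K i) (ftrunc (mdeg a) f) =
   \sum_(b : bmultinom 1 (mdeg a).+1)
     psubst (fun=> fvar K i) (f b *: mpolyX K b) by rewrite raddf_sum.
rewrite fsumE.
have bE (b : multinom 1) : b = mnm_muln (mnm1 ord0) (b ord0).
  by apply/mnmP => j; rewrite mulmnE mnm1E (ord1 j) eqxx mul1n.
have term b : psubst (fun=> fvar K i) (f b *: mpolyX K b) a =
    f b * (mnm_muln (mnm1 i) (b ord0) == a)%:R.
  rewrite /psubst mmapZ fconstM mmapX /mmap1 big_ord_recl big_ord0 mulr1.
  by rewrite fvarX.
under eq_bigr => b _ do rewrite term.
have muln_i k : mnm_muln (mnm1 i) k i = k by rewrite mulmnE mnm1E eqxx mul1n.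
case: eqP => [ea|na]; last first.
  rewrite mulr0n big1 // => b _; case: eqP => [eb|]; last by rewrite mulr0.
  by case: na; rewrite -eb muln_i.
pose c : multinom 1 := mnm_muln (mnm1 ord0) (a i).
have lec : (mdeg c < (mdeg a).+1)%N.
  by rewrite /c -[in X in (_ < X)%N]ea !mdegMn !mdeg1 !mul1n ltnS.
rewrite (bigD1 (BMultinom lec)) //= -/c big1 ?addr0 => [|b nb].
  by rewrite /c mulmnE mnm1E eqxx mul1n ea eqxx mulr1.
case: eqP => [eb|]; last by rewrite mulr0.
case/eqP: nb; apply: val_inj; rewrite /= (bE b) /c; congr mnm_muln.
by have := congr1 (fun c' : multinom n => c' i) eb; rewrite /= muln_i.
Qed.

(** The divided difference (f(x) - f(y)) / (x - y): the quotient of x^k - y^k by x - y is the sum of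
    all monomials of degree k - 1. *)
Definition fdiffquot (f : fps K 1) : fps K 2 :=
  fun a => f (mnm_muln (mnm1 ord0) (mdeg a).+1).

Lemma fvar_mul_mdeg n (i : 'I_n) (g : nat -> K) a :
  (fvar K i * (fun b => g (mdeg b).+1 : K) : fps K n) a =
  g (mdeg a) *+ (a i != 0%N).
Proof.
case: (eqVneq (a i) 0%N) => [ai|/multinomSP[b ->]]; first by rewrite fvar_mul0.
by rewrite fvar_mulE mdegD mdeg1 addn1.
Qed.

Lemma fdiffquotE f :
  (fvar K ord0 - fvar K (lift ord0 ord0)) * fdiffquot f =
  fsubst (fvar K ord0) f - fsubst (fvar K (lift ord0 ord0)) f.
Proof.
have fq i a : (fvar K i * fdiffquot f) a =
    f (mnm_muln (mnm1 ord0) (mdeg a)) *+ (a i != 0%N).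
  exact: (fvar_mul_mdeg i (fun k => f (mnm_muln (mnm1 ord0) k))).
apply/funext => a; rewrite mulrBl !fsubE !fq !fsubst_fvarE.
have -> : mdeg a = (a ord0 + a (lift ord0 ord0))%N.
  by rewrite mdegE big_ord_recl big_ord_recl big_ord0 addn0.
have E0 : (mnm_muln (mnm1 ord0) (a ord0) == a) = (a (lift ord0 ord0) == 0%N).
  apply/eqP/eqP => [<-|a1]; first by rewrite mulmnE mnm1E mul0n.
  apply/mnmP => j; rewrite mulmnE mnm1E; case: (unliftP ord0 j) => [j' ->|->].
    by rewrite (ord1 j') a1 mul0n.
  by rewrite eqxx mul1n.
have E1 : (mnm_muln (mnm1 (lift ord0 ord0)) (a (lift ord0 ord0)) == a) = (a ord0 == 0%N).
  apply/eqP/eqP => [<-|a1]; first by rewrite mulmnE mnm1E mul0n.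
  apply/mnmP => j; rewrite mulmnE mnm1E; case: (unliftP ord0 j) => [j' ->|->].
    by rewrite (ord1 j') eqxx mul1n.
  by rewrite a1 mul0n.
rewrite E0 E1; case: (eqVneq (a ord0) 0%N) => [->|_];
  case: (eqVneq (a (lift ord0 ord0)) 0%N) => [->|_];
  by rewrite ?addn0 ?add0n ?mulr0n ?mulr1n ?subrr ?subr0 ?sub0r.
Qed.

Lemma fhom_diffquot k n (E : fps K k -> fps K n) (x y a b q : fps K k)
    (x' y' a' b' : fps K n) :
  fhom E -> E x = x' -> E y = y' -> E a = a' -> E b = b' -> (x - y) * q = a - b ->
  a' - b' = (x' - y') * E q.
Proof.
move=> hE <- <- <- <- /(congr1 E).
by rewrite (fhomM hE) (fhomB hE) (fhomB hE).
Qed.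

(** Substitution into the divided difference. It transfers divisibility from [v - w] to the values
    of [f]: by rho for initial conditions, by the defining series for tangency. *)
Lemma fsubst_sub n (v w : fps K n) f : ord_ge 1 v -> ord_ge 1 w ->
  exists q : fps K n, fsubst v f - fsubst w f = (v - w) * q.
Proof.
move=> v1 w1; pose G (i : 'I_2) := if i == ord0 then v else w.
have G1 i : ord_ge 1 (G i) by rewrite /G; case: ifP.
have hG := fcomp_fhom G1; exists (fcomp (fdiffquot f) G).
have GE i : fcomp (fsubst (fvar K i) f) G = fsubst (G i) f.
  apply: etrans (fhom_fsubst f hG (@ord_ge_var K 2 i)) _.
  by rewrite (fcomp_var i G1).
exact: (fhom_diffquot hG (fcomp_var ord0 G1) (fcomp_var (lift ord0 ord0) G1)
  (GE ord0) (GE (lift ord0 ord0)) (fdiffquotE f)).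
Qed.

End Substitution1.

(** * The polynomial system in rho *)

Section System.
Variables (K : numClosedFieldType) (n : nat).
Local Notation m := n.+1.
Local Notation A := (fps K 2).
Local Notation i0 := (ord0 : 'I_2).
Local Notation i1 := (lift ord0 ord0 : 'I_2).

Definition rho : A := fvar K i0.
Definition uvar : A := fvar K i1.
Definition fimag k : fps K k := fconst 'i.
Definition fhalf k : fps K k := fconst 2^-1.
Local Notation I := (@fimag 2).
Local Notation h := (@fhalf 2).
Definition eps : A := uvar ^+ n.

(* With s = Us: Ua = 1 / (1 + i eps s), Ud = 1 / (1 - i eps s), Uf is the
   derivative of s, and Up, Uq are the coefficients of the first integral
   Up * B(w) - Uq * B(wbar) + 2 i rho, where w = u (1 + i eps s). *)
Inductive unknown := Us | Up | Uq | Ua | Ud | Uf.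

Section RightHandSide.
Variable Y : unknown -> A.

(** For w = u / x this is u^m (1 - w^n) / w^m, the logarithmic derivative of mu at w scaled by u^m;
    hence u^m B'(w) = kap(x) B(w) - x^m. *)
Definition kap (x : A) : A := x ^+ m - eps * x.
Definition dkap (x dx : A) : A := (x ^+ n *+ m - eps) * dx.
Definition rhs_p : A := - (h * I * Y Up * (kap (Y Ua) + kap (Y Ud)) * Y Uf).
Definition rhs_q : A := h * I * Y Uq * (kap (Y Ua) + kap (Y Ud)) * Y Uf.
Definition rhs_a : A := - (I * eps * Y Ua ^+ 2 * Y Uf).
Definition rhs_d : A := I * eps * Y Ud ^+ 2 * Y Uf.
(** Differentiating the first integral in rho and requiring a multiple of itself gives f * den = 2,
    which determines the derivative of s. *)
Definition den : A := Y Up * Y Ua ^+ m + Y Uq * Y Ud ^+ m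
  + I * rho * (kap (Y Ua) - kap (Y Ud)).
Definition dden : A := rhs_p * Y Ua ^+ m + Y Up * (Y Ua ^+ n * rhs_a *+ m)
  + (rhs_q * Y Ud ^+ m + Y Uq * (Y Ud ^+ n * rhs_d *+ m))
  + (I * (kap (Y Ua) - kap (Y Ud))
     + I * rho * (dkap (Y Ua) rhs_a - dkap (Y Ud) rhs_d)).
Definition rhs_f : A := - (h * Y Uf ^+ 2 * dden).

End RightHandSide.

(* Derivatives with respect to rho.  The equation for f is the derivative of
   f * den = 2, which makes the system polynomial. *)
Definition rhs (Y : unknown -> A) (j : unknown) : A :=
  match j with
  | Us => Y Uf | Up => rhs_p Y | Uq => rhs_q Y
  | Ua => rhs_a Y | Ud => rhs_d Y | Uf => rhs_f Y
  end.

(** At rho = 0 the points w and wbar coincide with u; then [den] is 2, so that f is 1. *)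
Definition init (j : unknown) : A := if j is Us then 0 else 1.

Lemma tame_rhs (M : K) j : 0 <= M -> tame M (fun Y => rhs Y j).
Proof.
move=> M0.
have te : tame M (fun Y : unknown -> A => eps).
  exact: (tameX n (tame_var unknown M i1)).
have tY U : tame M (fun Y : unknown -> A => Y U) by exact: tame_proj.
have tX U k : tame M (fun Y : unknown -> A => Y U ^+ k) by exact: tameX.
have tC c : tame M (fun Y : unknown -> A => fconst c) by exact: tame_const.
have tk U : tame M (fun Y : unknown -> A => kap (Y U)).
  exact: (tameD (tX U m) (tameN (tameM te (tY U)))).
have tdk U (R : (unknown -> A) -> A) : tame M R ->
    tame M (fun Y => dkap (Y U) (R Y)).
  move=> tR; exact: (tameM (tameD (tameMn m (tX U n)) (tameN te)) tR).
have thI : tame M (fun Y : unknown -> A => h * I) by exact: (tameM (tC _) (tC _)).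
have tkk := tameD (tk Ua) (tk Ud).
have tp : tame M rhs_p.
  exact: (tameN (tameM (tameM (tameM thI (tY Up)) tkk) (tY Uf))).
have tq : tame M rhs_q.
  exact: (tameM (tameM (tameM thI (tY Uq)) tkk) (tY Uf)).
have tIe : tame M (fun Y : unknown -> A => I * eps) by exact: (tameM (tC _) te).
have ta : tame M rhs_a.
  exact: (tameN (tameM (tameM tIe (tX Ua 2)) (tY Uf))).
have td : tame M rhs_d by exact: (tameM (tameM tIe (tX Ud 2)) (tY Uf)).
have tI : tame M (fun Y : unknown -> A => I) by exact: tC.
have tdd : tame M dden.
  exact: (tameD (tameD
    (tameD (tameM tp (tX Ua m)) (tameM (tY Up) (tameMn m (tameM (tX Ua n) ta))))
    (tameD (tameM tq (tX Ud m)) (tameM (tY Uq) (tameMn m (tameM (tX Ud n) td)))))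
    (tameD (tameM tI (tameD (tk Ua) (tameN (tk Ud))))
      (tameM (tameM tI (tame_var unknown M i0))
        (tameD (tdk Ua _ ta) (tameN (tdk Ud _ td)))))).
case: j => //=.
exact: (tameN (tameM (tameM (tC _) (tX Uf 2)) tdd)).
Qed.

Lemma rhs_congr d Y Y' : (forall j, ord_ge d (Y j - Y' j)) ->
  forall j, ord_ge d (rhs Y j - rhs Y' j).
Proof. by move=> YY j; apply: (tame_congr (tame_rhs j ler01)). Qed.

Definition sol : unknown -> A := picard_sol i0 rhs init.

Lemma solE j : sol j = init j + fint i0 (rhs sol j).
Proof. exact: (picard_solE i0 init rhs_congr). Qed.

Lemma init_deriv j : fderiv i0 (init j) = 0.
Proof. by case: j; rewrite /= ?fderiv1 // fderiv0. Qed.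

Lemma sol_bound : exists r M : K, [/\ 0 < r, r <= 1, 0 < M &
  forall d j, fnorm r d (sol j) <= M].
Proof.
have bound j := tame_bound (tame_rhs j (ler0n K 2)).
have [C C0 RC] : exists2 C, 0 <= C & forall j r d Y, 0 <= r -> r <= 1 ->
    (forall j, fnorm r d (Y j) <= 2) -> fnorm r d (rhs Y j) <= C.
  have [C1 C10 R1] := bound Us; have [C2 C20 R2] := bound Up.
  have [C3 C30 R3] := bound Uq; have [C4 C40 R4] := bound Ua.
  have [C5 C50 R5] := bound Ud; have [C6 C60 R6] := bound Uf.
  exists (C1 + C2 + C3 + C4 + C5 + C6) => [|j r d Y r0 r1 Y2].
    by rewrite !addr_ge0.
  case: j; [move: (R1 _ _ _ r0 r1 Y2)|move: (R2 _ _ _ r0 r1 Y2)|move: (R3 _ _ _ r0 r1 Y2)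
    |move: (R4 _ _ _ r0 r1 Y2)|move: (R5 _ _ _ r0 r1 Y2)|move: (R6 _ _ _ r0 r1 Y2)];
    move=> /le_trans; apply; rewrite -subr_ge0.
  - by rewrite (_ : _ - _ = C2 + C3 + C4 + C5 + C6) ?addr_ge0 //; ring.
  - by rewrite (_ : _ - _ = C1 + C3 + C4 + C5 + C6) ?addr_ge0 //; ring.
  - by rewrite (_ : _ - _ = C1 + C2 + C4 + C5 + C6) ?addr_ge0 //; ring.
  - by rewrite (_ : _ - _ = C1 + C2 + C3 + C5 + C6) ?addr_ge0 //; ring.
  - by rewrite (_ : _ - _ = C1 + C2 + C3 + C4 + C6) ?addr_ge0 //; ring.
  - by rewrite (_ : _ - _ = C1 + C2 + C3 + C4 + C5) ?addr_ge0 //; ring.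
have C1 : 0 < 1 + C by apply: ltr_pwDl.
have r1 : (1 + C)^-1 <= 1 by rewrite invf_le1 // lerDl.
(* The initial values have norm at most 1, and the ball of radius 2 is preserved because r C <= 1
   for r = 1 / (1 + C). *)
exists (1 + C)^-1, 2; split; rewrite ?invr_gt0 ?ltr0n //.
have r0 : 0 <= (1 + C)^-1 by rewrite invr_ge0 ltW.
apply: (@picard_bound K 2 i0 unknown rhs init rhs_congr _ 1 2 C) => //.
- rewrite -[2]/(1 + 1) lerD2l mulrC ler_pdivrMr // mul1r lerDr //.
- by rewrite ler1n.
- move=> d j; have E c : fnorm (1 + C)^-1 d (fconst c : A) = `|c| by rewrite fnormC.
  have E1 := E 1; have E0 := E 0; rewrite rmorph1 normr1 in E1.
  by rewrite raddf0 normr0 in E0; case: j; rewrite /= ?E1 ?E0.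
- by move=> d Y Y2 j; apply: RC.
Qed.

End System.

Lemma half_add (K : numFieldType) : 2^-1 + 2^-1 = 1 :> K.
Proof. by rewrite [RHS](splitr 1) div1r. Qed.

(** * Relations satisfied by the solution, and tangency *)

Section Solution.
Variables (K : numClosedFieldType) (n : nat).
Hypothesis n_gt0 : (0 < n)%N.
Local Notation m := n.+1.
Local Notation A := (fps K 2).
Local Notation i0 := (ord0 : 'I_2).
Local Notation i1 := (lift ord0 ord0 : 'I_2).
Local Notation D := (@fderiv K 2 i0).
Local Notation I := (@fimag K 2).
Local Notation h := (@fhalf K 2).
Local Notation u := (uvar K).
Local Notation r := (rho K).
Local Notation e := (eps K n).
Variable Y : unknown -> A.
Hypothesis YE : forall j, Y j = init K j + fint i0 (rhs n Y j).
Local Notation s := (Y Us).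
Local Notation P := (Y Up).
Local Notation Q := (Y Uq).
Local Notation a := (Y Ua).
Local Notation d := (Y Ud).
Local Notation f := (Y Uf).

Lemma Y_deriv j : D (Y j) = rhs n Y j.
Proof. by rewrite {1}YE fderivD init_deriv add0r fderiv_fint. Qed.

Lemma Y_init j : exists y : A, Y j = init K j + r * y.
Proof. by exists (fdiv_int i0 (rhs n Y j)); rewrite {1}YE. Qed.

Lemma imag_sqr k : @fimag K k * @fimag K k = -1.
Proof. by rewrite /fimag -rmorphM /= -expr2 sqrCi rmorphN rmorph1. Qed.

Lemma half_half k : @fhalf K k + @fhalf K k = 1.
Proof. by rewrite /fhalf -raddfD /= half_add rmorph1. Qed.

Lemma opp_half_imag k : - (@fhalf K k * @fimag K k) = fconst (- (2^-1 * 'i)).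
Proof. by rewrite /fhalf /fimag raddfN /= rmorphM. Qed.

Lemma Du : D u = 0. Proof. by rewrite fderiv_var. Qed.
Lemma Drho : D r = 1. Proof. by rewrite fderiv_var. Qed.
Lemma DI : D I = 0. Proof. by rewrite fderivC. Qed.
Lemma Dh : D h = 0. Proof. by rewrite fderivC. Qed.
Lemma De : D e = 0. Proof. by rewrite fderivX Du mulr0 mul0rn. Qed.

Lemma ode_zero (l x y : A) : D x = l * x -> x = r * y -> x = 0.
Proof. exact: linear_ode_zero. Qed.

(** The pattern of the relations below: the difference of the two sides satisfies a linear
    homogeneous equation in rho and is divisible by rho, so it vanishes. The second argument of
    [ode_zero] is the quotient by rho. *)
Lemma sol_a_inv : a * (1 + I * e * s) = 1.
Proof.
apply/eqP; rewrite -subr_eq0; apply/eqP.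
have [s1 sE] := Y_init Us; have [a1 aE] := Y_init Ua.
apply: (@ode_zero (- (I * e * a * f)) _
  ((1 + r * a1) * (I * e * s1) + a1)).
  rewrite fderivB fderivM fderivD fderiv1 !fderivM DI De !Y_deriv /= /rhs_a.
  by ring.
by rewrite {1}aE sE /=; ring.
Qed.

Lemma sol_d_inv : d * (1 - I * e * s) = 1.
Proof.
apply/eqP; rewrite -subr_eq0; apply/eqP.
have [s1 sE] := Y_init Us; have [d1 dE] := Y_init Ud.
apply: (@ode_zero (I * e * d * f) _
  (- (1 + r * d1) * (I * e * s1) + d1)).
  rewrite fderivB fderivM fderivB fderiv1 !fderivM DI De !Y_deriv /= /rhs_d.
  by ring.
by rewrite {1}dE sE /=; ring.
Qed.

Lemma sol_pq : P * Q = 1.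
Proof.
apply/eqP; rewrite -subr_eq0; apply/eqP.
have [p1 pE] := Y_init Up; have [q1 qE] := Y_init Uq.
apply: (@ode_zero 0 _ (p1 + q1 + r * p1 * q1)).
  rewrite fderivB fderiv1 fderivM !Y_deriv /= /rhs_p /rhs_q; ring.
by rewrite {1}pE {1}qE /=; ring.
Qed.

Lemma DX_eq (x dx : A) k : D x = dx -> D (x ^+ k.+1) = x ^+ k * dx *+ k.+1.
Proof. by move=> <-; rewrite fderivX. Qed.

Lemma D_kap_eq (x dx : A) : D x = dx -> D (kap n x) = dkap n x dx.
Proof.
move=> Dx; rewrite /kap /dkap fderivB (DX_eq n Dx) fderivM De Dx.
by rewrite mul0r add0r mulrBl mulrnAl.
Qed.

Lemma D_den_expand (p q x y k l dp dq dx dy dk dl : A) :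
  D p = dp -> D q = dq -> D x = dx -> D y = dy -> D k = dk -> D l = dl ->
  D (p * x + q * y + I * r * (k - l)) =
  dp * x + p * dx + (dq * y + q * dy) + (I * (k - l) + I * r * (dk - dl)).
Proof.
move=> <- <- <- <- <- <-; rewrite !fderivD !fderivM DI Drho fderivB.
by move: I r (D _) (D _) (D _) (D _) (D _) (D _) => *; ring.
Qed.

Lemma D_den : D (den n Y) = dden n Y.
Proof.
exact: (D_den_expand (Y_deriv Up) (Y_deriv Uq)
  (DX_eq n (Y_deriv Ua)) (DX_eq n (Y_deriv Ud))
  (D_kap_eq (Y_deriv Ua)) (D_kap_eq (Y_deriv Ud))).
Qed.

Lemma expr_cong1 (x y : A) k : x = 1 + r * y -> exists z, x ^+ k = 1 + r * z :> A.
Proof.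
move=> xE; elim: k => [|k [z zE]]; first by exists 0; rewrite mulr0 addr0.
by exists (y + z + r * y * z); rewrite exprS zE xE; ring.
Qed.

Lemma sol_den : f * den n Y = 1 + 1.
Proof.
apply/eqP; rewrite -subr_eq0; apply/eqP.
have [p1 pE] := Y_init Up; have [q1 qE] := Y_init Uq.
have [a1 aE] := Y_init Ua; have [d1 dE] := Y_init Ud.
have [f1 fE] := Y_init Uf.
have [am amE] := expr_cong1 m aE; have [dm dmE] := expr_cong1 m dE.
have [z zE] : exists z : A, f * den n Y - (1 + 1) = r * z.
  exists (f1 * den n Y + p1 * a ^+ m + am + q1 * d ^+ m + dm
          + I * (kap n a - kap n d)).
  rewrite {1}fE /den amE dmE pE qE /=; ring.
apply: (@ode_zero (- (h * f * dden n Y)) _ z _ zE).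
rewrite fderivB fderivD !fderiv1 fderivM D_den Y_deriv /= /rhs_f.
have := half_half 2; move: h (dden n Y) (den n Y) f => h' E' E f' h2.
transitivity (- (h' * f' * E') * (f' * E - (1 + 1)) - ((h' + h') - 1) * (f' * E')).
  by ring.
by rewrite h2 subrr mul0r subr0.
Qed.

(** The weight u^m matches the expression of u^m B'(w) through B(w), so that differentiation in u
    requires no division by u. *)
Definition Dp (x : A) : A := u ^+ m * fderiv i1 x.

Lemma DpD x y : Dp (x + y) = Dp x + Dp y.
Proof. by rewrite /Dp fderivD mulrDr. Qed.
Lemma DpN x : Dp (- x) = - Dp x.
Proof. by rewrite /Dp fderivN mulrN. Qed.
Lemma DpM x y : Dp (x * y) = Dp x * y + x * Dp y.
Proof. by rewrite /Dp fderivM; move: (u ^+ m) (fderiv _ _) (fderiv _ _) => *; ring. Qed.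
Lemma DpC c : Dp (fconst c) = 0.
Proof. by rewrite /Dp fderivC mulr0. Qed.
Lemma Dp0 : Dp 0 = 0.
Proof. by rewrite /Dp fderiv0 mulr0. Qed.
Lemma Dp1 : Dp 1 = 0.
Proof. by rewrite /Dp fderiv1 mulr0. Qed.
Lemma DpI : Dp I = 0. Proof. exact: DpC. Qed.
Lemma Dph : Dp h = 0. Proof. exact: DpC. Qed.
Lemma Dprho : Dp r = 0.
Proof. by rewrite /Dp fderiv_var mulr0. Qed.
Lemma Dpu : Dp u = u * e.
Proof. by rewrite /Dp fderiv_var mulr1 exprS. Qed.
Lemma Dpe : Dp e = n%:R * e ^+ 2.
Proof.
rewrite /Dp fderivX fderiv_var mulr1 mulr_natl mulrnAr; congr (_ *+ _).
by rewrite -!exprD -exprM; congr (_ ^+ _); lia.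
Qed.
Lemma D_Dp x : D (Dp x) = Dp (D x).
Proof.
by rewrite /Dp fderivM (DX_eq n Du) mulr0 mul0rn mul0r add0r fderiv_comm.
Qed.
Lemma DpX_eq (x dx : A) k : Dp x = dx -> Dp (x ^+ k.+1) = x ^+ k * dx *+ k.+1.
Proof.
by move=> <-; rewrite /Dp fderivX mulrnAr mulrCA.
Qed.
Lemma Dp_kap_eq (x dx : A) : Dp x = dx ->
  Dp (kap n x) = dkap n x dx - n%:R * e ^+ 2 * x.
Proof.
move=> Dx; rewrite /kap /dkap DpD DpN (DpX_eq n Dx) DpM Dpe Dx.
by rewrite -mulrnAl; move: (x ^+ n *+ m) e => X e'; ring.
Qed.

(** The slope d/du (u^m s), so that dw/du = 1 + i tau on the hypersurface. *)
Definition tau : A := e * s *+ m + Dp s.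

Lemma tauE : tau = e * s * (n%:R + 1) + Dp s.
Proof. by rewrite /tau natr1 mulr_natr. Qed.

Lemma D_tau : D tau = (n%:R + 1) * e * f + Dp f.
Proof.
rewrite tauE fderivD fderivM (fderivM _ e) De D_Dp (Y_deriv Us) /=.
have -> : D (n%:R + 1) = 0.
  by rewrite natr1 -(rmorph_nat (@fconst K 2)) fderivC.
by ring.
Qed.

Lemma Dp_inverse (J x : A) : Dp J = 0 -> x * (1 + J * e * s) = 1 ->
  Dp x = - (J * x ^+ 2 * e * (tau - e * s)).
Proof.
move=> DJ xJ; have := congr1 Dp xJ.
rewrite DpM DpD Dp1 add0r !DpM DJ mul0r add0r Dpe tauE.
move: e s (Dp s) (Dp x) xJ => e' s' ds dx xJ dE; move: (n%:R) dE => N dE.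
transitivity (x * (dx * (1 + J * e' * s') + x * (J * (N * e' ^+ 2) * s' + J * e' * ds))
  - (x * (1 + J * e' * s') - 1) * dx - J * x ^+ 2 * e' * (e' * s' * N + ds)).
  by ring.
by rewrite dE xJ; ring.
Qed.

Local Notation k1 := (kap n a).
Local Notation k2 := (kap n d).
Local Notation t := tau.

(** The system prescribes P only along rho. Vanishing of [chi] is the evolution along u expected
    from P^2 = mu(wbar) / mu(w), a compatibility that has to be proved. *)
Definition chi : A := Dp P + h * P * (k1 * (1 + I * t) - k2 * (1 - I * t)).

Lemma D_chi_expand (p x y f' t' : A) (dp kx ky lx ly dt : A) :
  D p = - (h * I * p * (x + y) * f') -> Dp p = dp -> D x = kx -> D y = ky ->
  Dp x = lx -> Dp y = ly -> D t' = dt ->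
  D (Dp p + h * p * (x * (1 + I * t') - y * (1 - I * t'))) =
  - (h * I * (dp * (x + y) * f' + p * ((lx + ly) * f' + (x + y) * Dp f')))
  + h * (- (h * I * p * (x + y) * f') * (x * (1 + I * t') - y * (1 - I * t'))
     + p * (kx * (1 + I * t') + x * (I * dt) - (ky * (1 - I * t') - y * (I * dt)))).
Proof.
move=> Dpp <- <- <- <- <- <-; rewrite fderivD D_Dp Dpp.
rewrite DpN !DpM !DpD DpI Dph fderivM (fderivM _ h) Dh Dpp fderivB.
rewrite !fderivM fderivB !fderivD fderiv1 fderivM DI.
move: I h (D _) (D _) (D _) (Dp _) (Dp _) (Dp _) (Dp _) => *; ring.
Qed.

Lemma kapE x : kap n x = x * x ^+ n - e * x.
Proof. by rewrite /kap exprS. Qed.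

Lemma dkapE x dx : dkap n x dx = ((n%:R + 1) * x ^+ n - e) * dx.
Proof. by rewrite /dkap natr1 mulr_natl. Qed.

Lemma chi_bracket_kap (J x : A) : x * (1 + J * e * s) = 1 ->
  - (J * (dkap n x (- (J * x ^+ 2 * e * (t - e * s))) - n%:R * e ^+ 2 * x) * f)
  + dkap n x (- (J * e * x ^+ 2 * f)) * (1 + J * t)
  + J * (n%:R + 1) * e * kap n x * f = 0.
Proof. by move=> xJ; rewrite !dkapE kapE; apply: chi_bracket. Qed.

Lemma sol_dN : d * (1 + (- I) * e * s) = 1.
Proof. by rewrite !mulNr sol_d_inv. Qed.

Lemma DpNI : Dp (- I) = 0. Proof. by rewrite DpN DpI oppr0. Qed.

Lemma D_chi : D chi = - (h * I * (k1 + k2) * f) * chi.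
Proof.
have b1 := chi_bracket_kap sol_a_inv.
have b2 := chi_bracket_kap sol_dN.
have Dpa := Dp_inverse DpI sol_a_inv.
have Dpd := Dp_inverse DpNI sol_dN.
have Dd : D d = - (- I * e * d ^+ 2 * f).
  by rewrite (Y_deriv Ud) /= /rhs_d !mulNr opprK.
rewrite /chi (D_chi_expand (Y_deriv Up) erefl (D_kap_eq (Y_deriv Ua))
  (D_kap_eq Dd) (Dp_kap_eq Dpa) (Dp_kap_eq Dpd) D_tau).
apply: (@chi_linear _ I h P (Dp P) k1 k2 _ _ _ _ f (Dp f) t _ (n%:R + 1) e erefl b1).
apply: etrans b2; move: (dkap _ _ _) (dkap _ _ _) (kap _ d) => x y z.
by move: I f t e (n%:R) d => *; ring.
Qed.

Lemma cong1_sub (x y x1 y1 : A) k : x = 1 + r * x1 -> y = 1 + r * y1 ->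
  exists z : A, x ^+ k - y ^+ k = r * z.
Proof.
move=> /expr_cong1-/(_ k)[z zE] /expr_cong1-/(_ k)[z' zE'].
by exists (z - z'); rewrite zE zE'; ring.
Qed.

Lemma tau_vanish : exists y : A, t = r * y.
Proof.
have [s1 sE] := Y_init Us; exists (e * s1 *+ m + Dp s1).
rewrite /tau sE /= add0r DpM Dprho mul0r add0r mulrDr mulrnAr.
by rewrite mulrCA.
Qed.

Lemma chi0 : chi = 0.
Proof.
have [p1 pE] := Y_init Up; have [a1 aE] := Y_init Ua.
have [d1 dE] := Y_init Ud; have [t1 tE] := tau_vanish.
have [z zE] := cong1_sub m aE dE.
apply: (ode_zero (y := Dp p1 + h * P * (z - e * (a1 - d1) + I * t1 * (k1 + k2)))
  D_chi).
have DpP : Dp P = r * Dp p1 by rewrite pE DpD Dp1 add0r DpM Dprho mul0r add0r.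
have kk : k1 - k2 = r * (z - e * (a1 - d1)).
  have -> : k1 - k2 = (a ^+ m - d ^+ m) - e * (a - d).
    by rewrite /kap; move: (a ^+ m) (d ^+ m) e => *; ring.
  by rewrite zE {1}aE {1}dE /=; move: e => *; ring.
rewrite /chi DpP.
have -> : k1 * (1 + I * t) - k2 * (1 - I * t) = (k1 - k2) + I * t * (k1 + k2).
  by move: k1 k2 I t => *; ring.
rewrite kk tE; move: (k1 + k2) (Dp p1) I h e P => *; ring.
Qed.

Lemma Dp_P : Dp P = - (h * P * (k1 * (1 + I * t) - k2 * (1 - I * t))).
Proof. by apply/eqP; rewrite -addr_eq0; apply/eqP/chi0. Qed.

Lemma Dp_Q : Dp Q = h * Q * (k1 * (1 + I * t) - k2 * (1 - I * t)).
Proof.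
have := congr1 Dp sol_pq; rewrite DpM Dp_P Dp1; have := sol_pq.
move: P Q (Dp Q) h (_ - _) => p q dq h' x pq E.
transitivity (q * (- (h' * p * x) * q + p * dq) + (1 - p * q) * dq
  + h' * q * x * (p * q)); first by ring.
by rewrite E pq subrr mulr0 mul0r !add0r mulr1.
Qed.

Section FormalSolution.
Variable B : fps K 1.
Local Notation X := (fvar K (ord0 : 'I_1)).
Hypothesis BE : X ^+ m * fderiv ord0 B = (1 - X ^+ n) * B - 1.

Section Sign.
Variables (J x Jf : A).
Hypotheses (DJ : D J = 0) (DpJ : Dp J = 0) (xJ : x * (1 + J * e * s) = 1).

(** For J = i and J = - i these are w and wbar on the hypersurface; both signs are treated at
    once. *)
Definition wsub : A := u * (1 + J * e * s).
Local Notation w := wsub.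

Lemma wsub_ord : ord_ge 1 w.
Proof. exact/ord_geMl/ord_ge_var. Qed.

Lemma wsub_mul : x * w = u.
Proof. by rewrite /wsub mulrCA xJ mulr1. Qed.

Lemma B_wsub : w ^+ m * fsubst w (fderiv ord0 B) = (1 - w ^+ n) * fsubst w B - 1.
Proof.
have hw := fsubst_fhom wsub_ord; have := congr1 (fsubst w) BE.
rewrite (fhomM hw) (fhomX hw) (fhomB hw) (fhomM hw) (fhomB hw) (fhomX hw).
by rewrite (fhom1 hw) fsubst_var //; apply: wsub_ord.
Qed.

Lemma kap_expand (v xm wm W b' wn e' : A) : v = xm * wm ->
  wm * W = (1 - wn) * b' - 1 -> xm * wn = e' * x ->
  v * W = (xm - e' * x) * b' - xm.
Proof.
move=> -> E <-; rewrite -mulrA E; ring.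
Qed.

(** Multiply the equation of B at w by x^m: since x w = u, the factor x^m w^m becomes u^m and x^m
    w^n becomes eps x. *)
Lemma B_wsub_deriv :
  u * e * fsubst w (fderiv ord0 B) = kap n x * fsubst w B - x ^+ m.
Proof.
have ue : u * e = x ^+ m * w ^+ m by rewrite -exprMn wsub_mul exprS.
have xw : x ^+ m * w ^+ n = e * x.
  by rewrite exprS -mulrA -exprMn wsub_mul mulrC.
exact: (kap_expand ue B_wsub xw).
Qed.

Lemma D_Bw : D (fsubst w B) = J * f * (kap n x * fsubst w B - x ^+ m).
Proof.
have wo := wsub_ord; rewrite fderiv_fsubst // -B_wsub_deriv.
have -> : D w = u * (J * e * f).
  rewrite /wsub fderivM Du mul0r add0r fderivD fderiv1 add0r fderivM.
  by rewrite (fderivM _ J) DJ De mul0r mulr0 !add0r mul0r add0r (Y_deriv Us).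
by move: (fsubst _ _) u e => *; ring.
Qed.

Lemma Dp_Bw : Dp (fsubst w B) = (kap n x * fsubst w B - x ^+ m) * (1 + J * t).
Proof.
have wo := wsub_ord; rewrite -B_wsub_deriv /Dp fderiv_fsubst // mulrCA.
have -> : u ^+ m * fderiv i1 w = u * e * (1 + J * t).
  rewrite -/(Dp w) /wsub DpM Dpu DpD Dp1 add0r !DpM DpJ mul0r add0r Dpe tauE.
  by move: e u (Dp s) => *; ring.
by move: (fsubst _ _) => *; ring.
Qed.

End Sign.

Local Notation w := (wsub I).
Local Notation o := (wsub (- I)).
Local Notation b := (fsubst w B).
Local Notation c := (fsubst o B).

Definition invariant : A := P * b - Q * c + (1 + 1) * I * r.

Lemma D_three (p q x y dp dq dx dy : A) :
  D p = dp -> D q = dq -> D x = dx -> D y = dy ->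
  D (p * x - q * y + (1 + 1) * I * r) =
  dp * x + p * dx - (dq * y + q * dy) + (I + I).
Proof.
move=> <- <- <- <-; rewrite fderivD fderivB !fderivM DI Drho fderivD fderiv1.
by move: I r (D _) (D _) (D _) (D _) => *; ring.
Qed.

Lemma DNI : D (- I) = 0. Proof. by rewrite fderivN DI oppr0. Qed.

Lemma D_invariant : D invariant = h * I * f * (k1 - k2) * invariant.
Proof.
have Db := D_Bw DI sol_a_inv; have Dc := D_Bw DNI sol_dN.
rewrite !mulNr in Dc.
rewrite /invariant (D_three (Y_deriv Up) (Y_deriv Uq) Db Dc).
exact: (invariant_linear _ _ (imag_sqr 2) (half_half 2) sol_den).
Qed.

Lemma cong_three (p q x y z p1 q1 q' v : A) : p = 1 + r * p1 -> q = 1 + r * q1 ->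
  x - y = v * q' -> v = r * z ->
  p * x - q * y + (1 + 1) * I * r =
  r * (z * q' + p1 * x - q1 * y + (1 + 1) * I).
Proof.
move=> -> -> /eqP; rewrite subr_eq => /eqP -> ->.
by move: I r => *; ring.
Qed.

(** The initial value vanishes because w - wbar is a multiple of s, hence of rho, and so is the
    difference of the values of B; moreover P and Q are both 1 there. *)
Lemma invariant0 : invariant = 0.
Proof.
have [p1 pE] : exists x : A, P = 1 + r * x := Y_init Up.
have [q1 qE] : exists x : A, Q = 1 + r * x := Y_init Uq.
have [s1 sE] := Y_init Us.
have [q qwo] := fsubst_sub B (wsub_ord I) (wsub_ord (- I)).
have wo : w - o = r * ((1 + 1) * u * I * e * s1).
  by rewrite /wsub sE /= add0r; move: u I e r => *; ring.
exact: (ode_zero D_invariant (cong_three pE qE qwo wo)).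
Qed.

Lemma Dp_three (p q x y dp dq dx dy : A) :
  Dp p = dp -> Dp q = dq -> Dp x = dx -> Dp y = dy ->
  Dp (p * x - q * y + (1 + 1) * I * r) = dp * x + p * dx - (dq * y + q * dy).
Proof.
move=> <- <- <- <-; rewrite DpD DpD DpN !DpM DpI Dprho DpD Dp1.
by move: I r (Dp _) (Dp _) (Dp _) (Dp _) => *; ring.
Qed.

Lemma tau_den :
  t * den n Y = I * (P * a ^+ m - Q * d ^+ m) - r * (k1 + k2).
Proof.
have Db := Dp_Bw DpI sol_a_inv; have Dc := Dp_Bw DpNI sol_dN.
rewrite !mulNr in Dc.
have := Dp_three Dp_P Dp_Q Db Dc.
rewrite -/invariant invariant0 Dp0 => /esym E.
exact: (tau_identity (imag_sqr 2) (half_half 2) invariant0 E).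
Qed.

Definition bw (v : A) : A := v ^+ m * fsubst v B.
Definition theta : A :=
  h * ((1 - w ^+ n) * b - 1 + ((1 - o ^+ n) * c - 1)).

Lemma wsub_pow J x : x * (1 + J * e * s) = 1 ->
  (1 + J * e * s) ^+ m * x ^+ m = 1 /\
  (1 + J * e * s) ^+ m * kap n x = 1 - wsub J ^+ n.
Proof.
set y := 1 + J * e * s => xy.
have E : y ^+ m * x ^+ m = 1 by rewrite -exprMn mulrC xy expr1n.
split=> //; rewrite /kap mulrBr E; congr (_ - _).
rewrite /wsub -/y exprMn exprSr -/e.
transitivity (u ^+ n * y ^+ n * (x * y)); last by rewrite xy mulr1.
by rewrite /eps; move: (u ^+ n) (y ^+ n) => *; ring.
Qed.

Lemma tangency_scale (wm om v y z b' c' th x t' g : A) :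
  wm = v * y -> om = v * z ->
  x * th * g + h * (y * b' * (t' + I) + z * c' * (t' - I)) = 0 ->
  - (h * I) * (wm * b' - om * c') - x * th * (v * g)
  - t' * (h * (wm * b' + om * c')) = 0.
Proof.
move=> -> -> E; transitivity (- v * (x * th * g
  + h * (y * b' * (t' + I) + z * c' * (t' - I)))); last by rewrite E mulr0.
by move: I h => *; ring.
Qed.

(* Tangency of the real part of L to the hypersurface Im w = u^m s, written in
   the coordinates (rho, u) of the complexification. *)
Lemma tangency : - (h * I) * (bw w - bw o) - r * theta * (u ^+ m * f)
  - t * (h * (bw w + bw o)) = 0.
Proof.
have [E1 F1] := wsub_pow sol_a_inv; have [E2 F2] := wsub_pow sol_dN.
have T := tangency_identity (imag_sqr 2) (half_half 2) invariant0 sol_den tau_den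
  E1 E2 F1 F2.
rewrite -/theta in T.
exact: (tangency_scale (exprMn _ _ _) (exprMn _ _ _) T).
Qed.

Lemma tauE' : fderiv i1 (u ^+ m * s) = t.
Proof.
by rewrite fderivM fderivX fderiv_var mulr1 /tau /Dp -mulrnAl.
Qed.

Lemma D_um_s : D (u ^+ m * s) = u ^+ m * f.
Proof. by rewrite fderivM (DX_eq n Du) mulr0 mul0rn mul0r add0r (Y_deriv Us). Qed.

End FormalSolution.

End Solution.

(** * Conjugation of coefficients and reality of s *)

Section Conjugation.
Variables (K : numClosedFieldType).

Definition fconj k (f : fps K k) : fps K k := fun a => (f a)^*.

Section Fixed.
Variable k : nat.
Implicit Types f g : fps K k.

Lemma fconjD f g : fconj (f + g) = fconj f + fconj g.
Proof. by apply/funext => a; rewrite faddE /fconj faddE rmorphD. Qed.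

Lemma fconjN f : fconj (- f) = - fconj f.
Proof. by apply/funext => a; rewrite foppE /fconj foppE rmorphN. Qed.

Lemma fconjB f g : fconj (f - g) = fconj f - fconj g.
Proof. by rewrite fconjD fconjN. Qed.

Lemma fconjM f g : fconj (f * g) = fconj f * fconj g.
Proof.
apply/funext => a; rewrite /fconj -!fmul_mulE !fmulE rmorph_sum.
by apply: eq_bigr => p _; rewrite rmorphM.
Qed.

Lemma fconjC c : fconj (fconst c) = fconst c^* :> fps K k.
Proof. by apply/funext => a; rewrite /fconj /fconst rmorphMn. Qed.

Lemma fconj1 : fconj 1 = 1 :> fps K k.
Proof. by rewrite -(rmorph1 (@fconst K k)) fconjC conjC1. Qed.

Lemma fconj0 : fconj 0 = 0 :> fps K k.
Proof. by rewrite -(raddf0 (@fconst K k)) fconjC conjC0. Qed.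

Lemma fconjX f j : fconj (f ^+ j) = fconj f ^+ j.
Proof. by elim: j => [|j IHj]; rewrite ?fconj1 // !exprS fconjM IHj. Qed.

Lemma fconjMn f j : fconj (f *+ j) = fconj f *+ j.
Proof. by elim: j => [|j IHj]; rewrite ?mulr0n ?fconj0 // !mulrS fconjD IHj. Qed.

Lemma fconj_var i : fconj (fvar K i) = fvar K i :> fps K k.
Proof. by apply/funext => a; rewrite /fconj /fvar rmorph_nat. Qed.

Lemma fderiv_conj i f : fderiv i (fconj f) = fconj (fderiv i f).
Proof. by apply/funext => a; rewrite /fderiv /fconj rmorphMn. Qed.

Lemma fint_conj i f : fint i (fconj f) = fconj (fint i f).
Proof.
rewrite /fint fconjM fconj_var; congr (_ * _); apply/funext => a.
by rewrite /fdiv_int /fconj rmorphM fmorphV rmorph_nat.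
Qed.

Lemma fconj_imag : fconj (@fimag K k) = - @fimag K k :> fps K k.
Proof. by rewrite /fimag fconjC conjCi raddfN. Qed.

Lemma fconj_half : fconj (@fhalf K k) = @fhalf K k :> fps K k.
Proof. by rewrite /fhalf fconjC fmorphV rmorph_nat. Qed.

Lemma vf_conj (V : 'I_k -> fps K k) f :
  fconj (vf V f) = vf (fun i => fconj (V i)) (fconj f).
Proof.
rewrite /vf; elim/big_rec2: _ => [|i y1 y2 _ <-]; first exact: fconj0.
by rewrite fconjD fconjM fderiv_conj.
Qed.

Lemma fexp_conj (V : 'I_k -> fps K k) t f :
  fconj (fexp V t f) = fexp (fun i => fconj (V i)) t^* (fconj f).
Proof.
apply/funext => a; rewrite /fconj /fexp rmorph_sum; apply: eq_bigr => j _.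
rewrite /lie_coef !fconstM rmorphM fmorph_div rmorphXn rmorph_nat; congr (_ * _).
rewrite -[LHS]/(fconj (iter j (vf V) f) a); congr (_ a).
by elim: (val j) => //= l IHl; rewrite vf_conj IHl.
Qed.

End Fixed.

Lemma fsubst_conj k (i : 'I_k) f :
  fconj (fsubst (fvar K i) f) = fsubst (fvar K i) (fconj f).
Proof. by apply/funext => a; rewrite /fconj !fsubst_fvarE rmorphMn. Qed.

End Conjugation.

Lemma fconj_den_expand (K : numClosedFieldType)
    (p q x y k l dp dq dx dy dk dl p' q' x' y' k' l' dp' dq' dx' dy' dk' dl' : fps K 2) :
  p' = fconj q -> q' = fconj p -> x' = fconj y -> y' = fconj x ->
  k' = fconj l -> l' = fconj k -> dp' = fconj dq -> dq' = fconj dp ->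
  dx' = fconj dy -> dy' = fconj dx -> dk' = fconj dl -> dl' = fconj dk ->
  dp' * x' + p' * dx' + (dq' * y' + q' * dy')
  + (@fimag K 2 * (k' - l') + @fimag K 2 * rho K * (dk' - dl')) =
  fconj (dp * x + p * dx + (dq * y + q * dy)
  + (@fimag K 2 * (k - l) + @fimag K 2 * rho K * (dk - dl))).
Proof.
move=> -> -> -> -> -> -> -> -> -> -> -> ->.
rewrite !(fconjD, fconjM, fconjN) fconj_imag fconj_var -/(rho K).
move: (@fimag K 2) (rho K) (fconj p) (fconj q) (fconj x) (fconj y) (fconj k).
move: (fconj l) (fconj dp) (fconj dq) (fconj dx) (fconj dy) (fconj dk) (fconj dl).
by move=> *; ring.
Qed.

(** Conjugating the coefficients and exchanging P with Q and a with d is a symmetry of the system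
    and of its initial values, and s is fixed by the exchange; uniqueness of the solution
    concludes. *)
Lemma sol_real (K : numClosedFieldType) n : fconj (sol K n Us) = sol K n Us.
Proof.
pose swap j := match j with Up => Uq | Uq => Up | Ua => Ud | Ud => Ua | _ => j end.
pose Y' j := fconj (sol K n (swap j)).
have epsc : fconj (eps K n) = eps K n by rewrite /eps fconjX fconj_var.
have kapc x : fconj (kap n x) = kap n (fconj x) :> fps K 2.
  by rewrite /kap fconjB fconjX fconjM epsc.
have dkapc x dx : fconj (dkap n x dx) = dkap n (fconj x) (fconj dx) :> fps K 2.
  by rewrite /dkap fconjM fconjB fconjMn fconjX epsc.
have Ic := @fconj_imag K 2; have hc := @fconj_half K 2.
have E1 (Z : unknown -> fps K 2) : rhs_p n (fun j => fconj (Z (swap j))) = fconj (rhs_q n Z).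
  rewrite /rhs_p /rhs_q !fconjM fconjD !kapc Ic hc /=.
  by move: (@fimag K 2) (@fhalf K 2) (kap _ _) (kap _ _) => *; ring.
have E2 (Z : unknown -> fps K 2) : rhs_q n (fun j => fconj (Z (swap j))) = fconj (rhs_p n Z).
  rewrite /rhs_p /rhs_q fconjN !fconjM fconjD !kapc Ic hc /=.
  by move: (@fimag K 2) (@fhalf K 2) (kap _ _) (kap _ _) => *; ring.
have E3 (Z : unknown -> fps K 2) : rhs_a n (fun j => fconj (Z (swap j))) = fconj (rhs_d n Z).
  rewrite /rhs_a /rhs_d 3!fconjM fconjX epsc Ic /=.
  by move: (@fimag K 2) (eps K n) => *; ring.
have E4 (Z : unknown -> fps K 2) : rhs_d n (fun j => fconj (Z (swap j))) = fconj (rhs_a n Z).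
  rewrite /rhs_a /rhs_d fconjN 3!fconjM fconjX epsc Ic /=.
  by move: (@fimag K 2) (eps K n) => *; ring.
have Xc (x dx : fps K 2) : fconj (x ^+ n * dx *+ n.+1) = fconj x ^+ n * fconj dx *+ n.+1.
  by rewrite fconjMn fconjM fconjX.
have E5 (Z : unknown -> fps K 2) :
    dden n (fun j => fconj (Z (swap j))) = fconj (dden n Z).
  apply: fconj_den_expand; rewrite ?E1 ?E2 ?E3 ?E4 ?fconjX ?kapc ?dkapc ?Xc //.
pose R j := fconj (rhs n (sol K n) (swap j)).
have RE j : rhs n Y' j = R j.
  case: j; rewrite /R /= ?E1 ?E2 ?E3 ?E4 //.
  by rewrite /rhs_f E5 fconjN fconjM fconjM fconjX hc.
have Y'E j : Y' j = init K j + fint ord0 (rhs n Y' j).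
  rewrite RE /R fint_conj /Y' {1}solE fconjD; congr (_ + _).
  by case: j; rewrite /= ?fconj1 ?fconj0.
have := picard_unique (@rhs_congr K n) Y'E (@solE K n) Us.
by [].
Qed.

(** * Flows and automorphisms *)

Section Polarized.
Variables (K : numClosedFieldType).
Implicit Types (L : fmap2 K) (f : fps K 2).

Definition in_Zbar f : fps K (2 + 2) := fcomp f (fun i => fvar K (rshift 2 i)).

Lemma in_Z_fhom : fhom (@in_Z K).
Proof. by apply: fcomp_fhom => i; apply: ord_ge_var. Qed.

Lemma in_Zbar_fhom : fhom in_Zbar.
Proof. by apply: fcomp_fhom => i; apply: ord_ge_var. Qed.

Lemma in_Z_var i : in_Z (fvar K i) = fvar K (lshift 2 i).
Proof. by apply: fcomp_var => j; apply: ord_ge_var. Qed.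

Lemma in_Zbar_var i : in_Zbar (fvar K i) = fvar K (rshift 2 i).
Proof. by apply: fcomp_var => j; apply: ord_ge_var. Qed.

Lemma fbar_in_ZbarE f : fbar_in_Zbar f = in_Zbar (fconj f).
Proof. by []. Qed.

Definition real_vf L (i : 'I_(2 + 2)) : fps K (2 + 2) :=
  match fintype.split i with inl j => in_Z (L j) | inr j => fbar_in_Zbar (L j) end.

Lemma real_vfl L j : real_vf L (lshift 2 j) = in_Z (L j).
Proof.
by rewrite /real_vf (_ : lshift 2 j = unsplit (inl j)) // unsplitK.
Qed.

Lemma real_vfr L j : real_vf L (rshift 2 j) = fbar_in_Zbar (L j).
Proof.
by rewrite /real_vf (_ : rshift 2 j = unsplit (inr j)) // unsplitK.
Qed.

Lemma real_part_applyE L T : real_part_apply L T = vf (real_vf L) T.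
Proof.
apply/funext => a; rewrite /vf big_split_ord /= faddE !fsumE -big_split /=.
by apply: eq_bigr => i _; rewrite real_vfl real_vfr.
Qed.

Lemma real_vf_ord L : (forall i, ord_ge 2 (L i)) ->
  forall i, ord_ge 2 (real_vf L i).
Proof.
move=> L2 i; rewrite /real_vf; case: (fintype.split i) => j.
  exact/(fhom_ord in_Z_fhom).
apply/(fhom_ord in_Zbar_fhom) => a lta.
by rewrite L2 // rmorph0.
Qed.

(** A series in Z alone sees only the holomorphic half of the complexified field. *)
Lemma vf_in_Z L f : in_Z (vf L f) = vf (real_vf L) (in_Z f).
Proof.
rewrite {2}/vf big_split_ord /= [X in _ + X]big1 ?addr0 => [|i _]; last first.
  rewrite (fderiv_hom _ _ in_Z_fhom) big1 ?mulr0 // => j _.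
  rewrite in_Z_var fderiv_var (_ : _ == _ = false) ?mulr0 //.
  by apply/eqP => /(congr1 (@nat_of_ord _)) /= E; have := ltn_ord j; rewrite -E; lia.
rewrite /vf (fhom_sum in_Z_fhom); apply: eq_bigr => i _.
rewrite (fhomM in_Z_fhom) real_vfl (fderiv_hom _ _ in_Z_fhom); congr (_ * _).
rewrite (bigD1 i) //= in_Z_var fderiv_var eqxx mulr1 big1 ?addr0 // => j nji.
rewrite in_Z_var fderiv_var (_ : _ == _ = false) ?mulr0 //.
by rewrite (inj_eq (@lshift_inj _ _)) eq_sym (negbTE nji).
Qed.

Lemma vf_in_Zbar L f : in_Zbar (vf (fun i => fconj (L i)) f) =
  vf (real_vf L) (in_Zbar f).
Proof.
rewrite {2}/vf big_split_ord /= [X in X + _]big1 ?add0r => [|i _]; last first.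
  rewrite (fderiv_hom _ _ in_Zbar_fhom) big1 ?mulr0 // => j _.
  rewrite in_Zbar_var fderiv_var (_ : _ == _ = false) ?mulr0 //.
  by apply/eqP => /(congr1 (@nat_of_ord _)) /= E; have := ltn_ord i; rewrite E; lia.
rewrite /vf (fhom_sum in_Zbar_fhom); apply: eq_bigr => i _.
rewrite (fhomM in_Zbar_fhom) real_vfr (fderiv_hom _ _ in_Zbar_fhom); congr (_ * _).
rewrite (bigD1 i) //= in_Zbar_var fderiv_var eqxx mulr1 big1 ?addr0 // => j nji.
rewrite in_Zbar_var fderiv_var (_ : _ == _ = false) ?mulr0 //.
by rewrite (inj_eq (@rshift_inj _ _)) eq_sym (negbTE nji).
Qed.

Section Flow.
Variables (L : fmap2 K) (T : fps K (2 + 2)).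
Hypothesis L2 : forall i, ord_ge 2 (L i).

Definition lie_flow (t : K) : fmap2 K := fun i => fexp L t (fvar K i).

Lemma lie_flow_ord t i : ord_ge 1 (lie_flow t i).
Proof. exact/(fhom_ord (fexp_fhom L2 t))/ord_ge_var. Qed.

Lemma lie_flowE t f : fcomp f (lie_flow t) = fexp L t f.
Proof. by rewrite (fhomE f (fexp_fhom L2 t)). Qed.

Lemma lie_flow0 : lie_flow 0 = fid K.
Proof. by apply/funext => i; rewrite /lie_flow fexp0. Qed.

Lemma lie_flowD s t : lie_flow (s + t) = Defs.fmap_comp (lie_flow s) (lie_flow t).
Proof. by apply/funext => i; rewrite /Defs.fmap_comp lie_flowE addrC /lie_flow fexp_add. Qed.

Lemma lie_flow_linear t i j : lie_flow t i (mnm1 j) = (i == j)%:R.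
Proof.
rewrite /lie_flow /fexp mdeg1 big_ord_recl big_ord1 /lie_coef !fconstM /=.
rewrite vf_var L2 ?mdeg1 // mulr0 addr0 expr0 fact0 divr1 mul1r /fvar eq_sym.
rewrite (_ : (mnm1 i == mnm1 j) = (i == j)) //.
apply/eqP/eqP => [/(congr1 (fun a : multinom 2 => a i))|-> //].
by rewrite /= !mnm1E eqxx eq_sym; case: eqP.
Qed.

Lemma lie_flow_invertible t : formal_invertible (lie_flow t).
Proof.
split=> [i|]; first by apply: lie_flow_ord; rewrite mdeg0.
rewrite (_ : jac0 _ = 1%:M) ?unitmx1 //.
by apply/matrixP => i j; rewrite !mxE lie_flow_linear.
Qed.

(** Pullback by the flow of L is the Lie series of the complexified field, under which [T] is an
    eigenvector up to a series; [fexp_eigen] supplies the unit. *)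
Lemma lie_flow_automorphism l t : t^* = t -> real_part_apply L T = fmul l T ->
  T mnm0 = 0 -> (exists i, T (mnm1 i) <> 0) -> formal_automorphism T (lie_flow t).
Proof.
move=> tR; rewrite real_part_applyE fmul_mulE => LT T0 [i Ti].
split; first exact: lie_flow_invertible.
have V2 := real_vf_ord L2.
(* The field raises the order whereas [T] has a nonzero linear part; comparing linear terms forces
   [l] to vanish at 0. *)
have l1 : ord_ge 1 l.
  apply/ord_ge1P/eqP; have := vf_ord V2 (iffRL (ord_ge1P T) T0).
  move=> /(_ (mnm1 i)); rewrite mdeg1 => /(_ isT); rewrite LT.
  have -> : (l * T) (mnm1 i) = l mnm0 * T (mnm1 i).
    rewrite -[in LHS](subrK (fconst (l mnm0)) l) mulrDl faddE fconstM.
    have l0 : ord_ge 1 (l - fconst (l mnm0)).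
      by apply/ord_ge1P; rewrite fsubE /fconst eqxx subrr.
    rewrite (ord_geM l0 (iffRL (ord_ge1P T) T0)) ?add0r //.
    by rewrite mdeg1.
  by move/eqP; rewrite mulf_eq0 => /orP[//|/eqP].
have [e [e0 eT]] := fexp_eigen V2 t l1 LT.
exists e; split; first by rewrite e0; apply/eqP/oner_neq0.
rewrite fmul_mulE -eT (fhomE T (fexp_fhom V2 t)) /pullback.
congr fcomp; apply/funext => j; rewrite -(splitK j).
case: (fintype.split j) => i'; rewrite unsplitK /=.
  by rewrite (fexp_intertwine t _ L2 V2 in_Z_fhom (vf_in_Z L)) in_Z_var.
(* Here the reality of [t] enters: conjugation sends the Lie series of a field at time [t] to that
   of the conjugate field at the conjugate time. *)
rewrite fbar_in_ZbarE fexp_conj fconj_var tR.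
have L2' i0 : ord_ge 2 (fconj (L i0)) by move=> a lta; rewrite /fconj L2 ?rmorph0.
by rewrite (fexp_intertwine t _ L2' V2 in_Zbar_fhom (vf_in_Zbar L)) in_Zbar_var.
Qed.

End Flow.
End Polarized.

(** * The divergent field and the defining series *)

Section Euler.
Variables (K : numClosedFieldType) (n : nat).
Hypothesis n_gt0 : (0 < n)%N.
Local Notation m := n.+1.
Local Notation X := (fvar K (ord0 : 'I_1)).
Implicit Types f : fps K 1.

Definition coef1 f k : K := f (mnm_muln (mnm1 ord0) k).

Lemma coef1P f g : (forall k, coef1 f k = coef1 g k) -> f = g.
Proof.
move=> fg; apply/funext => a; have := fg (a ord0); rewrite /coef1.
rewrite (_ : mnm_muln _ _ = a) //; apply/mnmP => j.
by rewrite mulmnE mnm1E (ord1 j) eqxx mul1n.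
Qed.

Lemma coef1_varX f j k :
  coef1 (X ^+ j * f) k = if (j <= k)%N then coef1 f (k - j) else 0.
Proof.
elim: j k => [|j IHj] k; first by rewrite mul1r subn0.
rewrite exprS -mulrA; case: k => [|k].
  by rewrite /coef1 fvar_mul0 // mulmnE muln0.
by rewrite /coef1 mulmSr fvar_mulE -/(coef1 _ _) IHj subSS.
Qed.

Lemma coef1_deriv f k : coef1 (fderiv ord0 f) k = coef1 f k.+1 *+ k.+1.
Proof.
by rewrite /coef1 /fderiv -mulmSr mulmnE mnm1E eqxx mul1n.
Qed.

Lemma coef1_1 k : coef1 1 k = (k == 0%N)%:R.
Proof.
rewrite /coef1 foneE; congr (_%:R); congr nat_of_bool.
by rewrite -mdeg_eq0 mdegMn mdeg1 mul1n.
Qed.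

Definition euler_coef j : nat := \prod_(i < j) (1 + i * n).

Definition euler : fps K 1 := fun a =>
  (euler_coef (a ord0 %/ n))%:R *+ (n %| a ord0).

Lemma coef1_euler k : coef1 euler k = (euler_coef (k %/ n))%:R *+ (n %| k).
Proof. by rewrite /coef1 /euler mulmnE mnm1E eqxx mul1n. Qed.

(** For the coefficients b_k of the series this reads b_0 = 1, b_k = 0 for 0 < k < n, and b_k = (1 +
    (k - n)) b_(k-n) for k >= n. *)
Lemma eulerE : X ^+ m * fderiv ord0 euler = (1 - X ^+ n) * euler - 1.
Proof.
apply: coef1P => k; rewrite coef1_varX coef1_deriv.
have -> : coef1 ((1 - X ^+ n) * euler - 1) k =
    coef1 euler k - coef1 (X ^+ n * euler) k - coef1 1 k.
  by rewrite mulrBl mul1r.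
rewrite coef1_varX coef1_1; case: (ltnP n k) => [ltnk|lekn].
  rewrite (ltnW ltnk) subnSK // !coef1_euler.
  have [j ->] : exists j, k = (j + n)%N by exists (k - n)%N; rewrite subnK // ltnW.
  rewrite addnK dvdn_addl // addn_eq0 (gtn_eqF n_gt0) andbF subr0.
  rewrite divnDr // divnn n_gt0 addn1 /euler_coef big_ord_recr /=.
  case: (boolP (n %| j)%N) => [dj|_]; last by rewrite !mulr0n mul0rn subrr.
  by rewrite !mulr1n divnK // mulnDr muln1 natrD addrAC subrr add0r natrM mulr_natr.
case: (ltngtP k n) lekn => // [ltkn _|-> _].
  rewrite subr0 coef1_euler; case: k ltkn => [|k] ltkn.
    by rewrite dvdn0 div0n /euler_coef big_ord0 subrr.
  by rewrite gtnNdvd // subr0.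
rewrite subnn !coef1_euler dvdn0 dvdnn div0n divnn n_gt0 /euler_coef.
by rewrite big_ord_recl !big_ord0 /= mul0n muln1 addn0 subrr gtn_eqF // subrr.
Qed.

Lemma euler_real : fconj euler = euler.
Proof. by apply/funext => a; rewrite /fconj /euler rmorphMn rmorph_nat. Qed.

Lemma euler_coef_ge j : (j`! <= euler_coef j)%N.
Proof.
elim: j => [|j IHj]; first by rewrite /euler_coef big_ord0.
rewrite factS /euler_coef big_ord_recr /= mulnC leq_mul // add1n ltnS.
by rewrite leq_pmulr.
Qed.

Definition euler_w : fps K 1 := X ^+ m * euler.
(** By [eulerE] this is w^m B'; the form without derivative is the one in which tangency is
    stated. *)
Definition euler_z : fps K 1 := (1 - X ^+ n) * euler - 1.

Lemma euler_w_ord : ord_ge m euler_w.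
Proof.
by apply: ord_geMl; rewrite -[X in ord_ge X]mul1n; apply/ord_geX/ord_ge_var.
Qed.

Lemma euler_z_ord : ord_ge m euler_z.
Proof.
rewrite /euler_z -eulerE; apply: ord_geMl.
by rewrite -[X in ord_ge X]mul1n; apply/ord_geX/ord_ge_var.
Qed.

Definition euler_field : fmap2 K := fun i =>
  if i == ord0 then @fhalf K 2 * fvar K ord0 * fsubst (fvar K (lift ord0 ord0)) euler_z
  else fsubst (fvar K (lift ord0 ord0)) euler_w.

Lemma euler_field_ord i : ord_ge m (euler_field i).
Proof.
have hw := fsubst_fhom (@ord_ge_var K 2 (lift ord0 ord0)).
rewrite /euler_field; case: ifP => _; last exact: (fhom_ord hw euler_w_ord).
exact: (ord_geMr _ (fhom_ord hw euler_z_ord)).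
Qed.

Lemma euler_field_ord2 i : ord_ge 2 (euler_field i).
Proof. by apply: ord_geW (euler_field_ord i). Qed.

Lemma euler_field_real i : fconj (euler_field i) = euler_field i.
Proof.
rewrite /euler_field; case: ifP => _.
  rewrite !fconjM fconj_var fconj_half fsubst_conj /euler_z.
  by rewrite fconjB fconjM fconjB !fconj1 fconjX fconj_var euler_real.
by rewrite fsubst_conj /euler_w fconjM fconjX fconj_var euler_real.
Qed.

Lemma euler_field_w k : euler_field (lift ord0 ord0) (mnm_muln (mnm1 (lift ord0 ord0)) k) =
  coef1 euler_w k.
Proof. by rewrite /euler_field /= fsubst_fvarE mulmnE mnm1E eqxx mul1n eqxx. Qed.

Lemma vanishes_euler_field : vanishes_to_order m euler_field.
Proof.
split=> [i a|]; first exact: euler_field_ord.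
exists (lift ord0 ord0), (mnm_muln (mnm1 (lift ord0 ord0)) m); split.
  by rewrite mdegMn mdeg1 mul1n.
rewrite euler_field_w coef1_varX leqnn subnn coef1_euler dvdn0 div0n /euler_coef.
by rewrite big_ord0; apply/eqP/oner_neq0.
Qed.

Local Notation zeta_ := (fvar K (rshift 2 ord0 : 'I_(2 + 2))).
Local Notation z_ := (fvar K (lshift 2 ord0 : 'I_(2 + 2))).
Local Notation w_ := (fvar K (lshift 2 (lift ord0 ord0) : 'I_(2 + 2))).
Local Notation om_ := (fvar K (rshift 2 (lift ord0 ord0) : 'I_(2 + 2))).
Local Notation I4 := (@fimag K (2 + 2)).
Local Notation h4 := (@fhalf K (2 + 2)).
Local Notation I2 := (@fimag K 2).
Local Notation h2 := (@fhalf K 2).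
Local Notation Y := (sol K n).
Local Notation s := (sol K n Us).

(** The functions rho = z zbar and u = (w + wbar) / 2 on the complexification, whose variables zbar
    and wbar are [zeta_] and [om_]. *)
Definition iota_arg (i : 'I_2) : fps K (2 + 2) :=
  if i == ord0 then z_ * zeta_ else h4 * (w_ + om_).

Definition iota_map (f : fps K 2) : fps K (2 + 2) := fcomp f iota_arg.

Lemma iota_arg_ord i : ord_ge 1 (iota_arg i).
Proof.
rewrite /iota_arg; case: ifP => _; first exact/ord_geMl/ord_ge_var.
by apply: ord_geMr; apply: ord_geD; apply: ord_ge_var.
Qed.

Lemma iota_fhom : fhom iota_map.
Proof. exact/fcomp_fhom/iota_arg_ord. Qed.

Lemma iota_var i : iota_map (fvar K i) = iota_arg i.
Proof. exact: (fcomp_var i iota_arg_ord). Qed.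

Definition graph_fun : fps K 2 := uvar K ^+ m * s.

Definition theta_series : fps K (2 + 2) :=
  - (h4 * I4) * (w_ - om_) - iota_map graph_fun.

(** From an identity on the hypersurface to one in the ambient space: the coefficients of the field
    at w and wbar differ from their values on the hypersurface by multiples of [T], and these
    differences make up the factor [l]. *)
Lemma tangent_ring (I h T Vw Vo Bz Bo z zt b1 o1 b2 o2 q1 q2 q3 q4 t uf : fps K (2 + 2)) :
  Vw = b1 + I * T * q1 -> Vo = o1 - I * T * q2 ->
  Bz = b2 + I * T * q3 -> Bo = o2 - I * T * q4 ->
  - (h * I) * (b1 - o1) - z * zt * (h * (b2 + o2)) * uf
    - t * (h * (b1 + o1)) = 0 ->
  exists l : fps K (2 + 2),
  - (h * I) * (Vw - Vo) - (uf * (h * z * Bz * zt + z * (h * zt * Bo))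
     + t * (h * (Vw + Vo))) = l * T.
Proof.
move=> -> -> -> -> E.
exists (- (h * I) * (I * q1 + I * q2) - uf * h * z * zt * (I * q3 - I * q4)
  - t * h * (I * q1 - I * q2)).
transitivity ((- (h * I) * (b1 - o1) - z * zt * (h * (b2 + o2)) * uf
    - t * (h * (b1 + o1))) + (- (h * I) * (I * q1 + I * q2)
    - uf * h * z * zt * (I * q3 - I * q4) - t * h * (I * q1 - I * q2)) * T).
  by ring.
by rewrite E add0r.
Qed.

Lemma hat_ring (I h w o U E S : fps K (2 + 2)) : I * I = -1 -> h + h = 1 ->
  U = h * (w + o) ->
  w - U * (1 + I * E * S) = I * (- (h * I) * (w - o) - U * E * S) /\
  o - U * (1 + - I * E * S) = - I * (- (h * I) * (w - o) - U * E * S).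
Proof.
move=> I2 h1 ->; split; apply/eqP; rewrite -subr_eq0; apply/eqP.
  transitivity ((1 - (h + h)) * w + h * (I * I + 1) * (w - o)); first by ring.
  by rewrite I2 h1 subrr addNr mulr0 !mul0r addr0.
transitivity ((1 - (h + h)) * o - h * (I * I + 1) * (w - o)); first by ring.
by rewrite I2 h1 subrr addNr mulr0 !mul0r subr0.
Qed.

Lemma vf_iota (V : 'I_(2 + 2) -> fps K (2 + 2)) (f : fps K 2) : vf V (iota_map f) =
  iota_map (fderiv ord0 f) * vf V (z_ * zeta_) +
  iota_map (fderiv (lift ord0 ord0) f) * vf V (h4 * (w_ + om_)).
Proof.
rewrite {1}/vf.
under eq_bigr => i _ do rewrite (fderiv_hom _ _ iota_fhom) mulr_sumr.
rewrite exchange_big /= big_ord_recl big_ord1.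
congr (_ + _).
  rewrite /vf mulr_sumr; apply: eq_bigr => i _.
  by rewrite iota_var mulrCA.
rewrite /vf mulr_sumr; apply: eq_bigr => i _.
by rewrite iota_var mulrCA.
Qed.

Lemma fhom_mul3 k l (E : fps K k -> fps K l) (x y z : fps K k) (x' y' z' : fps K l) :
  fhom E -> E x = x' -> E y = y' -> E z = z' -> E (x * y * z) = x' * y' * z'.
Proof. by move=> hE <- <- <-; rewrite !(fhomM hE). Qed.

Lemma fhom_affine k l (E : fps K k -> fps K l) (x J e y : fps K k) (J' : fps K l) :
  fhom E -> E J = J' -> E (x * (1 + J * e * y)) = E x * (1 + J' * E e * E y).
Proof. by move=> hE <-; rewrite (fhomM hE) (fhomD hE) (fhom1 hE) !(fhomM hE). Qed.

Lemma fhom_euler_z l (E : fps K 1 -> fps K l) (x b : fps K 1) (x' : fps K l) :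
  fhom E -> E x = x' -> E ((1 - x ^+ n) * b - 1) = (1 - x' ^+ n) * E b - 1.
Proof.
move=> hE <-; rewrite (fhomB hE) (fhomM hE) (fhomB hE) (fhom1 hE).
by rewrite (fhomX hE).
Qed.

Lemma fhom_euler_w l (E : fps K 1 -> fps K l) (x b : fps K 1) (x' : fps K l) :
  fhom E -> E x = x' -> E (x ^+ m * b) = x' ^+ m * E b.
Proof. by move=> hE <-; rewrite (fhomM hE) (fhomX hE). Qed.

Lemma fhom_tangent k l (E : fps K k -> fps K l)
    (h I b1 o1 b2 o2 r uf t : fps K k) (h' I' b1' o1' b2' o2' r' : fps K l) :
  fhom E -> E h = h' -> E I = I' -> E b1 = b1' -> E o1 = o1' -> E b2 = b2' ->
  E o2 = o2' -> E r = r' ->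
  - (h * I) * (b1 - o1) - r * (h * (b2 + o2)) * uf - t * (h * (b1 + o1)) = 0 ->
  - (h' * I') * (b1' - o1') - r' * (h' * (b2' + o2')) * E uf
    - E t * (h' * (b1' + o1')) = 0.
Proof.
move=> hE <- <- <- <- <- <- <- /(congr1 E); rewrite (fhom0 hE) => <-.
by rewrite !(fhomB hE, fhomM hE, fhomN hE, fhomD hE).
Qed.

Lemma tangent_congr (h I b1 o1 b2 o2 b1' o1' b2' o2' r uf t : fps K 2) :
  b1 = b1' -> o1 = o1' -> b2 = b2' -> o2 = o2' ->
  - (h * I) * (b1 - o1) - r * (h * (b2 + o2)) * uf - t * (h * (b1 + o1)) = 0 ->
  - (h * I) * (b1' - o1') - r * (h * (b2' + o2')) * uf - t * (h * (b1' + o1')) = 0.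
Proof. by move=> -> -> -> ->. Qed.

Lemma tangent_theta_series :
  exists l, real_part_apply euler_field theta_series = fmul l theta_series.
Proof.
pose V := real_vf euler_field.
have YE : forall j, Y j = init K j + fint ord0 (rhs n Y j) by exact: solE.
have in_Z1 g : in_Z (fsubst (fvar K (lift ord0 ord0)) g) = fsubst w_ g.
  by rewrite (fhom_fsubst g (in_Z_fhom K)) ?in_Z_var //; apply: ord_ge_var.
have in_Zb1 g : in_Zbar (fsubst (fvar K (lift ord0 ord0)) g) = fsubst om_ g.
  by rewrite (fhom_fsubst g (in_Zbar_fhom K)) ?in_Zbar_var //; apply: ord_ge_var.
have fz : euler_field ord0 = h2 * fvar K ord0 *
    fsubst (fvar K (lift ord0 ord0)) euler_z by [].
have fw : euler_field (lift ord0 ord0) = fsubst (fvar K (lift ord0 ord0)) euler_w.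
  by [].
have Vz : vf V z_ = h4 * z_ * fsubst w_ euler_z.
  rewrite vf_var /V real_vfl fz.
  exact: (fhom_mul3 (in_Z_fhom K) (fhomC (in_Z_fhom K) _) (in_Z_var K ord0) (in_Z1 _)).
have Vzeta : vf V zeta_ = h4 * zeta_ * fsubst om_ euler_z.
  rewrite vf_var /V real_vfr fbar_in_ZbarE euler_field_real fz.
  exact: (fhom_mul3 (in_Zbar_fhom K) (fhomC (in_Zbar_fhom K) _)
    (in_Zbar_var K ord0) (in_Zb1 _)).
have Vw : vf V w_ = fsubst w_ euler_w by rewrite vf_var /V real_vfl fw; exact: in_Z1.
have Vom : vf V om_ = fsubst om_ euler_w.
  by rewrite vf_var /V real_vfr fbar_in_ZbarE euler_field_real fw; exact: in_Zb1.
(* The points u + i u^m s and u - i u^m s with the same rho and u. In the ambient space w - wh = i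
   theta and wbar - oh = - i theta. *)
pose wh := iota_map (wsub n Y I2); pose oh := iota_map (wsub n Y (- I2)).
have iota_u : iota_map (uvar K) = h4 * (w_ + om_).
  exact: iota_var.
have hi := iota_fhom.
have iota_I : iota_map I2 = I4 by apply: (fhomC hi).
have iota_h : iota_map h2 = h4 by apply: (fhomC hi).
have thetaE : theta_series = - (h4 * I4) * (w_ - om_)
    - iota_map (uvar K) * iota_map (eps K n) * iota_map s.
  by rewrite /theta_series /graph_fun exprS -/(eps K n) !(fhomM hi).
have [wE oE] := hat_ring (iota_map (eps K n)) (iota_map s) (imag_sqr K (2 + 2))
  (half_half K (2 + 2)) iota_u.
rewrite -thetaE in wE oE.
have whE : wh = iota_map (uvar K) * (1 + I4 * iota_map (eps K n) * iota_map s).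
  exact: (fhom_affine _ _ _ hi iota_I).
have ohE : oh = iota_map (uvar K) * (1 + - I4 * iota_map (eps K n) * iota_map s).
  by apply: (fhom_affine _ _ _ hi); rewrite (fhomN hi) iota_I.
rewrite -whE in wE; rewrite -ohE in oE.
have wh1 : ord_ge 1 wh by apply/(fhom_ord hi)/wsub_ord.
have oh1 : ord_ge 1 oh by apply/(fhom_ord hi)/wsub_ord.
have w1 : ord_ge 1 w_ by apply: ord_ge_var.
have o1 : ord_ge 1 om_ by apply: ord_ge_var.
have hatw g : iota_map (fsubst (wsub n Y I2) g) = fsubst wh g.
  exact: (fhom_fsubst g hi (@wsub_ord K n Y _)).
have hato g : iota_map (fsubst (wsub n Y (- I2)) g) = fsubst oh g.
  exact: (fhom_fsubst g hi (@wsub_ord K n Y _)).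
have [q1 q1E] := fsubst_sub euler_w w1 wh1.
have [q2 q2E] := fsubst_sub euler_w o1 oh1.
have [q3 q3E] := fsubst_sub euler_z w1 wh1.
have [q4 q4E] := fsubst_sub euler_z o1 oh1.
rewrite wE in q1E q3E; rewrite oE in q2E q4E.
have subE (x y v q : fps K (2 + 2)) : x - y = v * q -> x = y + v * q.
  by move=> /eqP; rewrite subr_eq addrC => /eqP.
have subEN (x y a v q : fps K (2 + 2)) :
    x - y = - a * v * q -> x = y - a * v * q.
  by move=> /subE ->; rewrite !mulNr.
have tang := tangency n_gt0 YE eulerE.
have bwE (v : fps K 2) (v1 : ord_ge 1 v) : bw n euler v = fsubst v euler_w.
  exact: (esym (fhom_euler_w _ (fsubst_fhom v1) (fsubst_var v1))).
have ezE (v : fps K 2) (v1 : ord_ge 1 v) :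
    (1 - v ^+ n) * fsubst v euler - 1 = fsubst v euler_z.
  exact: (esym (fhom_euler_z _ (fsubst_fhom v1) (fsubst_var v1))).
have {}tang := tangent_congr (bwE _ (wsub_ord _ _ I2)) (bwE _ (wsub_ord _ _ (- I2)))
  (ezE _ (wsub_ord _ _ I2)) (ezE _ (wsub_ord _ _ (- I2))) tang.
have iota_r : iota_map (rho K) = z_ * zeta_ by exact: iota_var.
have {}tang := fhom_tangent hi iota_h iota_I (hatw _) (hato _) (hatw _) (hato _)
  iota_r tang.
have [l lE] := tangent_ring (subE _ _ _ _ q1E) (subEN _ _ _ _ _ q2E)
  (subE _ _ _ _ q3E) (subEN _ _ _ _ _ q4E) tang.
exists l; rewrite fmul_mulE -lE real_part_applyE.
have := vf_iota V graph_fun; rewrite (D_um_s YE) (tauE' n Y) vfM Vz Vzeta.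
rewrite {1}/fhalf vfZ vfD Vw Vom => iotaE.
by rewrite /theta_series vfB opp_half_imag vfZ vfB Vw Vom iotaE.
Qed.

Lemma graph_fun_ord : ord_ge m graph_fun.
Proof.
by apply: ord_geMl; rewrite -[X in ord_ge X]mul1n; apply/ord_geX/ord_ge_var.
Qed.

Lemma theta_series0 : theta_series mnm0 = 0.
Proof.
apply: (iffLR (ord_ge1P _)); apply: ord_geB.
  by apply: ord_geMr; apply: ord_geB; apply: ord_ge_var.
by apply: (fhom_ord iota_fhom); apply: (@ord_geW _ _ m) => //; exact: graph_fun_ord.
Qed.

Lemma theta_series_linear (j : 'I_(2 + 2)) : theta_series (mnm1 j) =
  - (2^-1 * 'i) * ((mnm1 j == mnm1 (lshift 2 (lift ord0 ord0)) :> multinom (2 + 2))%:R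
                   - (mnm1 j == mnm1 (rshift 2 (lift ord0 ord0)) :> multinom (2 + 2))%:R).
Proof.
rewrite /theta_series opp_half_imag fsubE fconstM [X in _ - X](fhom_ord iota_fhom (d := 2)).
- by rewrite subr0.
- by apply: (@ord_geW _ _ m) => //; exact: graph_fun_ord.
- by rewrite mdeg1.
Qed.

Lemma theta_series_w : theta_series (mnm1 (lshift 2 (lift ord0 ord0))) <> 0.
Proof.
rewrite theta_series_linear eqxx (_ : _ == _ = false).
  apply/eqP; rewrite subr0 mulr1 oppr_eq0; apply: mulf_neq0; last exact: neq0Ci.
  by rewrite invr_eq0 pnatr_eq0.
apply/eqP => /(congr1 (fun a : multinom (2 + 2) => a (lshift 2 (lift ord0 ord0)))).
by rewrite !mnm1E eqxx.
Qed.

End Euler.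

(** * Convergence and evaluation *)

Section ComplexLimits.
Variable R : realType.
Local Notation C := (Cplx R).
Local Notation "x %:K" := (of_real x) (at level 2, format "x %:K").

Lemma ler_of_real (x y : R) : (x%:K <= y%:K) = (x <= y).
Proof. exact: lecR. Qed.

Lemma ltr_of_real (x y : R) : (x%:K < y%:K) = (x < y).
Proof. exact: ltcR. Qed.

Lemma of_realD (x y : R) : (x + y)%:K = x%:K + y%:K.
Proof. exact: (rmorphD (real_complex R)). Qed.

Lemma of_realB (x y : R) : (x - y)%:K = x%:K - y%:K.
Proof. exact: (rmorphB (real_complex R)). Qed.

Lemma of_realM (x y : R) : (x * y)%:K = x%:K * y%:K.
Proof. exact: (rmorphM (real_complex R)). Qed.

Lemma of_realX (x : R) k : (x ^+ k)%:K = x%:K ^+ k.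
Proof. exact: (rmorphXn (real_complex R)). Qed.

Lemma of_real_nat j : (j%:R : R)%:K = j%:R.
Proof. exact: (rmorph_nat (real_complex R)). Qed.

Lemma of_real_sum (I : Type) (s : seq I) (P : pred I) (F : I -> R) :
  (\sum_(i <- s | P i) F i)%:K = \sum_(i <- s | P i) (F i)%:K.
Proof. exact: (raddf_sum (real_complex R)). Qed.

Lemma of_real_ge0 (x : R) : (0 <= x%:K) = (0 <= x).
Proof. exact: (ler_of_real 0). Qed.

Lemma norm_normc (z : C) : `|z| = (ComplexField.Normc.normc z)%:K.
Proof. by []. Qed.

Lemma ge0_of_real (z : C) : 0 <= z -> z = (complex.Re z)%:K.
Proof. by move=> z0; rewrite /of_real RRe_real // ger0_real. Qed.

Lemma norm_Re_le (z : C) (e : R) : `|z| <= e%:K -> `|complex.Re z| <= e.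
Proof.
by move=> ze; rewrite -ler_of_real; apply: le_trans ze; apply: normc_ge_Re.
Qed.

Lemma norm_Im_le (z : C) (e : R) : `|z| <= e%:K -> `|complex.Im z| <= e.
Proof.
move=> ze; have : `|z * 'i%C| <= e%:K.
  by rewrite normrM complexiE normCi mulr1.
by move=> /norm_Re_le; rewrite ReiNIm normrN.
Qed.

Lemma norm_complex_le (a b e e' : R) : `|a| <= e -> `|b| <= e' ->
  `|(a +i* b)%C : C| <= (e + e')%:K.
Proof.
move=> ae be; rewrite [X in `|X|]complexE /= of_realD.
apply: le_trans (ler_normD _ _) _; apply: lerD.
  by rewrite normc_def /= expr0n addr0 sqrtr_sqr ler_of_real.
rewrite normrM complexiE normCi mul1r.
by rewrite normc_def /= expr0n addr0 sqrtr_sqr ler_of_real.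
Qed.

Section Monotone.
Variables (N : nat -> R) (M : R).
Hypothesis N_mono : forall d d', (d <= d')%N -> N d <= N d'.
Hypothesis N_bound : forall d, N d <= M.
Local Notation S := (sup (range N)).

Lemma range_has_sup : has_sup (range N).
Proof. by split; [exists (N 0%N), 0%N|exists M => _ [d _ <-]]. Qed.

Lemma le_sup_range d : N d <= S.
Proof. by apply: ub_le_sup; [exists M => _ [e _ <-]|exists d]. Qed.

Lemma tail_small (e : R) : 0 < e -> exists d0, forall d, (d0 <= d)%N -> S - N d <= e.
Proof.
move=> e0; have [_ [d0 _ <-] lt] := sup_adherent e0 range_has_sup.
exists d0 => d /N_mono le; rewrite lerBlDr -lerBlDl; apply/ltW.
exact: lt_le_trans le.
Qed.

(** The sequence [N + y] is nondecreasing and bounded; the limit of [y] is the supremum of [N + y]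
    minus that of [N], which gives an explicit rate. *)
Lemma real_cauchy_bound (y : nat -> R) :
  (forall d d', (d <= d')%N -> `|y d' - y d| <= N d' - N d) ->
  exists l, forall d, `|l - y d| <= S - N d.
Proof.
move=> yN; pose E := range (fun d => N d + y d).
have ub d d' : N d' + y d' <= 2 * S + y d - N d.
  have SN := le_sup_range d'; have SN' := le_sup_range d.
  case: (leqP d d') => [/yN|/ltnW /yN]; rewrite ler_norml => /andP[h1 h2]; lra.
have Eub d : ubound E (2 * S + y d - N d) by move=> _ [d' _ <-]; apply: ub.
exists (sup E - S) => d; rewrite ler_norml; apply/andP; split.
  have : N d + y d <= sup E by apply: ub_le_sup; [exists (2 * S + y d - N d)|exists d].
  lra.
have : sup E <= 2 * S + y d - N d.
  by apply: ge_sup => //; exists (N 0%N + y 0%N), 0%N.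
lra.
Qed.

Lemma complex_cauchy_bound (x : nat -> C) :
  (forall d d', (d <= d')%N -> `|x d' - x d| <= (N d' - N d)%:K) ->
  exists l, forall d, `|l - x d| <= (2 * (S - N d))%:K.
Proof.
move=> xN.
have [l1 h1] : exists l, forall d, `|l - complex.Re (x d)| <= S - N d.
  by apply: real_cauchy_bound => d d' /xN /norm_Re_le; rewrite raddfB.
have [l2 h2] : exists l, forall d, `|l - complex.Im (x d)| <= S - N d.
  by apply: real_cauchy_bound => d d' /xN /norm_Im_le; rewrite raddfB.
exists (l1 +i* l2)%C => d; rewrite mulr_natl mulr2n.
have := norm_complex_le (h1 d) (h2 d).
by case: (x d) => a b.
Qed.

End Monotone.

Lemma limn_eq (u : nat -> C) (l : C) (E : nat -> R) :
  (forall d, `|l - u d| <= (E d)%:K) ->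
  (forall e, 0 < e -> exists d0, forall d, (d0 <= d)%N -> E d <= e) ->
  limn u = l.
Proof.
move=> uE E0; apply: cvg_lim; first exact: norm_hausdorff.
apply/cvgrPdist_le => e e0.
have [d0 h] : exists d0, forall d, (d0 <= d)%N -> E d <= complex.Re e.
  by apply: E0; rewrite -ltr_of_real -ge0_of_real // ltW.
exists d0 => // d /= led; apply: le_trans (uE d) _.
by rewrite (ge0_of_real (ltW e0)) ler_of_real h.
Qed.

Lemma le_of_eps (x y : R) : (forall e, 0 < e -> x <= y + e) -> x <= y.
Proof. by move=> h; apply/ler_addgt0Pr. Qed.

End ComplexLimits.
Section NormEval.
Variables (K : numFieldType).

Lemma fnorm_split k (r : K) d d' (f : fps K k) : (d <= d')%N ->
  fnorm r d' f = fnorm r d f + fnorm r d' (f - fps_of_mpoly (ftrunc d f)).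
Proof.
move=> led; pose F (a : multinom k) := `|f a| * r ^+ mdeg a.
rewrite /fnorm (bigID (fun b : bmultinom k d'.+1 => (mdeg b < d.+1)%N)) /=.
congr (_ + _).
  have sub (x : multinom k) : (mdeg x < d.+1)%N -> (mdeg x < d'.+1)%N.
    by move/leq_trans; apply.
  exact: (esym (ssrcomplements.big_sub_widen (op := +%R) (bmultinom k d.+1)
    (bmultinom k d'.+1) predT F sub)).
rewrite [RHS](bigID (fun b : bmultinom k d'.+1 => (mdeg b < d.+1)%N)) /=.
rewrite [X in X + _]big1 ?add0r => [|b ltb].
  apply: eq_bigr => b ltb; rewrite fsubE /fps_of_mpoly mcoeff_ftrunc.
  by rewrite -ltnS (negbTE ltb) subr0.
by rewrite fsubE /fps_of_mpoly mcoeff_ftrunc -ltnS ltb subrr normr0 mul0r.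
Qed.

Lemma fnorm_mono k (r : K) d d' (f : fps K k) : 0 <= r -> (d <= d')%N ->
  fnorm r d f <= fnorm r d' f.
Proof. by move=> r0 led; rewrite (fnorm_split r f led) lerDl fnorm_ge0. Qed.

Lemma coef_le_fnorm k (r : K) d (f : fps K k) (a : multinom k) : 0 <= r ->
  (mdeg a <= d)%N -> `|f a| * r ^+ mdeg a <= fnorm r d f.
Proof.
move=> r0; rewrite -ltnS => lta; rewrite /fnorm (bigD1 (BMultinom lta)) //= lerDl.
by apply: sumr_ge0 => b _; rewrite mulr_ge0 ?exprn_ge0.
Qed.

Lemma fnorm_sum k (I : Type) (s : seq I) (P : pred I) (r : K) d (F : I -> fps K k) :
  0 <= r -> fnorm r d (\sum_(i <- s | P i) F i) <= \sum_(i <- s | P i) fnorm r d (F i).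
Proof.
move=> r0; elim/big_rec2: _ => [|i x f _ le].
  by rewrite -(raddf0 (@fconst K k)) fnormC normr0.
by apply: le_trans (fnormD _ _ _ r0) _; rewrite lerD2l.
Qed.

Lemma psubst_ftrunc k n (G : 'I_k -> fps K n) d f :
  psubst G (ftrunc d f) =
  \sum_(b : bmultinom k d.+1) fconst (f b) * \prod_(i < k) G i ^+ b i.
Proof.
rewrite /ftrunc raddf_sum; apply: eq_bigr => b _ /=.
by rewrite /psubst mmapZ mmapX.
Qed.

(** Submultiplicativity bounds a composite by the majorant of [f] evaluated at the norms of the
    inner series. Constant terms of [G] are allowed, as re-expansion requires. *)
Lemma fnorm_psubst k n (r rho : K) d D (G : 'I_k -> fps K n) f : 0 <= r ->
  (forall i, fnorm r D (G i) <= rho) ->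
  fnorm r D (psubst G (ftrunc d f)) <= fnorm rho d f.
Proof.
move=> r0 Grho; rewrite psubst_ftrunc.
apply: le_trans (fnorm_sum _ _ _ _ r0) _; apply: ler_sum => b _.
apply: le_trans (fnormM _ _ _ r0) _; rewrite fnormC ler_wpM2l // mdegE.
elim/big_rec2: _ => [|i l g _ le].
  by rewrite expr0 -(rmorph1 (@fconst K n)) fnormC normr1.
rewrite exprD; apply: le_trans (fnormM _ _ _ r0) _.
apply: ler_pM; rewrite ?fnorm_ge0 //.
apply: le_trans (fnormX _ _ _ r0) _.
by apply: lerXn2r => //; rewrite nnegrE ?fnorm_ge0 // (le_trans _ (Grho i)) ?fnorm_ge0.
Qed.

Lemma meval_ftrunc k (x : 'I_k -> K) d f :
  meval x (ftrunc d f) = \sum_(b : bmultinom k d.+1) f b * \prod_(i < k) x i ^+ b i.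
Proof.
rewrite /ftrunc raddf_sum; apply: eq_bigr => b _ /=.
by rewrite mevalZ mevalX.
Qed.

Lemma norm_meval_ftrunc k (x : 'I_k -> K) (rho : K) d f :
  (forall i, `|x i| <= rho) -> `|meval x (ftrunc d f)| <= fnorm rho d f.
Proof.
move=> xrho; rewrite meval_ftrunc; apply: le_trans (ler_norm_sum _ _ _) _.
apply: ler_sum => b _; rewrite normrM ler_wpM2l // mdegE normr_prod.
rewrite -prodrXr; apply: ler_prod => i _; rewrite normrX exprn_ge0 //=.
by apply: lerXn2r; rewrite ?nnegrE // (le_trans _ (xrho i)).
Qed.

Lemma ftrunc_sub k d d' (f : fps K k) : (d <= d')%N ->
  ftrunc d' f - ftrunc d f = ftrunc d' (f - fps_of_mpoly (ftrunc d f)).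
Proof.
move=> led; apply/mpolyP => a.
rewrite mcoeffB !mcoeff_ftrunc fsubE /fps_of_mpoly mcoeff_ftrunc.
case: (leqP (mdeg a) d') => // lt; rewrite ifF ?subrr //.
by apply/negbTE; rewrite -ltnNge (leq_ltn_trans led).
Qed.

End NormEval.

Lemma ftrunc_of_mpoly (K : comNzRingType) n d (q : mpoly n K) : (msize q <= d)%N ->
  ftrunc d (fps_of_mpoly q) = q.
Proof.
move=> led; apply/mpolyP => a; rewrite mcoeff_ftrunc /fps_of_mpoly.
case: leqP => // lt; apply/esym/memN_msupp_eq0/msize_mdeg_ge.
by apply: leq_trans led (ltnW lt).
Qed.

Lemma meval_comp_mpoly (K : comNzRingType) k n (y : 'I_n -> K)
    (G : 'I_k -> mpoly n K) (p : mpoly k K) :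
  meval y (comp_mpoly [tuple G i | i < k] p) = meval (fun i => meval y (G i)) p.
Proof.
by rewrite comp_mpoly_meval; apply: meval_eq => i; rewrite tnth_mktuple.
Qed.

(** * Evaluation, composition and re-expansion of convergent series *)

Section Recenter.
Variable R : realType.
Local Notation C := (Cplx R).
Local Notation "x %:K" := (of_real x) (at level 2, format "x %:K").

Definition rnorm k (r : R) d (f : fps C k) : R := complex.Re (fnorm r%:K d f).

Lemma rnormE k (r : R) d (f : fps C k) : 0 <= r -> fnorm r%:K d f = (rnorm r d f)%:K.
Proof. by move=> r0; apply/ge0_of_real/fnorm_ge0; rewrite of_real_ge0. Qed.

Definition bounded k (r M : R) (f : fps C k) := forall d, fnorm r%:K d f <= M%:K.

Section Bounded.
Variables (k : nat) (r M : R) (f : fps C k).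
Hypotheses (r0 : 0 <= r) (fM : bounded r M f).
Local Notation N := (fun d => rnorm r d f).

Lemma rnorm_mono d d' : (d <= d')%N -> N d <= N d'.
Proof.
by move=> led; rewrite -ler_of_real -!rnormE // fnorm_mono // of_real_ge0.
Qed.

Lemma rnorm_bound d : N d <= M.
Proof. by rewrite -ler_of_real -rnormE. Qed.

Lemma rnorm_tail d d' : (d <= d')%N ->
  fnorm r%:K d' (f - fps_of_mpoly (ftrunc d f)) = (N d' - N d)%:K.
Proof.
by move=> led; rewrite of_realB -!rnormE // (fnorm_split _ f led) addrAC subrr add0r.
Qed.

Lemma feval_bound (x : 'I_k -> C) : (forall i, `|x i| <= r%:K) ->
  forall d, `|feval f x - meval x (ftrunc d f)| <= (2 * (sup (range N) - N d))%:K.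
Proof.
move=> xr; have [l lE] : exists l : C, forall d,
    `|l - meval x (ftrunc d f)| <= (2 * (sup (range N) - N d))%:K.
  apply: (complex_cauchy_bound rnorm_bound (x := fun d => meval x (ftrunc d f))) => d d' led.
  rewrite -raddfB ftrunc_sub // -rnorm_tail //.
  exact: norm_meval_ftrunc.
suff -> : feval f x = l by [].
apply: (limn_eq lE) => e e0.
have [d0 h] := tail_small rnorm_mono rnorm_bound (divr_gt0 e0 (ltr0n R 2)).
by exists d0 => d /h; rewrite ler_pdivlMr // mulrC.
Qed.

End Bounded.

Section Composition.
Variables (k n : nat) (f : fps C k) (rho M r : R) (G : 'I_k -> mpoly n C).
Hypotheses (rho0 : 0 <= rho) (r0 : 0 < r) (fM : bounded rho M f).
Hypothesis Grho : forall i, bounded r rho (fps_of_mpoly (G i)).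
Local Notation N := (fun d => rnorm rho d f).
Local Notation S := (sup (range N)).
Let H d : fps C n := psubst (fun i => fps_of_mpoly (G i)) (ftrunc d f).
Let r0' : 0 <= r%:K. Proof. by rewrite of_real_ge0 ltW. Qed.
Let Nm := rnorm_mono f rho0.
Let Nb := rnorm_bound rho0 fM.

Let H_cauchy D d d' : (d <= d')%N -> fnorm r%:K D (H d' - H d) <= (N d' - N d)%:K.
Proof.
move=> led; rewrite /H -raddfB ftrunc_sub // -rnorm_tail //.
by apply: fnorm_psubst => // i; apply: Grho.
Qed.

Let H_lim : exists h : fps C n, forall a (e : R), 0 < e ->
  exists d0, forall d, (d0 <= d)%N -> `|h a - H d a| <= e%:K.
Proof.
suff hl a : exists l : C, forall e : R, 0 < e ->
    exists d0, forall d, (d0 <= d)%N -> `|l - H d a| <= e%:K.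
  by exists (fun a => projT1 (cid (hl a))) => a; apply: (projT2 (cid (hl a))).
pose c := r ^+ mdeg a; have c0 : 0 < c by apply: exprn_gt0.
pose N' d := N d / c.
have N'm d d' : (d <= d')%N -> N' d <= N' d'.
  by move=> /Nm le; rewrite ler_pM2r // invr_gt0.
have N'b d : N' d <= M / c by rewrite ler_pM2r ?invr_gt0.
have xN d d' : (d <= d')%N -> `|H d' a - H d a| <= (N' d' - N' d)%:K.
  move=> led; rewrite /N' -mulrBl -fsubE.
  have := le_trans (coef_le_fnorm (H d' - H d) r0' (leqnn _)) (H_cauchy (mdeg a) led).
  rewrite -of_realX norm_normc -of_realM !ler_of_real.
  by rewrite ler_pdivlMr.
have [l lE] := complex_cauchy_bound N'b xN.
exists l => e e0.
have [d0 h] := tail_small N'm N'b (divr_gt0 e0 (ltr0n R 2)).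
exists d0 => d /h le; apply: le_trans (lE d) _.
by rewrite ler_of_real -ler_pdivlMl // mulrC.
Qed.

(* The composites of G with the truncations of f form a Cauchy sequence for the
   majorant norm of radius r; no condition on the constant terms of G is needed,
   so this also re-expands f at another point. *)
Theorem recenter : exists h : fps C n,
  [/\ bounded r S h,
      (forall y : 'I_n -> C, (forall i, `|y i| <= r%:K) ->
         feval h y = feval f (fun i => meval y (G i))),
      ((forall i, ord_ge 1 (fps_of_mpoly (G i))) ->
        h = fcomp f (fun i => fps_of_mpoly (G i))) &
      forall a b, (forall q, psubst (fun i => fps_of_mpoly (G i)) q a =
                             psubst (fun i => fps_of_mpoly (G i)) q b) -> h a = h b].
Proof.
have [h hE] := H_lim; exists h.
have hH D d : fnorm r%:K D (h - H d) <= (S - N d)%:K.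
  have E0 : 0 <= fnorm r%:K D (h - H d) by apply: fnorm_ge0.
  rewrite (ge0_of_real E0) ler_of_real; apply: le_of_eps => e e0.
  pose c := \sum_(b : bmultinom n D.+1) r ^+ mdeg b.
  have c0 : 0 <= c by apply: sumr_ge0 => b _; apply/exprn_ge0/ltW.
  have e1 : 0 < e / (c + 1) by apply: divr_gt0 => //; apply: ltr_wpDl.
  (* Only finitely many coefficients have degree at most [D], so coefficientwise convergence is
     uniform on them. *)
  have [d0 h0] : exists d0, forall (b : bmultinom n D.+1) d, (d0 <= d)%N ->
      `|h b - H d b| <= (e / (c + 1))%:K.
    have hb (b : bmultinom n D.+1) := hE b _ e1.
    exists (\max_(b : bmultinom n D.+1) projT1 (cid (hb b))) => b d' led'.
    apply: (projT2 (cid (hb b))); apply: leq_trans led'.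
    exact: (leq_bigmax (F := fun b => projT1 (cid (hb b)))).
  pose d' := maxn d0 d.
  have le1 : fnorm r%:K D (h - H d') <= e%:K.
    apply: (@le_trans _ _ ((e / (c + 1))%:K * c%:K)).
      have -> : c%:K = \sum_(b : bmultinom n D.+1) (r%:K : C) ^+ mdeg b.
        by rewrite of_real_sum; apply: eq_bigr => b _; apply: of_realX.
      rewrite mulr_sumr; apply: ler_sum => b _; rewrite fsubE.
      by apply: ler_wpM2r; [apply: exprn_ge0|apply: h0; apply: leq_maxl].
    rewrite -of_realM ler_of_real mulrAC ler_pdivrMr; last by apply: ltr_wpDl.
    by rewrite ler_wpM2l ?(ltW e0) // lerDl.
  have := le_trans (fnormD D (h - H d') (H d' - H d) r0')
    (lerD le1 (H_cauchy D (leq_maxr d0 d))).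
  rewrite addrA subrK -of_realD (ge0_of_real E0) ler_of_real => /le_trans; apply.
  by rewrite [X in _ <= X]addrC lerD2l lerD2r; apply: (le_sup_range Nb).
have hS : bounded r S h.
  move=> D; have := fnormD D (h - H 0%N) (H 0%N) r0'.
  rewrite subrK => /le_trans; apply.
  have -> : S%:K = (S - N 0%N)%:K + (N 0%N)%:K by rewrite -of_realD subrK.
  apply: lerD; first exact: hH.
  rewrite -rnormE //; apply: fnorm_psubst => // i; exact: Grho.
split=> [//|y yr|G1|a b ab]; last first.
  apply/eqP; rewrite -subr_eq0 -normr_le0; have n0 := normr_ge0 (h a - h b).
  rewrite (ge0_of_real n0) (ler_of_real _ 0); apply: le_of_eps => e e0.
  rewrite add0r -ler_of_real -ge0_of_real //.
  have e2 : 0 < e / 2 by apply: divr_gt0.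
  have [da ha] := hE a _ e2; have [db hb] := hE b _ e2.
  have hab := ab (ftrunc (maxn da db) f).
  rewrite -[h a](subrK (H (maxn da db) a)) {2}/H hab -addrA.
  apply: le_trans (ler_normD _ _) _; rewrite [X in _ + X <= _]distrC.
  apply: le_trans (lerD (ha _ (leq_maxl _ _)) (hb _ (leq_maxr _ _))) _.
  by rewrite -of_realD ler_of_real -splitr.
- apply/funext => a; apply/eqP; rewrite -subr_eq0 -normr_le0.
  have n0 := normr_ge0 (h a - fcomp f (fun i => fps_of_mpoly (G i)) a).
  rewrite (ge0_of_real n0) (ler_of_real _ 0); apply: le_of_eps => e e0.
  rewrite add0r -ler_of_real -ge0_of_real //.
  have [d0 hd] := hE a e e0.
  rewrite (@fcompE _ _ _ (maxn d0 (mdeg a))) ?leq_maxr //.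
  by apply: hd; apply: leq_maxl.
pose x i := meval y (G i).
have xr i : `|x i| <= rho%:K.
  have := norm_meval_ftrunc (msize (G i)) (fps_of_mpoly (G i)) yr.
  have -> : ftrunc (msize (G i)) (fps_of_mpoly (G i)) = G i.
    exact: ftrunc_of_mpoly.
  by move=> /le_trans; apply; apply: Grho.
have S0 D : 0 <= S - N D by rewrite subr_ge0; apply: (le_sup_range Nb).
(* For a truncation of [f] the composite is a polynomial, on which evaluation and composition
   commute exactly; what remains are a tail of [h] and a tail of [f]. *)
have close D e : 0 < e ->
    `|feval h y - meval x (ftrunc D f)| <= (e + (S - N D))%:K.
  move=> e0; pose q := comp_mpoly [tuple G i | i < k] (ftrunc D f).
  have qE : fps_of_mpoly q = H D.
    apply: etrans (fps_of_comp_mpoly [tuple G i | i < k] (ftrunc D f)) _.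
    have -> : (fun i => fps_of_mpoly (tnth [tuple G i | i < k] i)) =
        (fun i => fps_of_mpoly (G i)) by apply/funext => i; rewrite tnth_mktuple.
    by [].
  have [d0 h0] := tail_small (rnorm_mono h (ltW r0)) (rnorm_bound (ltW r0) hS)
    (divr_gt0 e0 (ltr0n R 2)).
  pose D' := maxn d0 (msize q).
  rewrite -meval_comp_mpoly -/q -[q](@ftrunc_of_mpoly _ _ D') ?leq_maxr // qE.
  rewrite -[X in `|X|](subrKA (meval y (ftrunc D' h))) of_realD.
  apply: le_trans (ler_normD _ _) _; apply: lerD.
    apply: le_trans (feval_bound (ltW r0) hS yr D') _.
    rewrite ler_of_real -ler_pdivlMl // mulrC; apply: h0; exact: leq_maxl.
  rewrite -raddfB (_ : _ - _ = ftrunc D' (h - H D)).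
    exact: le_trans (norm_meval_ftrunc D' (h - H D) yr) (hH _ _).
  apply/mpolyP => a; rewrite mcoeffB !mcoeff_ftrunc.
  by case: ifP => _; rewrite ?subrr.
apply/eqP; rewrite -subr_eq0 -normr_le0.
have n0 := normr_ge0 (feval h y - feval f x).
rewrite (ge0_of_real n0) (ler_of_real _ 0); apply: le_of_eps => e e0.
rewrite add0r -ler_of_real -ge0_of_real //.
have e4 : 0 < e / 4 by apply: divr_gt0.
have [D hD] := tail_small Nm Nb e4.
rewrite -(subrKA (meval x (ftrunc D f))); apply: le_trans (ler_normD _ _) _.
rewrite [X in _ + X <= _]distrC.
apply: le_trans (lerD (close D _ e4) (feval_bound rho0 fM xr D)) _.
by rewrite -of_realD ler_of_real; have := hD D (leqnn D); lra.
Qed.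

End Composition.
End Recenter.

Lemma subr_subr (V : zmodType) (a b c d : V) : (a - b) - (c - d) = (a - c) - (b - d).
Proof. by rewrite !opprD !opprK addrACA. Qed.

Section Evaluation.
Variable R : realType.
Local Notation C := (Cplx R).
Local Notation "x %:K" := (of_real x) (at level 2, format "x %:K").

(** [feval] is a limit operator and has a value even without convergence; this predicate records the
    convergence that the algebraic rules for values need. *)
Definition has_feval k (f : fps C k) (x : 'I_k -> C) (l : C) :=
  forall e : R, 0 < e ->
  exists d0, forall d, (d0 <= d)%N -> `|l - meval x (ftrunc d f)| <= e%:K.

Lemma has_fevalE k (f : fps C k) x l : has_feval f x l -> feval f x = l.
Proof.
move=> fl; apply: (@limn_eq _ _ _
  (fun d => ComplexField.Normc.normc (l - meval x (ftrunc d f)))) => [d|e e0].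
  by rewrite norm_normc.
by have [d0 h] := fl e e0; exists d0 => d /h; rewrite norm_normc ler_of_real.
Qed.

Lemma bounded_has_feval k (f : fps C k) r M x : 0 <= r -> bounded r M f ->
  (forall i, `|x i| <= r%:K) -> has_feval f x (feval f x).
Proof.
move=> r0 fM xr e e0.
have [d0 h] := tail_small (rnorm_mono f r0) (rnorm_bound r0 fM)
  (divr_gt0 e0 (ltr0n R 2)).
exists d0 => d /h le; apply: le_trans (feval_bound r0 fM xr d) _.
by rewrite ler_of_real -ler_pdivlMl // mulrC.
Qed.

Lemma has_fevalB k (f g : fps C k) x l l' :
  has_feval f x l -> has_feval g x l' -> has_feval (f - g) x (l - l').
Proof.
move=> fl gl e e0; have e2 : 0 < e / 2 by apply: divr_gt0.
have [d1 h1] := fl _ e2; have [d2 h2] := gl _ e2; exists (maxn d1 d2) => d.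
rewrite geq_max => /andP[/h1 le1 /h2 le2].
have -> : ftrunc d (f - g) = ftrunc d f - ftrunc d g.
  apply/mpolyP => a; rewrite mcoeffB !mcoeff_ftrunc.
  by case: ifP => _; rewrite ?subrr.
rewrite raddfB /= (_ : _ - _ = (l - meval x (ftrunc d f)) -
  (l' - meval x (ftrunc d g))); last exact: subr_subr.
apply: le_trans (ler_normB _ _) _; apply: le_trans (lerD le1 le2) _.
by rewrite -of_realD ler_of_real -splitr.
Qed.

Lemma has_feval_poly k (q : mpoly k C) x : has_feval (fps_of_mpoly q) x (meval x q).
Proof.
move=> e e0; exists (msize q) => d led; rewrite ftrunc_of_mpoly // subrr normr0.
by rewrite of_real_ge0 ltW.
Qed.

Lemma ftrunc_varM k d i (f : fps C k) :
  ftrunc d.+1 (fvar C i * f) = mpolyX C (mnm1 i) * ftrunc d f.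
Proof.
apply/mpolyP => a; rewrite mcoeff_ftrunc.
rewrite -[RHS]/(fps_of_mpoly (mpolyX C (mnm1 i) * ftrunc d f) a).
rewrite (rmorphM (@fps_of_mpoly C k)) /= fps_of_mpolyX.
have [ai|/multinomSP[b ->]] := eqVneq (a i) 0%N.
  by rewrite !fvar_mul0 // if_same.
by rewrite !fvar_mulE /fps_of_mpoly mcoeff_ftrunc mdegD mdeg1 addn1 ltnS.
Qed.

Lemma has_feval_varM k i (f : fps C k) x l :
  has_feval f x l -> has_feval (fvar C i * f) x (x i * l).
Proof.
move=> fl e e0; pose c := ComplexField.Normc.normc (x i).
have c0 : 0 <= c by rewrite -of_real_ge0 -norm_normc.
have c1 : 0 < c + 1 by apply: ltr_wpDl.
have [d0 h] := fl _ (divr_gt0 e0 c1); exists d0.+1 => -[//|d].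
rewrite ltnS => /h le; rewrite ftrunc_varM rmorphM /= mevalXU -mulrBr normrM.
rewrite norm_normc -/c; apply: (@le_trans _ _ (c%:K * (e / (c + 1))%:K)).
  by rewrite ler_wpM2l // of_real_ge0.
rewrite -of_realM ler_of_real mulrCA -[X in _ <= X]mulr1 ler_pM2l //.
by rewrite ler_pdivrMr // mul1r lerDl.
Qed.

Lemma has_feval_varXM k i j (f : fps C k) x l :
  has_feval f x l -> has_feval (fvar C i ^+ j * f) x (x i ^+ j * l).
Proof.
move=> fl; elim: j => [|j IHj]; first by rewrite !expr0 !mul1r.
by rewrite (exprS (fvar C i)) (exprS (x i)) -!mulrA; apply: has_feval_varM.
Qed.

Lemma has_feval_real k (f : fps C k) x l : fconj f = f ->
  (forall i, x i \is Num.real) -> has_feval f x l -> l \is Num.real.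
Proof.
move=> fR xR fl.
have mR d : meval x (ftrunc d f) \is Num.real.
  rewrite meval_ftrunc; apply: rpred_sum => b _; apply: rpredM.
    by apply/CrealP; rewrite -{2}fR.
  by apply: rpred_prod => i _; apply: rpredX; apply: xR.
suff I0 : complex.Im l = 0.
  apply/complex_realP; exists (complex.Re l).
  by apply/eqP; rewrite eq_complex /= I0 !eqxx.
apply/eqP; rewrite -normr_le0; apply: le_of_eps => e e0; rewrite add0r.
have [d0 h] := fl e e0; have := norm_Im_le (h d0 (leqnn _)).
rewrite raddfB /= (_ : complex.Im (meval _ _) = 0) ?subr0 //.
by have /complex_realP[y ->] := mR d0.
Qed.

End Evaluation.

(** * Majorant bounds and absolute summability *)

Section Summability.
Variable R : realType.
Local Notation C := (Cplx R).
Local Notation "x %:K" := (of_real x) (at level 2, format "x %:K").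
Local Notation normc := ComplexField.Normc.normc.

Lemma sum_multinom_le k (F : multinom k -> R) M : (forall a, 0 <= F a) ->
  (forall d, \sum_(a : bmultinom k d.+1) F a <= M) ->
  forall s : seq (multinom k), uniq s -> \sum_(a <- s) F a <= M.
Proof.
move=> F0 FM s us; pose d := \max_(a <- s) mdeg a.
pose s' : seq (bmultinom k d.+1) := pmap insub s.
have sE : s = [seq val b | b <- s'].
  rewrite /s' (pmap_filter (@insubK _ _ _)); apply/esym/all_filterP/allP => a sa.
  by rewrite isSome_insub ltnS; apply: (leq_bigmax_seq (F := @mdeg k)).
rewrite sE big_map; apply: le_trans (FM d).
rewrite big_uniq ?pmap_sub_uniq //= [X in _ <= X](bigID (mem s')) /= lerDl.
exact: sumr_ge0.
Qed.

Lemma bounded_summable k (f : fps C k) r M (x : 'I_k -> C) : 0 <= r -> bounded r M f ->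
  (forall i, `|x i| <= r%:K) -> abs_summable_at f x.
Proof.
move=> r0 fM xr; rewrite /abs_summable_at /summable.
apply: (@le_lt_trans _ _ M%:E); last exact: ltry.
apply: ge_ereal_sup => _ [X [finX _] <-]; rewrite fsbig_finite //= sumEFin lee_fin.
have term a : `|normc (f a * \prod_(i < k) x i ^+ a i)| <= normc (f a) * r ^+ mdeg a.
  rewrite ger0_norm; last by rewrite -of_real_ge0 -norm_normc.
  rewrite -ler_of_real -norm_normc of_realM of_realX -norm_normc normrM.
  rewrite ler_wpM2l // mdegE normr_prod -prodrXr.
  apply: ler_prod => i _; rewrite normrX exprn_ge0 //=.
  by apply: lerXn2r; rewrite ?nnegrE // of_real_ge0.
apply: le_trans (ler_sum _ (fun a _ => term a)) _.
apply: sum_multinom_le => [a|d|]; last exact: finmap.fset_uniq.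
  by rewrite mulr_ge0 ?exprn_ge0 // -of_real_ge0 -norm_normc.
rewrite -ler_of_real; apply: le_trans (fM d).
rewrite of_real_sum; apply: ler_sum => b _.
by rewrite of_realM of_realX norm_normc.
Qed.

Lemma bounded_convergent k (f : fps C k) r M : 0 < r -> bounded r M f -> convergent f.
Proof.
move=> r0 fM; exists r; split=> // x xr.
by apply: (bounded_summable (ltW r0) fM) => i; apply/ltW/xr.
Qed.

Lemma convergent_bounded k (f : fps C k) : convergent f ->
  exists r M : R, 0 < r /\ bounded r M f.
Proof.
(* Summability is given only inside the open polydisc; at the point with all coordinates [c] it
   bounds the majorant norm of radius [c]. *)
move=> [r [r0 fr]]; have [c c0 cr] : exists2 c : R, 0 < c & c < r.
  by exists (r / 2); rewrite ?divr_gt0 // ltr_pdivrMr // ltr_pMr // ltr1n.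
pose F a : \bar R :=
  (normc (f a * \prod_(i < k) ((fun=> c%:K) i : C) ^+ a i))%:E.
have fin : (\esum_(a in [set: multinom k]) `|F a| < +oo)%E.
  apply: (fr (fun=> c%:K)) => i.
  by rewrite ger0_norm ?of_real_ge0 ?(ltW c0) // ltr_of_real.
exists c, (fine (\esum_(a in [set: multinom k]) `|F a|)%E); split=> // d.
have fn : (\esum_(a in [set: multinom k]) `|F a|)%E \is a fin_num.
  by rewrite ge0_fin_numE //; apply: esum_ge0.
rewrite (_ : fnorm _ _ _ = (\sum_(b : bmultinom k d.+1) normc (f b) * c ^+ mdeg b)%:K).
  rewrite ler_of_real -lee_fin fineK //; apply: esum_ge.
  pose s := [seq val b | b <- index_enum (bmultinom k d.+1)].
  have us : uniq s by rewrite map_inj_uniq ?index_enum_uniq //; apply: val_inj.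
  exists [set` s]; first by split=> //; exact: finite_seq.
  rewrite -fsbig_seq // big_map -sumEFin; apply: lee_sum => b _.
  rewrite lee_fin; apply: le_trans (_ : _ <= normc _) (ler_norm _).
  rewrite -ler_of_real of_realM of_realX -!norm_normc normrM ler_wpM2l //.
  by rewrite prodrXr -mdegE normrX ger0_norm // of_real_ge0 ltW.
rewrite of_real_sum; apply: eq_bigr => b _.
by rewrite of_realM of_realX norm_normc.
Qed.

End Summability.

Lemma psubst_ind (K : comNzRingType) k n (P : fps K n -> Prop) (G : 'I_k -> fps K n) :
  (forall c, P (fconst c)) -> (forall i, P (G i)) ->
  (forall f g : fps K n, P f -> P g -> P (f + g)) ->
  (forall f g : fps K n, P f -> P g -> P (f * g)) ->
  forall p, P (psubst G p).
Proof.
move=> PC PG PD PM p; rewrite /psubst /mmap.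
have P0 : P 0 by rewrite -(raddf0 (@fconst K n)); apply: PC.
have P1 : P 1 by rewrite -(rmorph1 (@fconst K n)); apply: PC.
apply: (big_ind P) => // a _; apply: (PM) => //.
rewrite /mmap1; apply: (big_ind P) => // i _.
by elim: (a i) => [|j IHj]; rewrite ?expr0 // exprS; apply: PM.
Qed.

Lemma fmul_mnm0 (K : comNzRingType) k (f g : fps K k) :
  (f * g) mnm0 = f mnm0 * g mnm0.
Proof.
rewrite -fmul_mulE /fmul; have mcoeff0M := rmorphM (@mcoeff k K mnm0).
by rewrite mcoeff0M /= !mcoeff_ftrunc mdeg0.
Qed.

Lemma fmul_mnm1 (K : comNzRingType) k (f g : fps K k) i :
  (f * g) (mnm1 i) = f (mnm1 i) * g mnm0 + f mnm0 * g (mnm1 i).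
Proof.
have D1 (h : fps K k) : fderiv i h mnm0 = h (mnm1 i).
  by rewrite /fderiv add0m mnm0E mulr1n.
by rewrite -D1 fderivM faddE !fmul_mnm0 !D1.
Qed.

Lemma fhom_mnm0 (K : comNzRingType) k l (E : fps K k -> fps K l) f :
  fhom E -> E f mnm0 = f mnm0.
Proof.
move=> hE; have f1 : ord_ge 1 (f - fconst (f mnm0)).
  by apply/ord_ge1P; rewrite fsubE /fconst eqxx mulr1n subrr.
have := fhom_ord hE f1; rewrite (fhomB hE) (fhomC hE) => /ord_ge1P.
by rewrite fsubE /fconst eqxx mulr1n => /eqP; rewrite subr_eq0 => /eqP.
Qed.

Section Bounded.
Variables (R : realType) (k : nat) (r : R).
Hypothesis r0 : 0 <= r.
Local Notation C := (Cplx R).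
Local Notation "x %:K" := (of_real x) (at level 2, format "x %:K").
Implicit Types f g : fps C k.

Let r0' : 0 <= r%:K. Proof. by rewrite of_real_ge0. Qed.

Lemma boundedD f g M N : bounded r M f -> bounded r N g -> bounded r (M + N) (f + g).
Proof.
by move=> fM gN d; apply: le_trans (fnormD _ _ _ r0') _; rewrite of_realD lerD.
Qed.

Lemma boundedB f g M N : bounded r M f -> bounded r N g -> bounded r (M + N) (f - g).
Proof.
move=> fM gN; have gN' : bounded r N (- g) by move=> d; rewrite fnormN; apply: gN.
exact: boundedD fM gN'.
Qed.

Lemma boundedM f g M N : bounded r M f -> bounded r N g -> bounded r (M * N) (f * g).
Proof.
move=> fM gN d; apply: le_trans (fnormM _ _ _ r0') _; rewrite of_realM.
by apply: ler_pM; rewrite ?fnorm_ge0.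
Qed.

Lemma bounded_const c M : `|c| <= M%:K -> bounded r M (@fconst C k c).
Proof. by move=> cM d; rewrite fnormC. Qed.

Lemma bounded_var i : bounded r r (fvar C i : fps C k).
Proof. by move=> d; apply: fnorm_var. Qed.

Lemma boundedW f M N : M <= N -> bounded r M f -> bounded r N f.
Proof. by move=> MN fM d; apply: le_trans (fM d) _; rewrite ler_of_real. Qed.

Lemma bounded_varXM i j f M : bounded r M f -> bounded r (r ^+ j * M) (fvar C i ^+ j * f).
Proof.
move=> fM; apply: boundedM => // d; apply: le_trans (fnormX _ _ _ r0') _.
by rewrite of_realX; apply: lerXn2r; rewrite ?nnegrE ?fnorm_ge0 // fnorm_var.
Qed.

Lemma bounded_poly (q : mpoly k C) : exists M, bounded r M (fps_of_mpoly q).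
Proof.
pattern (fps_of_mpoly q); apply: fps_of_mpoly_ind.
- move=> c; exists (ComplexField.Normc.normc c); apply: bounded_const.
  by rewrite -norm_normc.
- by move=> i; exists r; apply: bounded_var.
- by move=> f g [M fM] [N gN]; exists (M + N); apply: boundedD.
- by move=> f g [M fM] [N gN]; exists (M * N); apply: boundedM.
Qed.

End Bounded.

(** * The hypersurface *)

Section GraphFunction.
Variables (R : realType) (n : nat).
Local Notation C := (Cplx R).
Local Notation m := n.+1.
Local Notation s := (sol C n Us).
Local Notation "x %:K" := (of_real x) (at level 2, format "x %:K").

Lemma sol_bounded : exists r M : R, [/\ 0 < r, r <= 1 & bounded r M s].
Proof.
have [r [M [r0 r1 M0 rM]]] := sol_bound C n.
have rE := ge0_of_real (ltW r0); have ME := ge0_of_real (ltW M0).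
rewrite rE in r0 r1 rM; rewrite ME in rM.
exists (complex.Re r), (complex.Re M); split=> [||d]; last exact: rM.
  by rewrite -ltr_of_real.
by rewrite -ler_of_real.
Qed.

Definition phi_arg (i : 'I_2) : mpoly 3 C :=
  if i == ord0 then mpolyX C (mnm1 (Ordinal (isT : (0 < 3)%N)))
                    * mpolyX C (mnm1 (Ordinal (isT : (1 < 3)%N)))
  else mpolyX C (mnm1 (Ordinal (isT : (2 < 3)%N))).

Definition phi_series : fps C 3 := fcomp s (fun i => fps_of_mpoly (phi_arg i)).

Local Notation x0 := (fvar C (Ordinal (isT : (0 < 3)%N))).
Local Notation x1 := (fvar C (Ordinal (isT : (1 < 3)%N))).

Lemma phi_argE i : fps_of_mpoly (phi_arg i) =
  if i == ord0 then x0 * x1 else fvar C (Ordinal (isT : (2 < 3)%N)).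
Proof. by rewrite /phi_arg; case: ifP => _; rewrite ?rmorphM /= !fps_of_mpolyX. Qed.

Lemma phi_arg_ord i : ord_ge 1 (fps_of_mpoly (phi_arg i)).
Proof. by rewrite phi_argE; case: ifP => _; [apply: ord_geMl|]; apply: ord_ge_var. Qed.

Lemma phi_fhom : fhom (fun f : fps C 2 => fcomp f (fun i => fps_of_mpoly (phi_arg i))).
Proof. exact/fcomp_fhom/phi_arg_ord. Qed.

(** As s vanishes at rho = 0, the series is divisible by z zbar, which excludes pluriharmonic terms.
    The quotient has constant term f(0) = 1, the coefficient showing that the series is nonzero at u
    = 0. *)
Lemma phi_seriesE : exists2 y : fps C 3, y mnm0 = 1 & phi_series = x0 * (x1 * y).
Proof.
have fE : sol C n Uf mnm0 = 1.
  by rewrite solE faddE /fint fvar_mul0 ?mnm0E // addr0 /= foneE eqxx.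
exists (fcomp (fdiv_int ord0 (sol C n Uf)) (fun i => fps_of_mpoly (phi_arg i))).
  by rewrite (fhom_mnm0 _ phi_fhom) /fdiv_int mnm0E fE divr1.
rewrite /phi_series solE /= add0r /fint (fhomM phi_fhom).
by rewrite (fcomp_var ord0 phi_arg_ord) phi_argE mulrA.
Qed.

Lemma phi_no_pluriharmonic j l :
  phi_series (Multinom [tuple j; 0%N; l]) = 0 /\
  phi_series (Multinom [tuple 0%N; j; l]) = 0.
Proof.
have [y _ ->] := phi_seriesE; split; first by rewrite mulrCA fvar_mul0.
by rewrite fvar_mul0.
Qed.

Lemma phi_neq0 : phi_series (Multinom [tuple 1%N; 1%N; 0%N]) <> 0.
Proof.
have [y y0 ->] := phi_seriesE.
have -> : Multinom [tuple 1%N; 1%N; 0%N] =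
  mnm_add (mnm_add mnm0 (mnm1 (Ordinal (isT : (1 < 3)%N))))
          (mnm1 (Ordinal (isT : (0 < 3)%N))).
  apply/mnmP => i; rewrite !mnmDE !mnm1E mnm0E.
  by case: i => [[|[|[|[]]]] ?].
by rewrite !fvar_mulE y0; apply/eqP/oner_neq0.
Qed.

End GraphFunction.

Lemma fvar_mnm1 (K : comNzRingType) k (j l : 'I_k) : fvar K j (mnm1 l) = (j == l)%:R.
Proof.
rewrite /fvar; congr (_%:R); congr nat_of_bool.
apply/eqP/eqP => [/mnmP/(_ j)|->//]; rewrite !mnm1E eqxx.
by case: eqP => [->|].
Qed.

Lemma fconst_mnm1 (K : comNzRingType) k c (l : 'I_k) :
  (fconst c : fps K k) (mnm1 l) = 0.
Proof. by rewrite /fconst -mdeg_eq0 mdeg1 mulr0n. Qed.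

Lemma im_shift (K : comNzRingType) (h i w wb v vb : K) :
  - (h * i) * (w - v - (wb - vb)) + i * (vb - v) * h = i * (wb - w) * h.
Proof. by ring. Qed.

Section Hypersurface.
Variables (R : realType) (n : nat).
Local Notation C := (Cplx R).
Local Notation m := n.+1.
Local Notation s := (sol C n Us).
Local Notation "x %:K" := (of_real x) (at level 2, format "x %:K").
Local Notation iz := (lshift 2 ord0 : 'I_(2 + 2)).
Local Notation iw := (lshift 2 (lift ord0 ord0) : 'I_(2 + 2)).
Local Notation izb := (rshift 2 ord0 : 'I_(2 + 2)).
Local Notation iwb := (rshift 2 (lift ord0 ord0) : 'I_(2 + 2)).
Local Notation X i := (mpolyX C (mnm1 i)).
Local Notation h4 := (@fhalf C (2 + 2)).
Local Notation I4 := (@fimag C (2 + 2)).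
Implicit Types (p Z : 'rV[C]_2) (i : 'I_2).

(** The values |z|^2 and Re w at Z as polynomials in (Z - p, conj (Z - p)). They may have constant
    terms, so the re-expansion at [p] goes through [recenter]. *)
Definition shift_arg p i : mpoly (2 + 2) C :=
  if i == ord0 then (X iz + mpolyC _ (p 0 ord0)) * (X izb + mpolyC _ (p 0 ord0)^*)
  else mpolyC _ 2^-1 * (X iw + X iwb) + mpolyC _ ('Re (p 0 (lift ord0 ord0))).

Definition real_arg Z i : C :=
  if i == ord0 then Z 0 ord0 * (Z 0 ord0)^* else 'Re (Z 0 (lift ord0 ord0)).

Lemma shift_argE p i : fps_of_mpoly (shift_arg p i) =
  if i == ord0 then (fvar C iz + fconst (p 0 ord0)) * (fvar C izb + fconst (p 0 ord0)^*)
  else h4 * (fvar C iw + fvar C iwb) + fconst ('Re (p 0 (lift ord0 ord0))).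
Proof.
rewrite /shift_arg; case: ifP => _.
  by rewrite rmorphM !raddfD /= !fps_of_mpolyX !fps_of_mpolyC.
by rewrite raddfD /= rmorphM raddfD /= !fps_of_mpolyX !fps_of_mpolyC.
Qed.

Lemma shift_arg0 : (fun i => fps_of_mpoly (shift_arg 0 i)) = iota_arg C.
Proof.
apply/funext => i; rewrite shift_argE /iota_arg !mxE.
have -> : 'Re (0 : C) = 0 by rewrite ReE conjC0 addr0 mul0r.
by rewrite conjC0 raddf0 !addr0.
Qed.

Lemma with_conjl Z i : with_conj Z (lshift 2 i) = Z 0 i.
Proof. by rewrite /with_conj row_mxEl. Qed.

Lemma with_conjr Z i : with_conj Z (rshift 2 i) = (Z 0 i)^*.
Proof. by rewrite /with_conj row_mxEr mxE. Qed.

Lemma norm_with_conj Z (r : R) : (forall i, `|Z 0 i| <= r%:K) ->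
  forall j, `|with_conj Z j| <= r%:K.
Proof.
move=> Zr j; rewrite -[j]splitK; case: (fintype.split j) => i /=.
  by rewrite with_conjl.
by rewrite with_conjr norm_conjC.
Qed.

Lemma meval_shift_arg p Z :
  (fun i => meval (with_conj (Z - p)) (shift_arg p i)) = real_arg Z.
Proof.
apply/funext => i; rewrite /shift_arg /real_arg; case: ifP => _.
  rewrite rmorphM !raddfD /= !mevalXU !mevalC with_conjl with_conjr !mxE.
  by rewrite rmorphB /= !subrK.
rewrite raddfD /= rmorphM raddfD /= !mevalXU !mevalC with_conjl with_conjr !mxE.
by rewrite !ReE rmorphB /= mulrC -mulrDl addrACA !subrK.
Qed.

(** The condition [rho <= 1] keeps the product |z|^2 within the radius [rho]. *)
Lemma bounded_shift_arg p (r rho : R) : 0 <= r -> rho <= 1 ->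
  (forall i, `|p 0 i| + r%:K <= rho%:K) ->
  forall i, bounded r rho (fps_of_mpoly (shift_arg p i)).
Proof.
move=> r0 rho1 pr i; rewrite shift_argE.
pose c i := ComplexField.Normc.normc (p 0 i).
have cr j : r + c j <= rho.
  by rewrite -ler_of_real of_realD addrC -norm_normc.
have rho0 : 0 <= rho.
  by apply: le_trans (cr ord0); rewrite addr_ge0 // -of_real_ge0 -norm_normc.
case: ifP => _.
  have E : rho * rho <= rho by rewrite ler_piMl.
  apply: (boundedW E); apply: (boundedM r0); apply: (boundedW (cr ord0));
    apply: (boundedD r0) (bounded_var r0 _) _; apply: bounded_const.
    by rewrite -norm_normc.
  by rewrite norm_conjC -norm_normc.
apply: (boundedW (cr (lift ord0 ord0))); apply: (boundedD r0); last first.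
  apply: bounded_const; rewrite -norm_normc.
  by case: (leif_normC_Re_Creal (p 0 (lift ord0 ord0))).
have E : 2^-1 * (r + r) <= r by rewrite mulrC mulrDl -splitr.
apply: (boundedW E); apply: (boundedM r0).
  apply: bounded_const.
  have -> : (2^-1 : R)%:K = 2^-1.
    exact: etrans (fmorphV (real_complex R) 2) (congr1 GRing.inv (rmorph_nat _ 2)).
  by rewrite ger0_norm // invr_ge0 ler0n.
by apply: (boundedD r0); apply: (bounded_var r0).
Qed.

(** The graph function depends on w and wbar only through w + wbar, so it contributes equally to
    their linear coefficients, whereas Im w contributes with opposite signs. *)
Lemma psubst_shift_arg_sym p q :
  psubst (fun i => fps_of_mpoly (shift_arg p i)) q (mnm1 iw) =
  psubst (fun i => fps_of_mpoly (shift_arg p i)) q (mnm1 iwb).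
Proof.
pattern (psubst (fun i => fps_of_mpoly (shift_arg p i)) q); apply: psubst_ind.
- by move=> c; rewrite !fconst_mnm1.
- move=> i; rewrite shift_argE; case: ifP => _.
    by rewrite !fmul_mnm1 !faddE !fvar_mnm1 !fconst_mnm1.
  by rewrite !faddE !fconstM !faddE !fvar_mnm1 !fconst_mnm1 /= [_ + 1%:R]addrC.
- by move=> f g fE gE; rewrite !faddE fE gE.
- by move=> f g fE gE; rewrite !fmul_mnm1 fE gE.
Qed.

Definition theta_poly p : mpoly (2 + 2) C :=
  mpolyC _ (- (2^-1 * 'i)) * (X iw - X iwb) + mpolyC _ ('Im (p 0 (lift ord0 ord0))).

Lemma theta_polyE p : fps_of_mpoly (theta_poly p) =
  - (h4 * I4) * (fvar C iw - fvar C iwb) + fconst ('Im (p 0 (lift ord0 ord0))).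
Proof.
rewrite raddfD /= rmorphM raddfB /= !fps_of_mpolyX !fps_of_mpolyC.
by rewrite opp_half_imag.
Qed.

Lemma meval_theta_poly p Z :
  meval (with_conj (Z - p)) (theta_poly p) = 'Im (Z 0 (lift ord0 ord0)).
Proof.
rewrite raddfD /= rmorphM raddfB /= !mevalXU !mevalC with_conjl with_conjr !mxE.
rewrite !ImE rmorphB /=; exact: im_shift.
Qed.

Lemma real_arg_bound Z (rho : R) : rho <= 1 -> (forall i, `|Z 0 i| <= rho%:K) ->
  forall i, `|real_arg Z i| <= rho%:K.
Proof.
move=> rho1 Zr i; rewrite /real_arg; case: ifP => _; last first.
  apply: le_trans (Zr (lift ord0 ord0)).
  by case: (leif_normC_Re_Creal (Z 0 (lift ord0 ord0))).
rewrite normrM norm_conjC; apply: le_trans (Zr ord0).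
rewrite ler_piMl //; apply: le_trans (Zr ord0) _.
by rewrite (ler_of_real _ 1).
Qed.

Lemma real_arg_real Z i : real_arg Z i \is Num.real.
Proof.
by rewrite /real_arg; case: ifP => _; rewrite ?Creal_Re // -normCK rpredX ?normr_real.
Qed.

Section Radius.
Variables (rho M : R).
Hypotheses (rho0 : 0 < rho) (rho1 : rho <= 1) (sM : bounded rho M s).

Lemma feval_graph_fun Z : (forall i, `|Z 0 i| <= rho%:K) ->
  feval (graph_fun C n) (real_arg Z) =
  'Re (Z 0 (lift ord0 ord0)) ^+ m * feval s (real_arg Z).
Proof.
move=> Zr; apply: has_fevalE; apply: (@has_feval_varXM _ _ (lift ord0 ord0) m s).
exact: bounded_has_feval (ltW rho0) sM (real_arg_bound rho1 Zr).
Qed.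

Lemma feval_sol_real Z : (forall i, `|Z 0 i| <= rho%:K) ->
  feval s (real_arg Z) \is Num.real.
Proof.
move=> Zr; apply: (has_feval_real (sol_real C n) (real_arg_real Z)).
exact: bounded_has_feval (ltW rho0) sM (real_arg_bound rho1 Zr).
Qed.

(** A real-analytic hypersurface needs a defining series at each of its points. This one is Im w
    minus the re-expanded graph function; its linear coefficients at w and wbar differ by - i, so
    they cannot both vanish. *)
Lemma local_theta p (r : R) : 0 < r -> (forall i, `|p 0 i| + r%:K <= rho%:K) ->
  exists (T : fps C (2 + 2)) N, [/\ exists j : 'I_(2 + 2), T (mnm1 j) <> 0, bounded r N T,
    forall Z, (forall i, `|Z 0 i - p 0 i| <= r%:K) ->
      has_feval T (with_conj (Z - p)) ('Im (Z 0 (lift ord0 ord0))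
        - 'Re (Z 0 (lift ord0 ord0)) ^+ m * feval s (real_arg Z)) &
    p = 0 -> T = theta_series C n].
Proof.
move=> r0 pr; have gM := bounded_varXM (ltW rho0) (lift ord0 ord0) m sM.
have [h [hS hE h0 hsym]] := recenter (ltW rho0) r0 gM
  (bounded_shift_arg (ltW r0) rho1 pr).
move: hS; set S := sup _ => hS.
have [N qN] := bounded_poly (ltW r0) (theta_poly p).
exists (fps_of_mpoly (theta_poly p) - h), (N + S).
split=> [||Z Zr|p0]; last first.
- have G1 i : ord_ge 1 (fps_of_mpoly (shift_arg p i)).
    have -> : fps_of_mpoly (shift_arg p i) = iota_arg C i.
      by rewrite p0; exact: (congr1 (fun F => F i) shift_arg0).
    exact: iota_arg_ord.
  have Im0 : 'Im (0 : C) = 0 by rewrite ImE conjC0 subrr mulr0 mul0r.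
  by rewrite (h0 G1) p0 shift_arg0 theta_polyE mxE Im0 raddf0 addr0.
- have Zrho i : `|Z 0 i| <= rho%:K.
    rewrite -[Z 0 i](subrK (p 0 i)) addrC; apply: le_trans (ler_normD _ _) _.
    by apply: le_trans (pr i); rewrite lerD2l.
  rewrite -(meval_theta_poly p); apply: has_fevalB; first exact: has_feval_poly.
  rewrite -feval_graph_fun // -(meval_shift_arg p) -hE.
    apply: (bounded_has_feval (ltW r0) hS); apply: norm_with_conj => i.
    by rewrite !mxE.
  by apply: norm_with_conj => i; rewrite !mxE.
- exact: (boundedB (ltW r0) qN hS).
set T := _ - h; have TE : T (mnm1 iw) - T (mnm1 iwb) = - 'i.
  rewrite /T !fsubE (hsym _ _ (psubst_shift_arg_sym p)) subr_subr subrr subr0 theta_polyE.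
  rewrite opp_half_imag !faddE !fconstM !fsubE !fvar_mnm1 !fconst_mnm1 !addr0 /= subr0 sub0r.
  by rewrite mulrN1 mulr1 opprK -opprD -mulrDl half_add mul1r.
have [T0|/eqP T0] := eqVneq (T (mnm1 iw)) 0; [exists iwb|by exists iw].
move=> T1; move: TE; rewrite T0 T1 subrr => /esym/eqP.
by rewrite oppr_eq0 (negbTE (neq0Ci C)).
Qed.

Lemma phi_series_eval : (exists N, bounded rho N (phi_series R n)) /\
  forall Z, (forall i, `|Z 0 i| <= rho%:K) ->
  feval (phi_series R n)
    (tnth [tuple Z 0 ord0; (Z 0 ord0)^*; 'Re (Z 0 (lift ord0 ord0))])
  = feval s (real_arg Z).
Proof.
have [i|h [hS hE h0 _]] := recenter (ltW rho0) rho0 sM (G := @phi_arg R).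
  rewrite phi_argE; case: ifP => _; last exact: bounded_var (ltW rho0) _.
  apply: (boundedW (M := rho * rho)); first by rewrite ler_piMl // ltW.
  by apply: (boundedM (ltW rho0)); apply: bounded_var (ltW rho0) _.
rewrite /phi_series -h0; last exact: phi_arg_ord.
split=> [|Z Zr]; first by exists (sup (range (fun d => rnorm rho d s))).
rewrite hE => [|i].
  congr feval; apply/funext => i; rewrite /phi_arg /real_arg; case: ifP => _.
    by rewrite rmorphM /= !mevalXU.
  by rewrite mevalXU.
case: i => [[|[|[|[]]]] ? //] /=.
- exact: Zr.
- by rewrite norm_conjC; apply: Zr.
apply: le_trans (Zr (lift ord0 ord0)).
by case: (leif_normC_Re_Creal (Z 0 (lift ord0 ord0))).
Qed.

End Radius.

Lemma polydisc_shrink p (rho : R) : polydisc 0 rho p ->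
  exists2 r : R, 0 < r & forall i, `|p 0 i| + r%:K <= rho%:K.
Proof.
move=> pr; pose c i := rho - ComplexField.Normc.normc (p 0 i).
have c0 i : 0 < c i.
  by rewrite subr_gt0 -ltr_of_real -norm_normc; have := pr i; rewrite mxE subr0.
exists (Num.min (c ord0) (c (lift ord0 ord0))) => [|i]; first by rewrite lt_min !c0.
rewrite norm_normc -of_realD ler_of_real -lerBrDl ge_min.
by case: (unliftP ord0 i) => [j|] ->; rewrite ?(ord1 j) lexx ?orbT.
Qed.

Lemma feval_fid (x : 'I_2 -> C) i : feval (fid C i) x = x i.
Proof.
apply: has_fevalE; have := @has_feval_poly R 2 (X i) x.
by rewrite fps_of_mpolyX mevalXU.
Qed.

Lemma fid_coordinates : local_holomorphic_coordinates (fid C).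
Proof.
split.
  have L2 (i : 'I_2) : ord_ge 2 (0 : fps C 2) by apply: ord_ge_zero.
  by rewrite -(lie_flow0 (fun=> 0)); apply: lie_flow_invertible.
move=> i; apply: (@bounded_convergent R 2 _ 1 1) => //.
exact: (bounded_var ler01).
Qed.

Theorem nonminimal_hypersurface : exists M : set 'rV[C]_2,
  [/\ real_analytic_hypersurface M, M 0, defining_series M 0 (theta_series C n) &
      nonminimal_at_origin m M].
Proof.
have [rho [B [rho0 rho1 sB]]] := sol_bounded R n.
have [[N phiN] phiE] := phi_series_eval rho0 rho1 sB.
(* The set is confined to an open polydisc on which the series of s is known to converge; openness
   leaves room for a smaller polydisc around each of its points. *)
pose M : set 'rV[C]_2 := [set Z | polydisc 0 rho Z /\ 'Im (Z 0 (lift ord0 ord0)) =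
  'Re (Z 0 (lift ord0 ord0)) ^+ m * feval s (real_arg Z)].
have polyE Z : polydisc 0 rho Z -> forall i, `|Z 0 i| <= rho%:K.
  by move=> Zr i; have := ltW (Zr i); rewrite mxE subr0.
have def p : polydisc 0 rho p ->
    exists T, defining_series M p T /\ (p = 0 -> T = theta_series C n).
  move=> prho; have [r r0 pr] := polydisc_shrink prho.
  have [T [B' [T1 TB TE T0]]] := local_theta rho0 rho1 sB r0 pr.
  exists T; split=> //; split=> //; exists r; split=> // Z Zr.
  have Zr' i : `|Z 0 i - p 0 i| <= r%:K by apply/ltW/Zr.
  have Zrho : polydisc 0 rho Z.
    move=> i; rewrite mxE subr0 -[Z 0 i](subrK (p 0 i)) addrC.
    apply: le_lt_trans (ler_normD _ _) _; apply: lt_le_trans (pr i).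
    by rewrite ltrD2l; apply: Zr.
  rewrite (has_fevalE (TE Z Zr')); split.
  - apply: (bounded_summable (ltW r0) TB); apply: norm_with_conj => i.
    by rewrite !mxE.
  - apply: rpredB; first exact: Creal_Im.
    apply: rpredM; first exact/rpredX/Creal_Re.
    by apply: (feval_sol_real rho0 rho1 sB); apply: polyE.
  split=> [[_ ->]|/eqP]; first by rewrite subrr.
  by rewrite subr_eq0 => /eqP.
have z0 : polydisc 0 rho 0.
  by move=> i; rewrite subrr normr0 (ltr_of_real 0).
have M0 : M 0.
  split=> //; rewrite !mxE.
  have -> : 'Im (0 : C) = 0 by rewrite ImE conjC0 subrr mulr0 mul0r.
  have -> : 'Re (0 : C) = 0 by rewrite ReE conjC0 addr0 mul0r.
  by rewrite expr0n mul0r.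
exists M; split=> //.
- by move=> p [/def[T [? _]] _]; exists T.
- by have [T [+ T0]] := def 0 z0; rewrite T0.
exists (fid C), (phi_series R n); split.
- exact: fid_coordinates.
- split; first exact: bounded_convergent rho0 phiN.
  exists rho; split=> // z u zr ur.
  pose Z : 'rV[C]_2 := \row_i (if i == ord0 then z else u%:K).
  have Zr i : `|Z 0 i| <= rho%:K.
    rewrite mxE; case: ifP => _; first exact: ltW.
    by apply/ltW; rewrite normc_def /= expr0n addr0 sqrtr_sqr ltr_of_real.
  have := phiE Z Zr; rewrite !mxE /= => E.
  have uE : u%:K = 'Re (u%:K : C) by apply/esym/Creal_ReP/complex_realP; exists u.
  by rewrite [in tnth _]uE E; apply: (feval_sol_real rho0 rho1 sB).
- exact: phi_no_pluriharmonic.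
- by exists 1%N, 1%N; apply: phi_neq0.
exists rho; split; first exact: rho0.
move=> Z Zr; cbv zeta.
have -> : feval (fid C 0) (Z 0) = Z 0 ord0 by exact: feval_fid.
have -> : feval (fid C 1) (Z 0) = Z 0 (lift ord0 ord0).
  by rewrite (_ : 1 = lift ord0 ord0) ?feval_fid //; apply: val_inj.
rewrite phiE; last exact: polyE.
by split=> [[_ ->//]|E]; split.
Qed.

End Hypersurface.

(** * Divergence *)

Section Inverse.
Variables (K : comNzRingType) (k n : nat).
Implicit Types (G : 'I_k -> fps K n) (p : mpoly k K).

Lemma ord_ge_mulB d (x x' y y' : fps K n) : ord_ge 1 x -> ord_ge d (y - y') ->
  ord_ge d (x - x') -> ord_ge 1 y' -> ord_ge d.+1 (x * y - x' * y').
Proof.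
move=> x1 yd xd y1; have -> : x * y - x' * y' = x * (y - y') + (x - x') * y'.
  by rewrite mulrBr mulrBl addrA subrK.
apply: ord_geD; first by rewrite -(add1n d); apply: ord_geM.
by rewrite -(addn1 d); apply: ord_geM.
Qed.

(** In a monomial of degree at least 2, a difference of order [d] in one factor is accompanied by
    another factor of order at least 1, so one degree is gained. *)
Lemma psubst_congr_ord2 d G G' p :
  (forall i, ord_ge 1 (G i)) -> (forall i, ord_ge 1 (G' i)) ->
  (forall i, ord_ge d (G i - G' i)) -> (forall a, (mdeg a < 2)%N -> mcoeff a p = 0) ->
  ord_ge d.+1 (psubst G p - psubst G' p).
Proof.
move=> G1 G'1 GG' p2.
have sumE (H : 'I_k -> fps K n) :
    psubst H p = \sum_(a <- msupp p) psubst H (mcoeff a p *: mpolyX K a).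
  by rewrite {1}[p]mpolyE raddf_sum.
rewrite (sumE G) (sumE G') -sumrB.
apply: ord_ge_sum => a _; have [/p2 ->|a2] := ltnP (mdeg a) 2.
  rewrite scale0r (raddf0 (psubst G)) (raddf0 (psubst G')).
  by rewrite subrr; apply: ord_ge_zero.
rewrite /= /psubst !mmapZ -mulrBr; apply: ord_geMr; rewrite -/(psubst _ _) -/(psubst _ _).
have [i ai] : exists i, a i != 0%N.
  apply/existsP; apply: contraLR a2; rewrite negb_exists => /forallP a0.
  rewrite (_ : a = mnm0) ?mdeg0 //; apply/mnmP => i; rewrite mnm0E.
  by apply/eqP; have := a0 i; rewrite negbK.
have [b ab] := multinomSP ai.
have b1 : (0 < mdeg b)%N by move: a2; rewrite ab mdegD mdeg1 addn1.
have -> : mpolyX K a = mpolyX K b * mpolyX K (mnm1 i) by rewrite ab mpolyXD.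
rewrite !rmorphM /= !psubstX.
apply: ord_ge_mulB; [|exact: GG'|exact: psubst_congr|exact: G'1].
apply: psubst_ord => // c; rewrite ltnS leqn0 mdeg_eq0 => /eqP ->.
rewrite mcoeffX (_ : b == mnm0 = false) //.
by apply/negbTE; rewrite -mdeg_eq0 -lt0n.
Qed.

End Inverse.

Section InverseBound.
Variables (R : realType) (k : nat).
Local Notation C := (Cplx R).
Local Notation "x %:K" := (of_real x) (at level 2, format "x %:K").

(** Terms of degree at least 2 shrink quadratically with the radius, which eventually beats the
    linear size of the polydisc. *)
Lemma fnorm_ord2 d (r rho : R) (h : fps C k) : 0 < rho -> rho <= r -> ord_ge 2 h ->
  fnorm rho%:K d h <= ((rho / r) ^+ 2)%:K * fnorm r%:K d h.
Proof.
move=> rho0 rhor h2; have r0 := lt_le_trans rho0 rhor.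
rewrite /fnorm mulr_sumr; apply: ler_sum => b _.
have [/h2 ->|b2] := ltnP (mdeg b) 2; first by rewrite normr0 !mul0r mulr0.
rewrite mulrCA ler_wpM2l // -!of_realX -of_realM ler_of_real.
have -> : (rho / r) ^+ 2 * r ^+ mdeg b = r ^+ (mdeg b - 2) * rho ^+ 2.
  by rewrite -{1}(subnK b2) exprD mulrCA -exprMn divfK // gt_eqF.
rewrite -{1}(subnK b2) exprD ler_wpM2r ?exprn_ge0 ?(ltW rho0) //.
by rewrite lerXn2r // nnegrE ltW.
Qed.

(* Since h has order 2, the terms of degree d + 1 of G = id - h o G depend only
   on the terms of degree at most d, and the majorant of h is contracting on a
   small polydisc. *)
Lemma inverse_bounded (G h : 'I_k -> fps C k) (r M : R) : 0 < r ->
  (forall i, ord_ge 1 (G i)) -> (forall i, ord_ge 2 (h i)) ->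
  (forall i, bounded r M (h i)) ->
  (forall i, fcomp (fvar C i + h i) G = fvar C i) ->
  exists2 rho : R, 0 < rho & forall i, bounded rho (rho + rho) (G i).
Proof.
move=> r0 G1 h2 hM inv.
have [rho rho0 hrho] : exists2 rho : R, 0 < rho &
    forall d i, fnorm (rho + rho)%:K d (h i) <= rho%:K.
  pose c := `|M| + 1; have c0 : 0 < c by rewrite ltr_wpDl.
  have hc d i : fnorm r%:K d (h i) <= c%:K.
    apply: le_trans (hM i d) _; rewrite ler_of_real (le_trans (ler_norm _)) //.
    by rewrite lerDl.
  have x0 : 0 < r ^+ 2 / (4 * c) by rewrite divr_gt0 ?exprn_gt0 ?mulr_gt0.
  (* With 2 rho <= r, the norm of h at radius 2 rho is at most (2 rho / r)^2 c, and this is at most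
     rho as soon as 4 c rho <= r^2. *)
  exists (Num.min (r / 2) (r ^+ 2 / (4 * c))) => [|d i].
    by rewrite lt_min x0 divr_gt0.
  set rho := Num.min _ _.
  have rho0 : 0 < rho by rewrite lt_min x0 divr_gt0.
  have rhor : rho + rho <= r.
    by rewrite [leRHS]splitr lerD // ge_min lexx.
  apply: le_trans (fnorm_ord2 d _ rhor (h2 i)) _; first by rewrite addr_gt0.
  apply: (@le_trans _ _ (((rho + rho) / r) ^+ 2 * c)%:K).
    by rewrite of_realM ler_wpM2l // of_real_ge0 exprn_ge0 // divr_ge0 ?addr_ge0 ?ltW.
  have rhox : rho * (4 * c) <= r ^+ 2.
    by rewrite -ler_pdivlMr ?mulr_gt0 // ge_min lexx orbT.
  rewrite ler_of_real expr_div_n mulrAC ler_pdivrMr ?exprn_gt0 //.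
  rewrite (_ : (rho + rho) ^+ 2 * c = rho * (rho * (4 * c))); last by ring.
  exact: (ler_wpM2l (ltW rho0)).
exists rho => // i d; elim: d i => [|d IHd] i.
  rewrite (@fnorm_eq _ _ _ 0 _ 0) ?subr0 //.
  rewrite -(raddf0 (@fconst C k)) fnormC normr0 of_real_ge0.
  by rewrite addr_ge0 // ltW.
have rho_ge0 : 0 <= rho%:K by rewrite of_real_ge0 ltW.
have GE : G i = fvar C i - fcomp (h i) G.
  rewrite -(inv i) (fhomD (fcomp_fhom G1)) (fcomp_var _ G1); apply/esym.
  exact: addrK.
pose G' i := fps_of_mpoly (ftrunc d (G i)).
have GG' j : ord_ge d.+1 (G j - G' j) by apply: ord_ge_trunc.
have G'1 j : ord_ge 1 (G' j).
  have -> : G' j = G j - (G j - G' j) by rewrite opprB addrC subrK.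
  by apply: ord_geB => //; apply: (@ord_geW _ _ d.+1).
rewrite {1}GE; apply: le_trans (fnormD _ _ _ rho_ge0) _; rewrite fnormN of_realD.
apply: lerD; first exact: fnorm_var.
rewrite (@fnorm_eq _ _ _ _ _ (psubst G' (ftrunc d.+1 (h i)))); last first.
  have -> : fcomp (h i) G - psubst G' (ftrunc d.+1 (h i)) =
     (fcomp (h i) G - psubst G (ftrunc d.+1 (h i))) +
     (psubst G (ftrunc d.+1 (h i)) - psubst G' (ftrunc d.+1 (h i))).
    by rewrite addrA subrK.
  apply: ord_geD; first exact: fcomp_trunc.
  apply: psubst_congr_ord2 => // a a2; rewrite mcoeff_ftrunc.
  by case: ifP => // _; apply: h2.
apply: le_trans (hrho d.+1 i); apply: fnorm_psubst => // j.
rewrite (fnorm_split _ _ (leqnSn d)) (_ : G' j - _ = 0).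
  rewrite -(raddf0 (@fconst C k)) fnormC normr0 addr0.
  by rewrite -(fnorm_eq _ (GG' j)).
apply/funext => a; rewrite fsubE /G' /fps_of_mpoly !mcoeff_ftrunc.
by case: ifP; rewrite ?subrr.
Qed.

End InverseBound.

Section FactorialGrowth.
Variable R : realType.
Local Notation C := (Cplx R).
Local Notation "x %:K" := (of_real x) (at level 2, format "x %:K").

(** The terms q^j / j! of the exponential series tend to 0. *)
Lemma factorial_beats (A q c : R) : 0 < c -> exists j, A * q ^+ j < c * j`!%:R.
Proof.
move=> c0; have /cvgrPdist_lt/(_ (c / (`|A| + 1))) h :=
  cvg_series_cvg_0 (is_cvg_series_exp_coeff q).
have A1 : 0 < `|A| + 1 by rewrite ltr_wpDl.
have [N _ /(_ N (leqnn N))] := h (divr_gt0 c0 A1); rewrite sub0r normrN => lt.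
exists N; have f0 : 0 < N`!%:R :> R by rewrite ltr0n fact_gt0.
rewrite -ltr_pdivrMr //; apply: le_lt_trans (ler_norm _) _.
move: lt; rewrite /exp_coeff /= ltr_pdivlMr // => lt.
apply: le_lt_trans lt; rewrite -mulrA normrM mulrC ler_wpM2l //.
by rewrite lerDl.
Qed.

(** Convergence gives Cauchy estimates, hence at most geometric growth in the degree. The degrees of
    the chosen monomials grow linearly in [j], so this contradicts factorial growth. *)
Lemma factorial_growth_divergent k (f : fps C k) (a : nat -> multinom k) (c : R) p n :
  0 < c -> (forall j, mdeg (a j) = p + j * n)%N ->
  (forall j, (c * j`!%:R)%:K <= `|f (a j)|) -> ~ convergent f.
Proof.
move=> c0 am fa /convergent_bounded[r [M [r0 fM]]].
have [j] := factorial_beats (M / r ^+ p) ((r ^+ n)^-1) c0; rewrite ltNge => /negP; apply.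
rewrite exprVn -exprM mulnC -mulrA -invfM -exprD -am ler_pdivlMr ?exprn_gt0 //.
rewrite -ler_of_real of_realM of_realX.
have r0' : 0 <= r%:K by rewrite of_real_ge0 ltW.
apply: le_trans (fM (mdeg (a j))); apply: le_trans (coef_le_fnorm _ r0' (leqnn _)).
by rewrite ler_wpM2r ?exprn_ge0.
Qed.

End FactorialGrowth.

Section Nonnegative.
Variable K : numFieldType.

Definition coef_nneg k (f : fps K k) := forall a, 0 <= f a.

Lemma coef_nnegM k (f g : fps K k) : coef_nneg f -> coef_nneg g -> coef_nneg (f * g).
Proof.
move=> f0 g0 a; rewrite -fmul_mulE fmulE; apply: sumr_ge0 => b _.
exact: mulr_ge0.
Qed.

Lemma coef_nneg_fderiv k i (f : fps K k) : coef_nneg f -> coef_nneg (fderiv i f).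
Proof. by move=> f0 a; rewrite /fderiv mulrn_wge0. Qed.

Lemma coef_nneg_const k c : 0 <= c -> coef_nneg (fconst c : fps K k).
Proof. by move=> c0 a; rewrite /fconst mulrn_wge0. Qed.

Lemma coef_nneg_var k i : coef_nneg (fvar K i : fps K k).
Proof. by move=> a; rewrite /fvar ler0n. Qed.

Lemma coef_nnegX k (f : fps K k) j : coef_nneg f -> coef_nneg (f ^+ j).
Proof.
move=> f0; elim: j => [|j IHj]; last by rewrite exprS; apply: coef_nnegM.
by rewrite expr0 -(rmorph1 (@fconst K k)); apply: coef_nneg_const.
Qed.

Lemma coef_nneg_vf k (V : 'I_k -> fps K k) f : (forall i, coef_nneg (V i)) ->
  coef_nneg f -> coef_nneg (vf V f).
Proof.
move=> V0 f0 a; rewrite /vf fsumE; apply: sumr_ge0 => i _.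
exact: (coef_nnegM (V0 i) (coef_nneg_fderiv i f0)).
Qed.

End Nonnegative.

Lemma bounded_radius (R : realType) k (r r' M : R) (f : fps (Cplx R) k) :
  0 <= r -> r <= r' -> bounded r' M f -> bounded r M f.
Proof.
move=> r0 rr' fM d; apply: le_trans (fM d); apply: ler_sum => b _.
by rewrite ler_wpM2l // lerXn2r ?nnegrE ?of_real_ge0 ?ler_of_real // (le_trans r0).
Qed.

(** * Divergence of the field and of its flow *)

Section Divergence.
Variables (R : realType) (n : nat).
Hypothesis n_gt0 : (0 < n)%N.
Local Notation C := (Cplx R).
Local Notation m := n.+1.
Local Notation L := (euler_field C n).
Local Notation iw := (lift ord0 ord0 : 'I_2).
Local Notation "x %:K" := (of_real x) (at level 2, format "x %:K").

Lemma euler_nneg : coef_nneg (euler C n).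
Proof. by move=> a; rewrite /euler mulrn_wge0. Qed.

Lemma fsubst_var_nneg (f : fps C 1) : coef_nneg f -> coef_nneg (fsubst (fvar C iw) f).
Proof. by move=> f0 a; rewrite fsubst_fvarE mulrn_wge0. Qed.

Lemma euler_field_nneg i : coef_nneg (L i).
Proof.
rewrite /euler_field; case: ifP => _; apply: coef_nnegM || apply: fsubst_var_nneg.
- apply: coef_nnegM; last exact: coef_nneg_var.
  by apply: coef_nneg_const; rewrite invr_ge0.
(* The definition of [euler_z] involves subtractions; in the form w^m B' nonnegativity of the
   coefficients is visible. *)
- apply: fsubst_var_nneg; rewrite /euler_z -(eulerE C n_gt0).
  apply: coef_nnegM; last exact/coef_nneg_fderiv/euler_nneg.
  exact/coef_nnegX/coef_nneg_var.
apply: coef_nnegM; last exact: euler_nneg.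
exact/coef_nnegX/coef_nneg_var.
Qed.

(** All terms of the Lie series have nonnegative coefficients, and t L is the term of index 1, which
    is present in the truncated sum because [a] has positive degree. *)
Lemma lie_flow_ge (t : C) i a : 0 <= t -> (0 < mdeg a)%N ->
  t * L i a <= lie_flow L t i a.
Proof.
move=> t0; rewrite /lie_flow /fexp; case: (mdeg a) => // d _.
have E0 k : 0 <= lie_coef L t k (fvar C i) a.
  apply: coef_nnegM => [|{a}].
    by apply: coef_nneg_const; rewrite divr_ge0 ?exprn_ge0.
  elim: k => [|k IHk] /=; first exact: coef_nneg_var.
  exact: (coef_nneg_vf euler_field_nneg IHk).
rewrite !big_ord_recl /= addrCA /lie_coef [X in _ <= X + _]fconstM /= vf_var.
rewrite expr1 fact0 divr1 lerDl addr_ge0 ?E0 //.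
by apply: sumr_ge0 => k _; apply: E0.
Qed.

Definition euler_mono j : multinom 2 := mnm_muln (mnm1 iw) (m + j * n).

Lemma mdeg_euler_mono j : mdeg (euler_mono j) = (m + j * n)%N.
Proof. by rewrite mdegMn mdeg1 mul1n. Qed.

Lemma euler_field_coef j : L iw (euler_mono j) = (euler_coef n j)%:R.
Proof.
rewrite euler_field_w coef1_varX leq_addr addKn coef1_euler mulnK // dvdn_mull //.
Qed.

Lemma euler_field_divergent : divergent L.
Proof.
exists iw; apply: (@factorial_growth_divergent _ _ _ euler_mono 1) => // j.
  exact: mdeg_euler_mono.
by rewrite euler_field_coef mul1r normr_nat of_real_nat ler_nat euler_coef_ge.
Qed.

Lemma lie_flow_growth (t : R) : 0 < t -> ~ convergent (lie_flow L t%:K iw).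
Proof.
move=> t0; apply: (@factorial_growth_divergent _ _ _ euler_mono t) => // j.
  exact: mdeg_euler_mono.
have t0' : 0 <= t%:K by rewrite of_real_ge0 ltW.
have d0 : (0 < mdeg (euler_mono j))%N by rewrite mdeg_euler_mono.
have := lie_flow_ge iw t0' d0; rewrite euler_field_coef => le.
rewrite ger0_norm; last by apply: le_trans le; rewrite mulr_ge0 ?ler0n.
apply: le_trans le; rewrite of_realM of_real_nat ler_wpM2l //.
by rewrite ler_nat euler_coef_ge.
Qed.

Lemma lie_flow_divergent (t : R) : t <> 0 -> divergent (lie_flow L t%:K).
Proof.
move=> /eqP; rewrite neq_lt => /orP[t0|t0]; last by exists iw; apply: lie_flow_growth.
apply: contrapT => /forallNP conv.
have L2 i : ord_ge 2 (L i) := euler_field_ord2 C n_gt0 i.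
pose h i := lie_flow L t%:K i - fvar C i.
have h2 i : ord_ge 2 (h i).
  move=> a a2; rewrite /h fsubE; case a0 : (mdeg a) a2 => [|[|//]] _.
    by rewrite lie_flow_ord ?a0 // (@ord_ge_var C 2 i) ?a0 // subr0.
  have [j ->] : exists j, a = mnm1 j by have /eqP/mdeg1P[j /eqP] := a0; exists j.
  by rewrite lie_flow_linear // fvar_mnm1 subrr.
have [r [M [r0 hM]]] : exists r M : R, 0 < r /\ forall i, bounded r M (h i).
  have cb i : exists r M : R, 0 < r /\ bounded r M (lie_flow L t%:K i).
    by apply: convergent_bounded; apply: contrapT; apply: conv.
  have [r1 [M1 [r10 b1]]] := cb ord0; have [r2 [M2 [r20 b2]]] := cb iw.
  pose r := Num.min r1 r2; have r0 : 0 < r by rewrite lt_min r10.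
  exists r, (Num.max M1 M2 + r); split=> // i.
  apply: (boundedB (ltW r0)) (bounded_var (ltW r0) i).
  case: (unliftP ord0 i) => [j|] ->; rewrite ?(ord1 j).
    apply: (boundedW (M := M2)); first by rewrite le_max lexx orbT.
    by apply: bounded_radius b2; rewrite ?(ltW r0) // ge_min lexx orbT.
  apply: (boundedW (M := M1)); first by rewrite le_max lexx.
  by apply: bounded_radius b1; rewrite ?(ltW r0) // ge_min lexx.
have inv i : fcomp (fvar C i + h i) (lie_flow L (- t)%:K) = fvar C i.
  rewrite /h addrC subrK.
  have := lie_flowD L2 t%:K (- t)%:K; rewrite -of_realD subrr => E.
  exact: (esym (congr1 (fun F : fmap2 C => F i) (etrans (esym (lie_flow0 L)) E))).
have [rho rho0 /(_ iw) bd] := inverse_bounded r0 (lie_flow_ord L2 (- t)%:K) h2 hM inv.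
by apply: (@lie_flow_growth (- t)); [rewrite oppr_gt0|exact: bounded_convergent bd].
Qed.

End Divergence.

(** * The Lie series as a formal flow *)

Lemma is_derive_horner (K : numFieldType) (p : {poly K}) (x : K) :
  is_derive x (1 : K) (horner p) p^`().[x].
Proof.
elim/poly_ind: p => [|p c IHp].
  have -> : horner (0 : {poly K}) = cst 0 by apply/funext => y; rewrite horner0.
  by rewrite deriv0 horner0; exact: is_derive_cst.
have -> : horner (p * 'X + c%:P) = horner p * id + cst c.
  by apply/funext => y; rewrite !hornerE.
rewrite derivD derivC addr0 derivM derivX mulr1 !hornerE.
have H := is_deriveD (is_deriveM IHp (is_derive_id x 1)) (is_derive_cst c x 1).
by apply: is_derive_eq H _; rewrite addr0 addrC mulrC; congr (_ + _); apply: mulr1.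
Qed.

Section FormalFlow.
Variables (R : realType) (L : fmap2 (Cplx R)).
Local Notation C := (Cplx R).
Hypothesis L2 : forall i, ord_ge 2 (L i).

(** Only finitely many iterates of the field reach a given degree, so each coefficient of the flow
    is a polynomial in time; this yields its holomorphy and its derivative at 0. *)
Definition flow_poly i (a : multinom 2) : {poly C} :=
  \poly_(k < (mdeg a).+1) (iter k (vf L) (fvar C i) a / k`!%:R).

Lemma lie_flow_poly (u : C) i a : lie_flow L u i a = (flow_poly i a).[u].
Proof.
rewrite horner_poly; apply: eq_bigr => k _.
by rewrite /lie_coef fconstM mulrC mulrA mulrAC.
Qed.

Lemma lie_flow_poly_deriv i a : (flow_poly i a)^`().[0] = L i a.
Proof.
rewrite horner_coef0 coef_deriv coef_poly mulr1n.
case: ltnP => [_|]; first by rewrite /= vf_var divr1.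
by rewrite ltnS leqn0 => /eqP a0; rewrite L2 // a0.
Qed.

Lemma lie_flow_formal_flow : formal_flow L (lie_flow L).
Proof.
have polyE i a : (fun u : C => lie_flow L u i a) = horner (flow_poly i a).
  by apply/funext => u; exact: lie_flow_poly.
split.
- exact: lie_flow_invertible.
- exact: lie_flow0.
- exact: lie_flowD.
- by move=> i a t; rewrite polyE; case: (is_derive_horner (flow_poly i a) t).
by move=> i a; rewrite polyE -lie_flow_poly_deriv; exact: is_derive_horner.
Qed.

End FormalFlow.

Theorem theoremB (R : realType) (m : nat) (hm : (2 <= m)%N) :
  exists (M : set 'rV[Cplx R]_2) (T : fps (Cplx R) (2 + 2)),
    [/\ real_analytic_hypersurface M,
        M 0,
        defining_series M 0 T,
        nonminimal_at_origin m M &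
        exists L : fmap2 (Cplx R),
          [/\ formal_infinitesimal_automorphism T L,
              divergent L,
              vanishes_to_order m L &
              exists (c : R) (H : Cplx R -> fmap2 (Cplx R)),
                formal_flow L H /\
                forall t : R, (forall k : int, t <> c * k%:~R) ->
                  formal_automorphism T (H (of_real t)) /\
                  divergent (H (of_real t))]].
Proof.
case: m hm => [//|n] n_gt0; have {}n_gt0 : (0 < n)%N by [].
have [M [Man M0 Mdef Mnm]] := nonminimal_hypersurface R n.
have L2 i : ord_ge 2 (euler_field (Cplx R) n i) := euler_field_ord2 (Cplx R) n_gt0 i.
have [l tan] := tangent_theta_series (Cplx R) n_gt0.
exists M, (theta_series (Cplx R) n); split=> //.
exists (euler_field (Cplx R) n); split.
- by exists l.
- exact: euler_field_divergent.
- exact: vanishes_euler_field.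
exists 0, (lie_flow (euler_field (Cplx R) n)); split; first exact: lie_flow_formal_flow.
move=> t t0; split.
  have tR : (of_real t : Cplx R)^* = of_real t.
    by apply/CrealP/complex_realP; exists t.
  apply: (lie_flow_automorphism L2 tR tan); first exact: theta_series0.
  by exists (lshift 2 (lift ord0 ord0)); apply: theta_series_w.
by apply: lie_flow_divergent => // tE; apply: (t0 0); rewrite mul0r.
Qed.
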